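(* Let $\mathbf k$ be a field, $\Gamma=(I,H)$ a finite quiver without 1-loops, $I=I_0\sqcup I_1$ a decomposition such that there are no arrows between vertices of $I_1$, and $\overline\Gamma=(\overline I,\overline H)$ the associated doubled quiver. Let $\alpha\in Q_I^+$ and $\overline\alpha=\phi(\alpha)\in Q^+_{\overline I}$. Then there is an algebra isomorphism $\Phi_{\alpha,\mathbf k}\colon R_{\alpha,\mathbf k}(\Gamma)\to S_{\overline\alpha,\mathbf k}(\overline\Gamma)$ from the KLR algebra of $(\Gamma,\alpha)$ to the balanced KLR algebra of $(\overline\Gamma,\overline\alpha)$ such that for all $\mathbf i\in I^\alpha$ and all $r$ $$e(\mathbf i)\mapsto e(\phi(\mathbf i)),\qquad x_re(\mathbf i)\mapsto x_r^*e(\phi(\mathbf i)),\qquad \tau_re(\mathbf i)\mapsto\tau_r^*e(\phi(\mathbf i)).$$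
   Context: **KLR algebra.** For a quiver with vertex set $I$ and no 1-loops let $h_{i,j}$ be the number of arrows from $i$ to $j$; $Q_I^+=\bigoplus_{i\in I}\mathbb N\alpha_i$ (with $0\in\mathbb N$). For $\alpha=\sum_{i}d_i\alpha_i$ put $|\alpha|=\sum d_i$ and $I^\alpha=\{\mathbf i\in I^{|\alpha|}:\sum_r\alpha_{i_r}=\alpha\}$. Put $Q_{i,j}(u,v)=0$ if $i=j$ and $(v-u)^{h_{i,j}}(u-v)^{h_{j,i}}$ if $i\neq j$. Let $s_r(\mathbf i)$ be $\mathbf i$ with $i_r,i_{r+1}$ exchanged. With $d=|\alpha|$, $R_{\alpha,\mathbf k}$ is the $\mathbf k$-algebra generated by $e(\mathbf i)$ ($\mathbf i\in I^\alpha$), $x_1,\dots,x_d$, $\tau_1,\dots,\tau_{d-1}$ with relations: $e(\mathbf i)e(\mathbf j)=\delta_{\mathbf i,\mathbf j}e(\mathbf i)$; $\sum_{\mathbf i}e(\mathbf i)=1$; $x_re(\mathbf i)=e(\mathbf i)x_r$; $\tau_re(\mathbf i)=e(s_r(\mathbf i))\tau_r$; $x_rx_s=x_sx_r$; $\tau_rx_{r+1}e(\mathbf i)=(x_r\tau_r+\delta_{i_r,i_{r+1}})e(\mathbf i)$; $x_{r+1}\tau_re(\mathbf i)=(\tau_rx_r+\delta_{i_r,i_{r+1}})e(\mathbf i)$; $\tau_rx_s=x_s\tau_r$ if $s\ne r,r+1$; $\tau_r\tau_s=\tau_s\tau_r$ if $|r-s|>1$; $\tau_r^2e(\mathbf i)=Q_{i_r,i_{r+1}}(x_r,x_{r+1})e(\mathbf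 i)$; $(\tau_{r+1}\tau_r\tau_{r+1}-\tau_r\tau_{r+1}\tau_r)e(\mathbf i)$ equals $(x_{r+2}-x_r)^{-1}\big(Q_{i_r,i_{r+1}}(x_{r+2},x_{r+1})-Q_{i_r,i_{r+1}}(x_r,x_{r+1})\big)e(\mathbf i)$ if $i_r=i_{r+2}$ and $0$ otherwise. **Doubled quiver.** $\overline I=\overline I_0\sqcup\overline I_1\sqcup\overline I_2$ with $\overline I_0=\{i^0:i\in I_0\}$, $\overline I_1=\{i^1:i\in I_1\}$, $\overline I_2=\{i^2:i\in I_1\}$. Arrows of $\overline\Gamma$: one $i^0\to j^0$ for each arrow $i\to j$ of $\Gamma$ with $i,j\in I_0$; one $i^0\to j^1$ for each arrow $i\to j$ with $i\in I_0$, $j\in I_1$; one $i^2\to j^0$ for each arrow $i\to j$ with $i\in I_1$, $j\in I_0$; one $i^1\to i^2$ for each $i\in I_1$. The map $\phi$ on finite sequences is the morphism of monoids (for concatenation) with $\phi(i)=i^0$ if $i\in I_0$ and $\phi(i)=(i^1,i^2)$ if $i\in I_1$; on $Q_I$ it is the linear map with $\phi(\alpha_i)=\alpha_{i^0}$ if $i\in I_0$, $\phi(\alpha_i)=\alpha_{i^1}+\alpha_{i^2}$ if $i\in I_1$. **Balanced KLR algebra.** A sequence $\mathbf i\in\overline I^{d}$ is *unordered* if for some $r\in[1,d]$ the sequence $(i_1,\dots,i_r)$ has strictly more entries in $\overline I_2$ than in $\overline I_1$; it is *well-ordered* if whenever $i_a=i^1$ for some $i\in I_1$ we have $a<d$ and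 $i_{a+1}=i^2$. Let $\overline I^{\overline\alpha}_{\rm un},\overline I^{\overline\alpha}_{\rm ord}$ be the sets of unordered, well-ordered sequences in $\overline I^{\overline\alpha}$, and $\mathbf e=\sum_{\mathbf i\in\overline I^{\overline\alpha}_{\rm ord}}e(\mathbf i)$. Then $S_{\overline\alpha,\mathbf k}(\overline\Gamma)=\mathbf eR_{\overline\alpha,\mathbf k}(\overline\Gamma)\mathbf e/\sum_{\mathbf i\in\overline I^{\overline\alpha}_{\rm un}}\mathbf eR_{\overline\alpha,\mathbf k}(\overline\Gamma)e(\mathbf i)R_{\overline\alpha,\mathbf k}(\overline\Gamma)\mathbf e$. **Elements $x_r^*,\tau_r^*$.** For $\mathbf i\in I^\alpha$ and $r\in[1,d]$ let $r'=r'_{\mathbf i}$ be $1$ plus the length of $\phi(i_1,\dots,i_{r-1})$. The elements $x_r^*,\tau_r^*\in S_{\overline\alpha,\mathbf k}$ are determined by $x_r^*e(\phi(\mathbf i))=x_{r'}e(\phi(\mathbf i))$ and $$\tau_r^*e(\phi(\mathbf i))=\begin{cases}\tau_{r'}e(\phi(\mathbf i))& i_r,i_{r+1}\in I_0,\\ \tau_{r'}\tau_{r'+1}e(\phi(\mathbf i))& i_r\in I_1,\,i_{r+1}\in I_0,\\ \tau_{r'+1}\tau_{r'}e(\phi(\mathbf i))& i_r\in I_0,\,i_{r+1}\in I_1,\\ \tau_{r'+1}\tau_{r'+2}\tau_{r'}\tau_{r'+1}e(\phi(\mathbf i))& i_r\neq i_{r+1}\text{ both in }I_1,\\ -\tau_{r'+1}\tau_{r'+2}\tau_{r'}\tau_{r'+1}e(\phi(\mathbf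 i))& i_r=i_{r+1}\in I_1.\end{cases}$$ *)

(* Defs.v *)
From HB Require Import structures.
From mathcomp Require Import all_boot all_order all_algebra perm.
From mathcomp.classical Require Import boolp.
From mathcomp.multinomials Require Import monalg mpoly.
Set Implicit Arguments. Unset Strict Implicit. Unset Printing Implicit Defensive.
Import GRing.Theory.
Local Open Scope ring_scope.
Local Open Scope quotient_scope.

(* MathComp's algType requires 1 != 0, which is not available in advance for
   algebras given by generators and relations, nor for corners and quotients.
   Hence a k-algebra is here a possibly zero ring with a central structure map
   pzscal; the induced scaling is pzscale, and it is declared as the lmodType
   structure of quotAlg below. *)
HB.mixin Record PzRing_isPzAlgebra (k : comPzRingType) A of GRing.PzRing A := {
  pzscal : k -> A;
  pzscal_zmod : zmod_morphism pzscal;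
  pzscal_monoid : monoid_morphism pzscal;
  pzscalC : forall (c : k) (a : A), pzscal c * a = a * pzscal c
}.
#[short(type="pzAlgType")]
HB.structure Definition PzAlgebra (k : comPzRingType) :=
  {A of PzRing_isPzAlgebra k A & GRing.PzRing A}.

Section Scale.
Variables (k : comPzRingType) (A : pzAlgType k).
HB.instance Definition _ :=
  GRing.isZmodMorphism.Build k A (@pzscal k A) (@pzscal_zmod k A).
HB.instance Definition _ :=
  GRing.isMonoidMorphism.Build k A (@pzscal k A) (@pzscal_monoid k A).
Implicit Types (c d : k) (a b : A).
Definition pzscale c a : A := pzscal c * a.
Lemma pzscaleA c d a : pzscale c (pzscale d a) = pzscale (c * d) a.
Proof. by rewrite /pzscale mulrA rmorphM. Qed.
Lemma pzscale1 : left_id 1 pzscale.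
Proof. by move=> a; rewrite /pzscale rmorph1 mul1r. Qed.
Lemma pzscaleDr : right_distributive pzscale +%R.
Proof. by move=> c a b; rewrite /pzscale mulrDr. Qed.
Lemma pzscaleDl a : {morph pzscale^~ a : c d / c + d}.
Proof. by move=> c d; rewrite /pzscale rmorphD mulrDl. Qed.
End Scale.

Record ideal (k : comPzRingType) (A : pzAlgType k) := Ideal {
  ideal_mem :> A -> Prop;
  ideal0 : ideal_mem 0;
  idealD : forall x y, ideal_mem x -> ideal_mem y -> ideal_mem (x + y);
  idealMl : forall a x, ideal_mem x -> ideal_mem (a * x);
  idealMr : forall x a, ideal_mem x -> ideal_mem (x * a)
}.

Section Quotient.
Variables (k : comPzRingType) (A : pzAlgType k) (J : ideal A).

Lemma idealN x : J x -> J (- x).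
Proof. by move=> Jx; rewrite -mulN1r; apply: idealMl. Qed.

Lemma idealB x y : J x -> J y -> J (x - y).
Proof. by move=> Jx Jy; apply: idealD => //; apply: idealN. Qed.

Definition cong : rel A := fun x y => `[< J (x - y) >].

Lemma cong_is_equiv : equiv_class_of cong.
Proof.
split=> [x|x y|y x z].
- by apply/asboolP; rewrite subrr; apply: ideal0.
- by apply/asbool_equiv_eq; split=> /idealN; rewrite opprB.
- move=> /asboolP Jxy /asboolP Jyz; apply/asboolP.
  by rewrite -[x](subrK y) -addrA; apply: idealD.
Qed.
Canonical cong_equiv := EquivRelPack cong_is_equiv.
Canonical cong_encModRel := defaultEncModRel cong.

Definition quotAlg := {eq_quot cong}.
HB.instance Definition _ : EqQuotient A cong quotAlg := EqQuotient.on quotAlg.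
HB.instance Definition _ := Choice.on quotAlg.

(* The operations are locked to keep unification from unfolding them. *)
Definition cls : A -> quotAlg := locked (fun a => \pi_quotAlg a).

Lemma clsP x y : cls x = cls y <-> J (x - y).
Proof.
rewrite /cls -lock; split=> [/eqP|Jxy]; first by rewrite piE => /asboolP.
by apply/eqP; rewrite piE; apply/asboolP.
Qed.

Lemma cls_repr (x : quotAlg) : cls (repr x) = x.
Proof. by rewrite /cls -lock reprK. Qed.

Lemma repr_cls a : J (repr (cls a) - a).
Proof. by apply/clsP; rewrite cls_repr. Qed.

Definition quot_opp := locked (fun x : quotAlg => cls (- repr x)).
Definition quot_add := locked (fun x y : quotAlg => cls (repr x + repr y)).
Definition quot_mul := locked (fun x y : quotAlg => cls (repr x * repr y)).

Lemma quot_oppE a : quot_opp (cls a) = cls (- a).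
Proof. by rewrite /quot_opp -lock; apply/clsP; rewrite -opprD; apply/idealN/repr_cls. Qed.

Lemma quot_addE a b : quot_add (cls a) (cls b) = cls (a + b).
Proof.
by rewrite /quot_add -lock; apply/clsP; rewrite opprD addrACA; apply: idealD; apply: repr_cls.
Qed.

Lemma quot_mulE a b : quot_mul (cls a) (cls b) = cls (a * b).
Proof.
rewrite /quot_mul -lock; apply/clsP; rewrite -[X in X - _](subrK (a * repr (cls b))) -addrA.
rewrite -mulrBl -mulrBr.
by apply: idealD; [apply/idealMr/repr_cls | apply/idealMl/repr_cls].
Qed.

Definition quotE := (quot_oppE, quot_addE, quot_mulE).

Lemma quot_addA : associative quot_add.
Proof.
by move=> x y z; rewrite -[x]cls_repr -[y]cls_repr -[z]cls_repr !quotE addrA.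
Qed.

Lemma quot_addC : commutative quot_add.
Proof. by move=> x y; rewrite -[x]cls_repr -[y]cls_repr !quotE addrC. Qed.

Lemma quot_add0 : left_id (cls 0) quot_add.
Proof. by move=> x; rewrite -[x]cls_repr !quotE add0r. Qed.

Lemma quot_addN : left_inverse (cls 0) quot_opp quot_add.
Proof. by move=> x; rewrite -[x]cls_repr !quotE addNr. Qed.

HB.instance Definition _ :=
  GRing.isZmodule.Build quotAlg quot_addA quot_addC quot_add0 quot_addN.

Lemma clsD a b : cls (a + b) = cls a + cls b.
Proof. exact/esym/quot_addE. Qed.

Lemma quot_mulA : associative quot_mul.
Proof.
by move=> x y z; rewrite -[x]cls_repr -[y]cls_repr -[z]cls_repr !quotE mulrA.
Qed.

Lemma quot_mul1l : left_id (cls 1) quot_mul.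
Proof. by move=> x; rewrite -[x]cls_repr !quotE mul1r. Qed.

Lemma quot_mul1r : right_id (cls 1) quot_mul.
Proof. by move=> x; rewrite -[x]cls_repr !quotE mulr1. Qed.

Lemma quot_mulDl : left_distributive quot_mul +%R.
Proof.
move=> x y z; rewrite -[x]cls_repr -[y]cls_repr -[z]cls_repr.
by rewrite -clsD !quotE mulrDl clsD.
Qed.

Lemma quot_mulDr : right_distributive quot_mul +%R.
Proof.
move=> x y z; rewrite -[x]cls_repr -[y]cls_repr -[z]cls_repr.
by rewrite -clsD !quotE mulrDr clsD.
Qed.

HB.instance Definition _ := GRing.Zmodule_isPzRing.Build quotAlg
  quot_mulA quot_mul1l quot_mul1r quot_mulDl quot_mulDr.

Lemma clsM a b : cls (a * b) = cls a * cls b.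
Proof. exact/esym/quot_mulE. Qed.

Lemma cls_is_zmod_morphism : zmod_morphism cls.
Proof.
move=> a b; rewrite clsD -[- b]mulN1r -[- cls b]mulN1r clsM; congr (_ + _ * _).
by apply/eqP; rewrite -addr_eq0 -clsD addNr.
Qed.
Lemma cls_is_monoid_morphism : monoid_morphism cls.
Proof. by split=> // a b; apply: clsM. Qed.
HB.instance Definition _ :=
  GRing.isZmodMorphism.Build A quotAlg cls cls_is_zmod_morphism.
HB.instance Definition _ :=
  GRing.isMonoidMorphism.Build A quotAlg cls cls_is_monoid_morphism.

Definition quot_scal : k -> quotAlg := fun c => cls (pzscal c).
Lemma quot_scal_zmod : zmod_morphism quot_scal.
Proof. by move=> c d; rewrite /quot_scal !rmorphB. Qed.
Lemma quot_scal_monoid : monoid_morphism quot_scal.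
Proof. by split=> [|c d]; rewrite /quot_scal ?rmorph1 ?rmorphM. Qed.
Lemma quot_scalC c x : quot_scal c * x = x * quot_scal c.
Proof. by rewrite -[x]cls_repr -!clsM pzscalC. Qed.
HB.instance Definition _ :=
  PzRing_isPzAlgebra.Build k quotAlg
  quot_scal_zmod quot_scal_monoid quot_scalC.
HB.instance Definition _ := GRing.Zmodule_isLmodule.Build k quotAlg
  (@pzscaleA k quotAlg) (@pzscale1 k quotAlg) (@pzscaleDr k quotAlg)
  (@pzscaleDl k quotAlg).
End Quotient.

Section Generated.
Variables (k : comPzRingType) (A : pzAlgType k) (P : A -> Prop).
Inductive ideal_gen_mem : A -> Prop :=
| ideal_gen_in x : P x -> ideal_gen_mem x
| ideal_gen0 : ideal_gen_mem 0
| ideal_genD x y : ideal_gen_mem x -> ideal_gen_mem y -> ideal_gen_mem (x + y)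
| ideal_genMl a x : ideal_gen_mem x -> ideal_gen_mem (a * x)
| ideal_genMr x a : ideal_gen_mem x -> ideal_gen_mem (x * a).
Definition ideal_gen : ideal A :=
  Ideal ideal_gen0 ideal_genD ideal_genMl ideal_genMr.
End Generated.


Record idempotent (k : comPzRingType) (A : pzAlgType k) :=
  Idempotent { idem_val :> A; idemP : idem_val * idem_val = idem_val }.

Section Corner.
Variables (k : comPzRingType) (A : pzAlgType k) (idem : idempotent A).
Local Notation e := (idem_val idem).

(* e A e, an algebra with unit e. *)
Definition in_corner : {pred A} := fun a => e * a * e == a.

Record corner := Corner { corner_val : A; _ : corner_val \in in_corner }.
HB.instance Definition _ := [isSub for corner_val].
HB.instance Definition _ := [Choice of corner by <:].

Lemma in_cornerP a : reflect (e * a * e = a) (a \in in_corner).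
Proof. exact: eqP. Qed.

Lemma in_corner_proj a : e * a * e \in in_corner.
Proof. by apply/in_cornerP; rewrite !mulrA idemP -mulrA idemP. Qed.

Lemma corner_mull a : a \in in_corner -> e * a = a.
Proof. by move/in_cornerP=> <-; rewrite !mulrA idemP. Qed.

Lemma corner_mulr a : a \in in_corner -> a * e = a.
Proof. by move/in_cornerP=> <-; rewrite -!mulrA idemP. Qed.

Lemma in_corner_zmod : zmod_closed in_corner.
Proof.
split=> [|a b ca cb]; apply/in_cornerP; first by rewrite mulr0 mul0r.
by rewrite mulrBr mulrBl (in_cornerP _ ca) (in_cornerP _ cb).
Qed.
HB.instance Definition _ := GRing.isZmodClosed.Build A in_corner in_corner_zmod.
HB.instance Definition _ := [SubChoice_isSubZmodule of corner by <:].

Lemma in_cornerM a b :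
  a \in in_corner -> b \in in_corner -> a * b \in in_corner.
Proof.
by move=> ca cb; apply/in_cornerP; rewrite mulrA corner_mull // -mulrA corner_mulr.
Qed.

Lemma in_corner1 : e \in in_corner.
Proof. by apply/in_cornerP; rewrite !idemP. Qed.

Definition corner_mul (a b : corner) := Corner (in_cornerM (valP a) (valP b)).
Definition corner_one := Corner in_corner1.

Lemma corner_mulA : associative corner_mul.
Proof. by move=> a b c; apply: val_inj; rewrite /= mulrA. Qed.
Lemma corner_mul1l : left_id corner_one corner_mul.
Proof. by move=> a; apply: val_inj; exact: corner_mull (valP a). Qed.
Lemma corner_mul1r : right_id corner_one corner_mul.
Proof. by move=> a; apply: val_inj; exact: corner_mulr (valP a). Qed.
Lemma corner_mulDl : left_distributive corner_mul +%R.
Proof. by move=> a b c; apply: val_inj; rewrite /= mulrDl. Qed.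
Lemma corner_mulDr : right_distributive corner_mul +%R.
Proof. by move=> a b c; apply: val_inj; rewrite /= mulrDr. Qed.
HB.instance Definition _ := GRing.Zmodule_isPzRing.Build corner
  corner_mulA corner_mul1l corner_mul1r corner_mulDl corner_mulDr.

Lemma corner_valM (a b : corner) : val (a * b) = val a * val b.
Proof. by []. Qed.

Lemma in_corner_scal (c : k) : pzscal c * e \in in_corner.
Proof.
by apply/in_cornerP; rewrite -[_ * e]mulrA -[pzscal c * e * e]mulrA idemP mulrA
  -pzscalC -mulrA idemP.
Qed.
Definition corner_scal (c : k) : corner := Corner (in_corner_scal c).

Lemma corner_scal_zmod : zmod_morphism corner_scal.
Proof. by move=> c d; apply: val_inj; rewrite /= rmorphB mulrBl. Qed.
Lemma corner_scal_monoid : monoid_morphism corner_scal.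
Proof.
split=> [|c d]; apply: val_inj; rewrite /= ?rmorph1 ?mul1r //.
by rewrite rmorphM -mulrA -[RHS]mulrA [e * _]mulrA -pzscalC -mulrA idemP.
Qed.
Lemma corner_scalC (c : k) (a : corner) : corner_scal c * a = a * corner_scal c.
Proof.
apply: val_inj; rewrite /= -mulrA (corner_mull (valP a)) [in RHS]pzscalC mulrA.
by rewrite (corner_mulr (valP a)) pzscalC.
Qed.
HB.instance Definition _ := PzRing_isPzAlgebra.Build k corner
  corner_scal_zmod corner_scal_monoid corner_scalC.

Section CornerIdeal.
Variables (T : Type) (f : T -> A) (P : pred T).
(* The sum over P t of e A (f t) A e, a product of subspaces being the span of
   the products of their elements. *)
Definition corner_ideal_mem (y : corner) : Prop :=
  exists s : seq (A * T * A), all (fun p => P p.1.2) s /\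
    val y = \sum_(p <- s) e * p.1.1 * f p.1.2 * p.2 * e.
Lemma corner_ideal0 : corner_ideal_mem 0.
Proof. by exists [::]; split=> //; rewrite big_nil. Qed.
Lemma corner_idealD x y :
  corner_ideal_mem x -> corner_ideal_mem y -> corner_ideal_mem (x + y).
Proof.
move=> [s [us xs]] [s' [us' ys]]; exists (s ++ s'); rewrite all_cat us us'.
by split=> //; rewrite big_cat -xs -ys.
Qed.
Lemma corner_idealMl a x : corner_ideal_mem x -> corner_ideal_mem (a * x).
Proof.
move=> [s [us xs]]; exists [seq (val a * e * p.1.1, p.1.2, p.2) | p <- s].
split; first by rewrite all_map.
rewrite corner_valM xs big_map mulr_sumr; apply: eq_bigr => p _ /=.
by rewrite !mulrA (corner_mull (valP a)).
Qed.
Lemma corner_idealMr x a : corner_ideal_mem x -> corner_ideal_mem (x * a).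
Proof.
move=> [s [us xs]]; exists [seq (p.1.1, p.1.2, p.2 * e * val a) | p <- s].
split; first by rewrite all_map.
rewrite corner_valM xs big_map mulr_suml; apply: eq_bigr => p _ /=.
by rewrite -!mulrA (corner_mulr (valP a)).
Qed.
Definition corner_ideal : ideal corner :=
  Ideal corner_ideal0 corner_idealD corner_idealMl corner_idealMr.
End CornerIdeal.
End Corner.

Section FreeAlgebra.
Variables (k : comNzRingType) (X : choiceType).

Definition free_alg := {malg k[{fmonom X}]}.
HB.instance Definition _ := GRing.Lalgebra.on free_alg.

Let free_scal : k -> free_alg := @malgC {fmonom X} k.
Lemma free_scal_zmod : zmod_morphism free_scal.
Proof. exact: rmorphB. Qed.
Lemma free_scal_monoid : monoid_morphism free_scal.
Proof. by split; [exact: rmorph1 | exact: rmorphM]. Qed.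
Lemma free_scalC (c : k) (a : free_alg) : free_scal c * a = a * free_scal c.
Proof.
rewrite mul_malgC malgM_def malgZ_def fgmulgU.
by apply: eq_bigr => w _; rewrite mulm1 mulrC.
Qed.
HB.instance Definition _ := PzRing_isPzAlgebra.Build k free_alg
  free_scal_zmod free_scal_monoid free_scalC.

Definition free_gen : X -> free_alg := locked (fun x => << fmu x >>).
End FreeAlgebra.

Record quiver := Quiver {
  vertex :> finType;
  arrow : finType;
  source : arrow -> vertex;
  target : arrow -> vertex
}.

Definition narrows (G : quiver) (i j : G) : nat :=
  #|[pred a : arrow G | (source a == i) && (target a == j)]|.

(* Q_{i,j}(u, v), in an arbitrary ring; in the free algebra below the order of
   the two factors is immaterial modulo the relations. *)
Definition Qpol (G : quiver) (A : pzRingType) (i j : G) (u v : A) : A :=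
  if i == j then 0 else (v - u) ^+ narrows i j * (u - v) ^+ narrows j i.

Section Weights.
Variable I : finType.

(* A weight alpha : {ffun I -> nat} is the element sum_i (alpha i) alpha_i of
   Q_I^+; height alpha is |alpha| and wseq alpha is I^alpha. *)
Definition height (alpha : {ffun I -> nat}) : nat := (\sum_i alpha i)%N.

Definition wseq (alpha : {ffun I -> nat}) :=
  {t : (height alpha).-tuple I | [forall i, count_mem i t == alpha i]}.

Lemma size_weight (alpha : {ffun I -> nat}) (s : seq I) :
  (forall i, count_mem i s = alpha i) -> size s = height alpha.
Proof.
move=> cs; rewrite /height -(eq_bigr _ (fun i _ => cs i)).
elim: s {cs} => [|j s IHs] /=; first by rewrite big1.
by rewrite big_split /= -IHs (bigD1 j) //= eqxx big1 // => i /negPf; rewrite eq_sym => ->.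
Qed.

(* Positions are 0-based: for r : 'I_n.-1, lo r and hi r are the positions
   written r and r + 1 in the usual 1-based notation. *)
Definition lo n (r : 'I_n.-1) : 'I_n := widen_ord (leq_pred n) r.
Lemma hi_subproof n (r : 'I_n.-1) : (r.+1 < n)%N.
Proof. by case: n r => [|n] [] //=. Qed.
Definition hi n (r : 'I_n.-1) : 'I_n := Ordinal (hi_subproof r).

Definition swap_tuple n (r : 'I_n.-1) (t : n.-tuple I) : n.-tuple I :=
  [tuple tnth t (tperm (lo r) (hi r) p) | p < n].

Lemma swap_subproof alpha (r : 'I_(height alpha).-1) (t : wseq alpha) :
  [forall i, count_mem i (swap_tuple r (val t)) == alpha i].
Proof.
apply/forallP=> i; rewrite -(eqP (forallP (valP t) i)); apply/eqP.
by apply/seq.permP; apply/tuple_permP; exists (tperm (lo r) (hi r)).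
Qed.
Definition swap alpha (r : 'I_(height alpha).-1) (t : wseq alpha) : wseq alpha :=
  Sub (swap_tuple r (val t)) (swap_subproof r t).
End Weights.

Section KLR.
Variables (k : fieldType) (G : quiver) (alpha : {ffun G -> nat}).
Let d := height alpha.

Definition klr_gen : choiceType := (wseq alpha + 'I_d + 'I_d.-1)%type.
Local Notation F := (free_alg k klr_gen).
Local Notation e i := (free_gen k (inl (inl i) : klr_gen)).
Local Notation x r := (free_gen k (inl (inr r) : klr_gen)).
Local Notation tau r := (free_gen k (inr r : klr_gen)).
Local Notation "i `_[ p ]" := (tnth (val i) p) (at level 3).

(* D(a, b, c); in the free algebra a, b, c do not commute, but the choice of an
   ordering of monomials made by mmap is immaterial modulo the relations. *)
Definition ev3 (D : mpoly 3 k) (a b c : F) : F :=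
  mmap (fun z => z%:A) (tnth [tuple a; b; c]) D.

(* D = (w - u)^-1 (Q_{i,j}(w, v) - Q_{i,j}(u, v)) in k[u, v, w]; it exists and
   is unique by the two lemmas below. *)
Definition is_divdiff (i j : G) (D : mpoly 3 k) : Prop :=
  let u : mpoly 3 k := 'X_(Ordinal (isT : 0 < 3)%N) in
  let v : mpoly 3 k := 'X_(Ordinal (isT : 1 < 3)%N) in
  let w : mpoly 3 k := 'X_(Ordinal (isT : 2 < 3)%N) in
  (w - u) * D = Qpol i j w v - Qpol i j u v.

Lemma divdiff_exists i j : exists D, is_divdiff i j D.
Proof.
rewrite /is_divdiff /Qpol; case: eqP => [_|_].
  by exists 0; rewrite mulr0 subr0.
set u : mpoly 3 k := 'X_(Ordinal (isT : 0 < 3)%N).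
set v : mpoly 3 k := 'X_(Ordinal (isT : 1 < 3)%N).
set w : mpoly 3 k := 'X_(Ordinal (isT : 2 < 3)%N).
rewrite /=.
set a := narrows i j; set b := narrows j i.
have E z : (v - z) ^+ a * (z - v) ^+ b = (-1) ^+ a * (z - v) ^+ (a + b).
  by rewrite -[v - z]opprB (exprNn (z - v)) exprD mulrA.
exists ((-1) ^+ a * \sum_(p < a + b) (w - v) ^+ ((a + b).-1 - p) * (u - v) ^+ p).
by rewrite !E -mulrBr subrXX opprB addrA subrK mulrCA.
Qed.

Lemma divdiff_uniq i j D D' : is_divdiff i j D -> is_divdiff i j D' -> D = D'.
Proof.
move=> /= Dd D'd; apply: (mulfI _ (etrans Dd (esym D'd))).
rewrite subr_eq0; apply/eqP => /(congr1 (mcoeff U_(Ordinal (isT : 0 < 3)%N))).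
by rewrite !mcoeffXU eqxx /= => /eqP; rewrite eq_sym oner_eq0.
Qed.

Inductive klr_rel : F -> F -> Prop :=
| klr_ee i j : klr_rel (e i * e j) (if i == j then e i else 0)
| klr_sum_e : klr_rel (\sum_i e i) 1
| klr_xe r i : klr_rel (x r * e i) (e i * x r)
| klr_te r i : klr_rel (tau r * e i) (e (swap r i) * tau r)
| klr_xx r s : klr_rel (x r * x s) (x s * x r)
| klr_tx_hi r i :
    klr_rel (tau r * x (hi r) * e i)
            ((x (lo r) * tau r + (i`_[lo r] == i`_[hi r])%:R) * e i)
| klr_xt_hi r i :
    klr_rel (x (hi r) * tau r * e i)
            ((tau r * x (lo r) + (i`_[lo r] == i`_[hi r])%:R) * e i)
| klr_tx r s : s != lo r -> s != hi r -> klr_rel (tau r * x s) (x s * tau r)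
| klr_tt (r s : 'I_d.-1) : (r.+1 < s)%N || (s.+1 < r)%N ->
    klr_rel (tau r * tau s) (tau s * tau r)
| klr_tau2 r i :
    klr_rel (tau r * tau r * e i)
            (Qpol i`_[lo r] i`_[hi r] (x (lo r)) (x (hi r)) * e i)
| klr_braid_eq (r s : 'I_d.-1) i D : s = r.+1 :> nat ->
    i`_[lo r] = i`_[hi s] -> is_divdiff i`_[lo r] i`_[hi r] D ->
    klr_rel ((tau s * tau r * tau s - tau r * tau s * tau r) * e i)
            (ev3 D (x (lo r)) (x (hi r)) (x (hi s)) * e i)
| klr_braid_neq (r s : 'I_d.-1) i : s = r.+1 :> nat ->
    i`_[lo r] != i`_[hi s] ->
    klr_rel ((tau s * tau r * tau s - tau r * tau s * tau r) * e i) 0.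

Definition klr := quotAlg
  (ideal_gen (fun f : F => exists a b, klr_rel a b /\ f = a - b)).

HB.instance Definition _ := PzAlgebra.on klr.
HB.instance Definition _ := GRing.Lmodule.on klr.

Definition klr_e (i : wseq alpha) : klr := cls _ (e i).
Definition klr_x (r : 'I_d) : klr := cls _ (x r).
Definition klr_tau (r : 'I_d.-1) : klr := cls _ (tau r).

Lemma klr_relE a b : klr_rel a b -> cls _ a = cls _ b :> klr.
Proof. by move=> ab; apply/clsP; apply: ideal_gen_in; exists a, b. Qed.

Lemma klr_eM i j : klr_e i * klr_e j = if i == j then klr_e i else 0.
Proof.
by rewrite /klr_e -clsM (klr_relE (klr_ee _ _)); case: eqP.
Qed.
Lemma klr_xeC r i : klr_x r * klr_e i = klr_e i * klr_x r.
Proof. by rewrite /klr_x -!clsM; apply/klr_relE/klr_xe. Qed.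

(* x and tau at a natural number index, 0 out of range; the indices used below
   are in range by pos_x_lt and pos_tau_lt. *)
Definition klr_xn (n : nat) : klr := oapp klr_x 0 (insub n).
Definition klr_taun (n : nat) : klr := oapp klr_tau 0 (insub n).
Lemma klr_xnC n i : klr_xn n * klr_e i = klr_e i * klr_xn n.
Proof.
rewrite /klr_xn; case: insub => [r|]; first exact: klr_xeC.
by rewrite /oapp mul0r mulr0.
Qed.

Lemma klr_teC r i : klr_tau r * klr_e i = klr_e (swap r i) * klr_tau r.
Proof. by rewrite /klr_tau -!clsM; apply/klr_relE/klr_te. Qed.

End KLR.

Arguments klr_e {k G alpha} i.
Arguments klr_x {k G alpha} r.
Arguments klr_tau {k G alpha} r.
Arguments klr_xn {k G alpha} n.
Arguments klr_taun {k G alpha} n.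

(* The decomposition of the vertex set is I = I0 + I1 with I0 := ~: I1. *)
Section Doubling.
Variables (G : quiver) (I1 : {set G}).

Definition vert0 := {i : G | i \notin I1}.
Definition vert1 := {i : G | i \in I1}.
Definition dvert : finType := (vert0 + vert1 + vert1)%type.
Definition v0 (i : vert0) : dvert := inl (inl i).
Definition v1 (i : vert1) : dvert := inl (inr i).
Definition v2 (i : vert1) : dvert := inr i.

Definition is1 (v : dvert) : bool := if v is inl (inr _) then true else false.
Definition is2 (v : dvert) : bool := if v is inr _ then true else false.

Definition split_vert (i : G) : vert0 + vert1 :=
  match boolP (i \in I1) with
  | AltTrue i1 => inr (exist _ i i1)
  | AltFalse i0 => inl (exist _ i i0)
  end.

Lemma split_vertK (i : G) :
  match split_vert i with inl a => val a | inr a => val a end = i.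
Proof. by rewrite /split_vert; case: {-}_ / boolP. Qed.

Definition phi1 (i : G) : seq dvert :=
  match split_vert i with inl a => [:: v0 a] | inr a => [:: v1 a; v2 a] end.
Definition phi (s : seq G) : seq dvert := flatten (map phi1 s).

(* For an arrow i -> j of G, the corresponding arrow of the doubled quiver goes
   from vsrc i (i^0 or i^2) to vtgt j (j^0 or j^1). When no arrow has both ends
   in I1, as will be assumed, this gives exactly the three families i^0 -> j^0,
   i^0 -> j^1, i^2 -> j^0; the arrows i^1 -> i^2 are added separately. *)
Definition vsrc (i : G) : dvert :=
  match split_vert i with inl a => v0 a | inr a => v2 a end.
Definition vtgt (i : G) : dvert :=
  match split_vert i with inl a => v0 a | inr a => v1 a end.

Definition dquiver : quiver := @Quiver dvert (arrow G + vert1)%type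
  (fun a => match a with inl h => vsrc (source h) | inr i => v1 i end)
  (fun a => match a with inl h => vtgt (target h) | inr i => v2 i end).

Definition base (v : dvert) : G :=
  match v with inl (inl i) => val i | inl (inr i) => val i | inr i => val i end.

(* phi on weights: alpha_i goes to alpha_{i^0}, resp. alpha_{i^1} + alpha_{i^2},
   so the coefficient at v is the coefficient of alpha at the vertex under v. *)
Definition phiW (alpha : {ffun G -> nat}) : {ffun dquiver -> nat} :=
  [ffun v : dvert => alpha (base v)].

Lemma phiK s : map base (filter (predC is2) (phi s)) = s.
Proof.
elim: s => //= j s IHs.
rewrite -/(phi s) filter_cat map_cat IHs /phi1.
by case: (split_vert j) (split_vertK j) => a /= ->.
Qed.

Lemma count_phi1 (v : dvert) j : count_mem v (phi1 j) = (j == base v).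
Proof.
rewrite /phi1; case: (split_vert j) (split_vertK j) => -[i ji] /= <-;
  case: v => [[l|l]|l] //=; rewrite ?addn0 ?add0n //.
all: by case: eqP => // il; move: (valP l); rewrite /= -il ?ji ?(negPf ji).
Qed.

Lemma count_phi (v : dvert) s : count_mem v (phi s) = count_mem (base v) s.
Proof. by elim: s => //= j s IHs; rewrite count_cat IHs count_phi1. Qed.

Lemma phi_count alpha (t : wseq alpha) :
  forall v, count_mem v (phi (val t)) = phiW alpha v.
Proof. by move=> v; rewrite ffunE count_phi (eqP (forallP (valP t) _)). Qed.

Lemma phi_size alpha (t : wseq alpha) :
  size (phi (val t)) == height (phiW alpha).
Proof. by apply/eqP/size_weight/phi_count. Qed.

Lemma phi_mem alpha (t : wseq alpha) :
  [forall v, count_mem v (Tuple (phi_size t)) == phiW alpha v].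
Proof. by apply/forallP=> v; apply/eqP/phi_count. Qed.

Definition phiS alpha (t : wseq alpha) : wseq (phiW alpha) :=
  Sub (Tuple (phi_size t)) (phi_mem t).
End Doubling.
Arguments is1 {G I1} v.
Arguments is2 {G I1} v.

Section Balanced.
Variables (k : fieldType) (G : quiver) (I1 : {set G}).
Variable beta : {ffun dquiver I1 -> nat}.
Local Notation R := (klr k beta).

Definition unordered (t : wseq beta) : bool :=
  [exists r : 'I_(height beta),
    (count is1 (take r.+1 (val t)) < count is2 (take r.+1 (val t)))%N].

Definition well_ordered (t : wseq beta) : bool :=
  [forall a : 'I_(height beta), forall i : vert1 I1,
    (tnth (val t) a == v1 i) ==> (onth (val t) a.+1 == Some (v2 i))].

Definition e_ord : R := \sum_(t | well_ordered t) klr_e t.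
Lemma e_ord_e t : well_ordered t -> e_ord * klr_e t = klr_e t.
Proof.
move=> wt; rewrite mulr_suml (bigD1 t) //= klr_eM eqxx big1 ?addr0 // => u.
by case/andP=> _ /negPf ut; rewrite klr_eM ut.
Qed.
Lemma e_e_ord t : well_ordered t -> klr_e t * e_ord = klr_e t.
Proof.
move=> wt; rewrite mulr_sumr (bigD1 t) //= klr_eM eqxx big1 ?addr0 // => u.
by case/andP=> _ /negPf ut; rewrite klr_eM eq_sym ut.
Qed.

Lemma e_ord_idem : e_ord * e_ord = e_ord.
Proof. by rewrite {2}/e_ord mulr_sumr; apply: eq_bigr => t /e_ord_e. Qed.
Definition idem_ord := Idempotent e_ord_idem.

Definition bal_ideal : ideal (corner idem_ord) :=
  corner_ideal idem_ord klr_e unordered.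

Definition bal_klr := quotAlg bal_ideal.
HB.instance Definition _ := PzAlgebra.on bal_klr.
HB.instance Definition _ := GRing.Lmodule.on bal_klr.

Lemma in_corner_e a u u' : well_ordered u -> well_ordered u' ->
  a * klr_e u = klr_e u' * a -> a * klr_e u \in in_corner idem_ord.
Proof.
move=> wu wu' au; apply/in_cornerP; rewrite /= au mulrA e_ord_e //.
by rewrite -au -mulrA e_e_ord.
Qed.
End Balanced.

Section Star.
Variables (k : fieldType) (G : quiver) (I1 : {set G}) (alpha : {ffun G -> nat}).
Local Notation R := (klr k (phiW I1 alpha)).
Local Notation S := (bal_klr k (phiW I1 alpha)).
Local Notation C := (corner (idem_ord k (phiW I1 alpha))).
Local Notation e t := (klr_e (phiS I1 t) : R).
Local Notation x n := (klr_xn n : R).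
Local Notation tau n := (klr_taun n : R).
Implicit Types (t : wseq alpha).

(* 0-based version of r'. *)
Definition pos t (r : nat) : nat := size (phi I1 (take r (val t))).

Definition x_elt t (r : 'I_(height alpha)) : R := x (pos t r) * e t.

Definition tau_elt t (r : 'I_(height alpha).-1) : R :=
  let n := pos t r in
  let i := tnth (val t) (lo r) in let j := tnth (val t) (hi r) in
  match i \in I1, j \in I1 with
  | false, false => tau n * e t
  | true, false => tau n * tau n.+1 * e t
  | false, true => tau n.+1 * tau n * e t
  | true, true =>
      let a := tau n.+1 * tau n.+2 * tau n * tau n.+1 * e t in
      if i == j then - a else a
  end.

Lemma phi_onth l n (i : vert1 I1) :
  onth (phi I1 l) n = Some (v1 i) -> onth (phi I1 l) n.+1 = Some (v2 i).
Proof.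
elim: l n => [|j l IH] n; first by rewrite onth0n.
rewrite [phi _ (j :: l)]/(phi1 I1 j ++ phi I1 l) /phi1.
case: (split_vert I1 j) => a; case: n => [|n] //=.
- by move=> /IH.
- by case=> ->.
- by case: n => [|n] // /IH.
Qed.

Lemma phi_well_ordered l (u : wseq (phiW I1 alpha)) :
  phi I1 l = val u :> seq _ -> well_ordered u.
Proof.
move=> lu; apply/forallP=> a; apply/forallP=> i; apply/implyP=> /eqP ua.
by rewrite -lu; apply/eqP/phi_onth; rewrite lu; apply/tnth_onth.
Qed.

Lemma tau_swap (u : wseq (phiW I1 alpha)) n p a b q :
  size p = n -> val u = p ++ a :: b :: q :> seq _ ->
  exists2 u' : wseq (phiW I1 alpha), val u' = p ++ b :: a :: q :> seq _ &
    tau n * klr_e u = klr_e u' * tau n.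
Proof.
move=> <- {n} uE.
have lt_p : (size p < (height (phiW I1 alpha)).-1)%N.
  by rewrite -(size_tuple (val u)) uE size_cat /= !addnS ltnS leq_addr.
pose r := Ordinal lt_p; exists (swap r u); last first.
  by rewrite /klr_taun insubT /= klr_teC.
have tE o : tnth (val u) o = nth a (p ++ a :: b :: q) o.
  by rewrite (tnth_nth a) uE.
apply: (@eq_from_nth _ a) => [|n].
  by rewrite size_tuple -(size_tuple (val u)) uE !size_cat.
rewrite size_tuple => lt_n; rewrite -(tnth_nth a _ (Ordinal lt_n)) tnth_mktuple.
rewrite tE !nth_cat; case: tpermP => [/(congr1 val)/= ->|/(congr1 val)/= ->|].
- by rewrite /= ltnNge leqnSn /= subSnn ltnn subnn.
- by rewrite /= ltnn subnn ltnNge leqnSn /= subSnn.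
move=> /eqP + /eqP +; rewrite -!val_eqE /= => n1 n2.
case: ltnP => // le_pn; case E: (n - size p)%N => [|[|m]] //=.
- by move: n1; rewrite eqn_leq le_pn -subn_eq0 E.
- by move: n2; rewrite -(subnKC le_pn) E addn1 eqxx.
Qed.

Lemma wseq_split t (r : 'I_(height alpha).-1) :
  val t = take r (val t) ++ tnth (val t) (lo r) :: tnth (val t) (hi r) ::
    drop r.+2 (val t) :> seq _.
Proof.
have [x0 _] : {x0 : G | true} by exists (tnth (val t) (lo r)).
rewrite (tnth_nth x0 _ (lo r)) (tnth_nth x0 _ (hi r)) /=.
rewrite -drop_nth ?size_tuple ?hi_subproof // -drop_nth ?cat_take_drop //.
by rewrite size_tuple ltnW ?hi_subproof.
Qed.

Lemma phi_cat l l' : phi I1 (l ++ l') = phi I1 l ++ phi I1 l'.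
Proof. by rewrite /phi map_cat flatten_cat. Qed.

Lemma phi_cons i l : phi I1 (i :: l) = phi1 I1 i ++ phi I1 l.
Proof. by []. Qed.

Lemma phiS_well_ordered t : well_ordered (phiS I1 t).
Proof. exact: (@phi_well_ordered (val t)). Qed.

Lemma x_elt_corner t r : x_elt t r \in in_corner (idem_ord k (phiW I1 alpha)).
Proof.
rewrite /x_elt; apply: (in_corner_e (u' := phiS I1 t)); rewrite ?phiS_well_ordered //.
exact: klr_xnC.
Qed.

Lemma e_corner t : klr_e (phiS I1 t) \in in_corner (idem_ord k (phiW I1 alpha)).
Proof.
rewrite -[klr_e _]mul1r; have wt := phiS_well_ordered t.
by apply: (in_corner_e wt wt); rewrite mul1r mulr1.
Qed.

Lemma phi1_in i : i \in I1 -> exists a, phi1 I1 i = [:: v1 a; v2 a].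
Proof.
rewrite /phi1; case: (split_vert I1 i) (split_vertK I1 i) => [a|a] /= ia.
  by rewrite -ia (negPf (valP a)).
by exists a.
Qed.

Lemma phi1_notin i : i \notin I1 -> exists a, phi1 I1 i = [:: v0 a].
Proof.
rewrite /phi1; case: (split_vert I1 i) (split_vertK I1 i) => [a|a] /= ia.
  by exists a.
by rewrite -ia (valP a).
Qed.

Lemma phiS_split t (r : 'I_(height alpha).-1) : val (phiS I1 t) =
  phi I1 (take r (val t)) ++ phi1 I1 (tnth (val t) (lo r)) ++
  phi1 I1 (tnth (val t) (hi r)) ++ phi I1 (drop r.+2 (val t)) :> seq _.
Proof.
rewrite -(phi_cons (tnth _ (hi r))) -(phi_cons (tnth _ (lo r))) -phi_cat.
by rewrite -wseq_split.
Qed.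

Lemma pos_x_lt t (r : 'I_(height alpha)) :
  (pos t r < height (phiW I1 alpha))%N.
Proof.
have [x0 _] : {x0 : G | true} by exists (tnth (val t) r).
have <- : size (phi I1 (val t)) = height (phiW I1 alpha).
  exact: size_tuple (val (phiS I1 t)).
rewrite -[X in (_ < size (phi _ X))%N](cat_take_drop r) phi_cat size_cat.
rewrite -addn1 leq_add2l (drop_nth x0) ?size_tuple //.
by rewrite phi_cons size_cat /phi1; case: split_vert.
Qed.

(* The largest index of a tau occurring in tau_elt is the left-hand side. *)
Lemma pos_tau_lt t (r : 'I_(height alpha).-1) :
  (pos t r + (size (phi1 I1 (tnth (val t) (lo r)))
     + size (phi1 I1 (tnth (val t) (hi r)))).-2
   < (height (phiW I1 alpha)).-1)%N.
Proof.
rewrite -(size_tuple (val (phiS I1 t))) (phiS_split t r) !size_cat /pos.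
rewrite /phi1; case: (split_vert _ _) => ?; case: (split_vert _ _) => ? /=.
all: by rewrite ?(addnS, addSn, addn0, add0n) /= ?ltnS leq_addr.
Qed.

Lemma tau_elt_corner t r : tau_elt t r \in in_corner (idem_ord k (phiW I1 alpha)).
Proof.
have := phiS_split t r; rewrite /tau_elt /pos.
set p := take r _; set q := drop _ _; set i := tnth _ _; set j := tnth _ _.
set P := phi I1 p; set Q := phi I1 q => uE.
have done_ (a : R) (u' : wseq (phiW I1 alpha)) :
    val u' = P ++ phi1 I1 j ++ phi1 I1 i ++ Q :> seq _ ->
    a * e t = klr_e u' * a -> a * e t \in in_corner (idem_ord k (phiW I1 alpha)).
  move=> u'E; apply: in_corner_e; first exact: phiS_well_ordered.
  apply: (@phi_well_ordered (p ++ j :: i :: q)).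
  by rewrite u'E phi_cat !phi_cons.
have tau_step (u : wseq (phiW I1 alpha)) (a : R) n L x y M :
    a * e t = klr_e u * a -> size L = n -> val u = L ++ x :: y :: M :> seq _ ->
    exists2 u' : wseq (phiW I1 alpha), val u' = L ++ y :: x :: M :> seq _ &
      (tau n * a) * e t = klr_e u' * (tau n * a).
  move=> au sL uM; have [u' u'E u'C] := tau_swap sL uM.
  by exists u' => //; rewrite -mulrA au mulrA u'C mulrA.
have e0 : 1 * e t = klr_e (phiS I1 t) * 1 by rewrite mul1r mulr1.
case: (boolP (i \in I1)) => [/phi1_in|/phi1_notin] [a ia];
  case: (boolP (j \in I1)) => [/phi1_in|/phi1_notin] [b jb];
  rewrite ia jb /= in uE done_.
- suff inC : tau (size P).+1 * (tau (size P).+2 * (tau (size P) *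
     tau (size P).+1)) * e t \in in_corner (idem_ord k (phiW I1 alpha)).
    by rewrite !mulrA in inC; case: ifP => _ //; rewrite rpredN.
  have [||u1 u1E c1] :=
    tau_step _ _ (size P).+1 (P ++ [:: v1 a]) (v2 a) (v1 b) (v2 b :: Q) e0.
  + by rewrite size_cat addn1.
  + by rewrite -catA; exact: uE.
  have [||u2 u2E c2] :=
    tau_step _ _ (size P) P (v1 a) (v1 b) (v2 a :: v2 b :: Q) c1 => //.
  + by rewrite u1E -catA.
  have [||u3 u3E c3] :=
    tau_step _ _ (size P).+2 (P ++ [:: v1 b; v1 a]) (v2 a) (v2 b) Q c2.
  + by rewrite size_cat addn2.
  + by rewrite u2E -catA.
  have [||u4 u4E c4] :=
    tau_step _ _ (size P).+1 (P ++ [:: v1 b]) (v1 a) (v2 b) (v2 a :: Q) c3.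
  + by rewrite size_cat addn1.
  + by rewrite u3E -!catA.
  rewrite mulr1 in c4; apply: done_ c4.
  by rewrite u4E -catA.
- have [||u1 u1E c1] :=
    tau_step _ _ (size P).+1 (P ++ [:: v1 a]) (v2 a) (v0 b) Q e0.
  + by rewrite size_cat addn1.
  + by rewrite -catA; exact: uE.
  have [||u2 u2E c2] := tau_step _ _ (size P) P (v1 a) (v0 b) (v2 a :: Q) c1 => //.
  + by rewrite u1E -catA.
  by rewrite mulr1 in c2; apply: done_ c2.
- have [||u1 u1E c1] := tau_step _ _ (size P) P (v0 a) (v1 b) (v2 b :: Q) e0 => //.
  have [||u2 u2E c2] :=
    tau_step _ _ (size P).+1 (P ++ [:: v1 b]) (v0 a) (v2 b) Q c1.
  + by rewrite size_cat addn1.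
  + by rewrite u1E -catA.
  rewrite mulr1 in c2; apply: done_ c2.
  by rewrite u2E -catA.
- have [||u1 u1E c1] := tau_step _ _ (size P) P (v0 a) (v0 b) Q e0 => //.
  by rewrite mulr1 in c1; apply: done_ c1.
Qed.

(* The class of e(phi(t)) in the balanced algebra. *)
Definition bal_e t : S := cls _ (Corner (e_corner t)).
(* Since 1 is the sum of the e(phi(t)), an element z of the balanced algebra is
   the sum of the z e(phi(t)); see xstarE and taustarE. *)
Definition xstar (r : 'I_(height alpha)) : S :=
  \sum_t cls _ (Corner (x_elt_corner t r)).
Definition taustar (r : 'I_(height alpha).-1) : S :=
  \sum_t cls _ (Corner (tau_elt_corner t r)).

Lemma phiS_inj : injective (phiS I1 (alpha := alpha)).
Proof.
move=> t t' tt'; apply/val_inj/val_inj.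
by rewrite -[LHS](phiK I1) -[RHS](phiK I1) -[phi I1 _]/(val (val (phiS I1 t))) tt'.
Qed.

Lemma eM t t' : e t * e t' = if t == t' then e t else 0.
Proof. by rewrite klr_eM (inj_eq phiS_inj). Qed.

Lemma x_eltM t r t' : x_elt t r * e t' = if t == t' then x_elt t r else 0.
Proof. by rewrite -mulrA eM; case: eqP => // _; rewrite mulr0. Qed.

Lemma tau_eltM t r t' : tau_elt t r * e t' = if t == t' then tau_elt t r else 0.
Proof.
have eA a : a * e t * e t' = if t == t' then a * e t else 0.
  by rewrite -mulrA eM; case: eqP => // _; rewrite mulr0.
rewrite /tau_elt; case: (_ \in I1); case: (_ \in I1) => //.
by case: ifP => _ //; rewrite -mulNr.
Qed.

Lemma sum_bal_e (f : wseq alpha -> C) t :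
  (forall u, val (f u) * e t = if u == t then val (f u) else 0) ->
  (\sum_u cls _ (f u) : S) * bal_e t = cls _ (f t).
Proof.
move=> fM; rewrite mulr_suml (bigD1 t) //= big1 ?addr0 => [|u ut].
  by rewrite -clsM; congr cls; apply: val_inj; rewrite /= fM eqxx.
rewrite -clsM (_ : _ * _ = 0) ?rmorph0 //.
by apply: val_inj; rewrite /= fM (negPf ut).
Qed.

Lemma xstarE t r : xstar r * bal_e t = cls _ (Corner (x_elt_corner t r)).
Proof.
exact: (sum_bal_e (f := fun u => Corner (x_elt_corner u r)))
  (fun u => x_eltM u r t).
Qed.

Lemma taustarE t r : taustar r * bal_e t = cls _ (Corner (tau_elt_corner t r)).
Proof.
exact: (sum_bal_e (f := fun u => Corner (tau_elt_corner u r)))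
  (fun u => tau_eltM u r t).
Qed.
End Star.

Arguments bal_e k {G} I1 {alpha} t.
Arguments xstar k {G} I1 {alpha} r.
Arguments taustar k {G} I1 {alpha} r.

(* Main.v *)
Require Import Defs.
From HB Require Import structures.
From mathcomp Require Import fingroup perm all_boot all_order all_algebra.
From mathcomp.classical Require Import boolp.
From mathcomp.finmap Require Import finmap.
From mathcomp.multinomials Require monalg.
From mathcomp.multinomials Require Import ssrcomplements mpoly.
From mathcomp Require Import ring zify.

(** Both algebras act faithfully, and by the same operators, on the sum Pol of the
    polynomial rings k[x_1, ..., x_d] over the sequences i of weight alpha. The
    isomorphism matches the elements that act alike. No relation between
    crossings has to be verified in the balanced algebra, where the braid
    relations of the tau_r^* would be laborious.

    The KLR algebra acts on Pol by its polynomial representation: tau_r is a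
    divided difference on two strands of one colour, and otherwise the exchange
    of two variables times a power of x_{r+1} - x_r, whose exponent counts
    arrows. (The braid relation is taup_braid.) Straightening shows that the
    products tau_w g(x) e(i), with one ascending (hence reduced) word w for each
    permutation, span the algebra, whichever words are chosen (klr_span). Their
    operators are independent: up to lower terms they are multiples of
    distinct permutations of the variables, which are independent by
    Dedekind's argument (word_op_indep). So the action is faithful.

    For the doubled quiver, call a polynomial at a sequence j vanishing if it
    becomes 0 whenever each strand of I_2 is matched with an earlier strand of
    I_1 of the same colour and the variables of matched strands are identified.
    The vanishing polynomials form a submodule (vanishing_pol_act), thanks to
    the factor x_{r+1} - x_r of the arrow from i^1 to i^2. At an unordered
    sequence there is no matching, so every polynomial is vanishing; at a
    well-ordered sequence, that is at some phi(i) (wo_phi), the matching is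
    unique and the quotient is the polynomial ring in the variables of i. Hence
    the balanced algebra acts on Pol (bal_act), and a computation shows that
    tau_r^* acts as tau_r does (res_tau_elt).

    It remains to see that the balanced algebra has no more elements than
    these. Straightening in the doubled algebra leaves, for each permutation of
    the doubled strands, the choice of a word (good_word). If the permutation
    reverses a pair i^1, i^2, a word that starts by crossing this pair passes
    through an unordered sequence and dies in the quotient. If the resulting
    sequence is not well-ordered, the idempotent of the corner kills the
    element. In the remaining cases the permutation moves the pairs as blocks
    (bal_exists), and the word can be taken to be a product of crossings of
    blocks (tauR_expand). Finally the two variables of a pair agree in the
    quotient, their difference being the square of the crossing of the pair
    (bcl_x). So the balanced algebra is spanned by elements that act like the
    tau_w g(x) e(i) of the KLR algebra; its action is faithful too, and has the
    same image. *)

Set Implicit Arguments. Unset Strict Implicit. Unset Printing Implicit Defensive.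
Import GRing.Theory.
Local Open Scope ring_scope.

(** * Actions of free algebras and induction in KLR algebras *)

Section FreeAction.
Import monalg.
Variables (k : comNzRingType) (X : choiceType) (V : lmodType k).
Variable gen : X -> {linear V -> V}.
Local Notation F := (free_alg k X).

Definition word_act (w : seq X) (v : V) : V := foldr (fun x => gen x) v w.

Definition free_act (a : F) (v : V) : V :=
  \sum_(w <- msupp a) (mcoeff w a) *: word_act w v.

Lemma word_act_is_linear w : linear (word_act w).
Proof. by elim: w => //= x w IHw c u v; rewrite /= IHw linearP. Qed.

HB.instance Definition _ w :=
  GRing.isLinear.Build k V V _ (word_act w) (word_act_is_linear w).

Lemma free_act_is_linear a : linear (free_act a).
Proof.
move=> c u v; rewrite /free_act scaler_sumr -big_split /=; apply: eq_bigr => w _.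
by rewrite linearP scalerDr !scalerA mulrC.
Qed.

HB.instance Definition _ a :=
  GRing.isLinear.Build k V V _ (free_act a) (free_act_is_linear a).

Lemma free_actEw (d : {fset {fmonom X}}) (a : F) v : (msupp a `<=` d)%fset ->
  free_act a v = \sum_(w <- d) (mcoeff w a) *: word_act w v.
Proof.
move=> le_d; rewrite /free_act (big_fset_incl _ le_d) //= => w _ /mcoeff_outdom ->.
by rewrite scale0r.
Qed.

Lemma free_act_is_zmod_morphism v : zmod_morphism (free_act^~ v).
Proof.
move=> a b; set E := (msupp a `|` msupp b)%fset.
rewrite !(free_actEw _ (d := E)) ?fsubsetUl ?fsubsetUr ?msuppB_le //.
by rewrite -sumrB; apply/eq_bigr=> w _; rewrite mcoeffB scalerBl.
Qed.

Let free_actv v a := free_act a v.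
HB.instance Definition _ v :=
  GRing.isZmodMorphism.Build F V (free_actv v) (free_act_is_zmod_morphism v).

Lemma free_actD a b v : free_act (a + b) v = free_act a v + free_act b v.
Proof. exact: (raddfD (free_actv v)). Qed.

Lemma free_actB a b v : free_act (a - b) v = free_act a v - free_act b v.
Proof. exact: (raddfB (free_actv v)). Qed.

Lemma free_act0 v : free_act 0 v = 0.
Proof. exact: (raddf0 (free_actv v)). Qed.

Lemma free_act_sum (J : Type) (r : seq J) (P : pred J) (a : J -> F) v :
  free_act (\sum_(j <- r | P j) a j) v = \sum_(j <- r | P j) free_act (a j) v.
Proof. exact: (raddf_sum (free_actv v)). Qed.

Lemma free_actU c w v : free_act << c *g w >> v = c *: word_act w v.
Proof. by rewrite (free_actEw _ msuppU_le) big_seq_fset1 mcoeffUU. Qed.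

Lemma free_actM a b v : free_act (a * b) v = free_act a (free_act b v).
Proof.
rewrite [b]monalgE mulr_sumr !free_act_sum linear_sum /=; apply: eq_bigr => w' _.
rewrite [a]monalgE mulr_suml !free_act_sum; apply: eq_bigr => w _.
rewrite malgM_def fgmulUU !free_actU fmM linearZ /= scalerA; congr (_ *: _).
by rewrite /word_act foldr_cat.
Qed.

Lemma free_act_scal c v : free_act (pzscal c) v = c *: v.
Proof. by rewrite [LHS]free_actU fm1. Qed.

Lemma free_act1 v : free_act 1 v = v.
Proof. by rewrite -(rmorph1 (@pzscal k F)) free_act_scal scale1r. Qed.

Lemma free_actZ c a v : free_act (c *: a) v = c *: free_act a v.
Proof.
by rewrite -free_act_scal -free_actM; congr (free_act _ v); rewrite [RHS]mul_malgC.
Qed.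

Lemma free_act_gen x v : free_act (free_gen k x) v = gen x v.
Proof. by rewrite /free_gen -lock free_actU scale1r fmU. Qed.

End FreeAction.

Section FreeInduction.
Import monalg.
(** Induction on the construction of an element by left multiplications, in a
    form that does not see the monomials. *)
Lemma free_alg_ind (k : comNzRingType) (X : choiceType)
    (P : free_alg k X -> Prop) :
  P 0 -> (forall a b, P a -> P b -> P (a + b)) -> P 1 ->
  (forall c a, P a -> P (pzscal c * a)) ->
  (forall x a, P a -> P (free_gen k x * a)) -> forall a, P a.
Proof.
move=> P0 PD P1 PZ PX a; rewrite [a]monalgE.
apply: (big_ind P) => // w _; set c := (mcoeff w a); case: w @c => w c.
have -> : << c *g FMonom w >> = pzscal c * (<< FMonom w >> : free_alg k X) :> free_alg k X.
  rewrite /pzscal [RHS]malgM_def /= /malgC fgmulUU mulr1; congr << _ *g _ >>.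
  by apply: val_inj; rewrite /= fmM fm1.
apply: PZ; elim: w {c} => [|x w IHw].
  suff -> : << FMonom [::] >> = 1 :> free_alg k X by [].
  by congr << _ *g _ >>; apply: val_inj; rewrite /= fm1.
suff -> : << FMonom (x :: w) >> = free_gen k x * (<< FMonom w >> : free_alg k X)
    :> free_alg k X by apply: PX.
rewrite /free_gen -lock [RHS]malgM_def fgmulUU mulr1; congr << _ *g _ >>.
by apply: val_inj; rewrite /= fmM fmU.
Qed.
End FreeInduction.

Section KLRAction.
Variables (k : fieldType) (G : quiver) (alpha : {ffun G -> nat}).
Local Notation R := (klr k alpha).
Variables (V : lmodType k) (gen : klr_gen alpha -> {linear V -> V}).
Hypothesis gen_rel : forall a b : free_alg k (klr_gen alpha),
  klr_rel a b -> forall v, free_act gen a v = free_act gen b v.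

(** The hypothesis makes the choice of a representative immaterial. *)
Definition klr_act (a : R) (v : V) : V := free_act gen (repr a) v.

Lemma klr_act_cls a v : klr_act (cls _ a) v = free_act gen a v.
Proof.
rewrite /klr_act -[repr _](subrK a) free_actD.
suff -> : free_act gen (repr (cls _ a : R) - a) v = 0 by rewrite add0r.
set J := ideal_gen _; move: (repr_cls J a); move: (repr _ - a) => z /= Jz.
 elim: Jz v => {z} [x [b [c [bc ->]]]||x y _ IHx _ IHy|b x _ IH|x b _ IH] v.
- by rewrite free_actB (gen_rel bc) subrr.
- exact: free_act0.
- by rewrite free_actD IHx IHy addr0.
- by rewrite free_actM IH linear0.
- by rewrite free_actM IH.
Qed.

Lemma klr_act_is_linear a : linear (klr_act a).
Proof. exact: linearP. Qed.
HB.instance Definition _ a :=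
  GRing.isLinear.Build k V V _ (klr_act a) (klr_act_is_linear a).

Lemma klr_actD a b v : klr_act (a + b) v = klr_act a v + klr_act b v.
Proof. by rewrite -[a]cls_repr -[b]cls_repr -clsD !klr_act_cls free_actD. Qed.

Lemma klr_actM a b v : klr_act (a * b) v = klr_act a (klr_act b v).
Proof. by rewrite -[a]cls_repr -[b]cls_repr -clsM !klr_act_cls free_actM. Qed.

Lemma klr_act_scal c v : klr_act (pzscal c) v = c *: v.
Proof. by rewrite klr_act_cls free_act_scal. Qed.

Lemma klr_act0 v : klr_act 0 v = 0.
Proof. by rewrite -(rmorph0 (@pzscal k R)) klr_act_scal scale0r. Qed.

Lemma klr_act1 v : klr_act 1 v = v.
Proof. by rewrite -(rmorph1 (@pzscal k R)) klr_act_scal scale1r. Qed.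

Lemma klr_actN a v : klr_act (- a) v = - klr_act a v.
Proof. by apply/eqP; rewrite -addr_eq0 -klr_actD addNr klr_act0. Qed.

Lemma klr_act_sum (J : Type) (r : seq J) (P : pred J) (a : J -> R) v :
  klr_act (\sum_(j <- r | P j) a j) v = \sum_(j <- r | P j) klr_act (a j) v.
Proof.
elim/big_rec2: _ => [|j u b _ <-]; first exact: klr_act0.
by rewrite klr_actD.
Qed.

Lemma klr_act_e i v : klr_act (klr_e i) v = gen (inl (inl i)) v.
Proof. by rewrite klr_act_cls free_act_gen. Qed.
Lemma klr_act_x r v : klr_act (klr_x r) v = gen (inl (inr r)) v.
Proof. by rewrite klr_act_cls free_act_gen. Qed.
Lemma klr_act_tau r v : klr_act (klr_tau r) v = gen (inr r) v.
Proof. by rewrite klr_act_cls free_act_gen. Qed.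
End KLRAction.

(** * Evaluation of polynomials *)

Section Evaluation.
Variables (k : fieldType) (A : pzAlgType k) (n : nat) (x : 'I_n -> A).
Implicit Types (g h : {mpoly k[n]}) (m : 'X_{1..n}).

(** The evaluation of a polynomial at a family of elements. It is multiplicative
    only when these commute, and the target may be the zero ring, as a
    presented algebra or a quotient of one might be. *)
Definition peval g : A :=
  \sum_(m <- msupp g) pzscal g@_m * \prod_(r < n) x r ^+ m r.

Lemma pevalE g (e : nat) : (msize g <= e)%N ->
  peval g = \sum_(m : 'X_{1..n < e}) pzscal g@_m * \prod_(r < n) x r ^+ m r.
Proof.
move=> le_ge; pose I := 'X_{1..n < e}; rewrite /peval (big_mksub I) //=.
- rewrite big_rmcond //= => m /memN_msupp_eq0 ->.
  by rewrite rmorph0 mul0r.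
- exact: msupp_uniq.
- by move=> m /msize_mdeg_lt /leq_trans; apply.
Qed.

Lemma pevalB : zmod_morphism peval.
Proof.
move=> g h; pose e := maxn (msize (g - h)) (maxn (msize g) (msize h)).
rewrite !(@pevalE _ e) ?leq_max ?leqnn ?orbT //.
by rewrite -sumrB; apply: eq_bigr => m _; rewrite mcoeffB rmorphB mulrBl.
Qed.

Lemma peval0 : peval 0 = 0.
Proof. by rewrite -[0](subrr 0) pevalB subrr. Qed.

Lemma pevalD g h : peval (g + h) = peval g + peval h.
Proof. by rewrite -{1}[h]opprK -[- h]sub0r !pevalB peval0 sub0r opprK. Qed.

Lemma pevalZ c g : peval (c *: g) = pzscal c * peval g.
Proof.
have le1 := msizeZ_le g c; have le2 := leqnn (msize g).
rewrite (pevalE le1) (pevalE le2) mulr_sumr; apply: eq_bigr => m _.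
by rewrite mcoeffZ rmorphM mulrA.
Qed.

Lemma pevalM m : peval 'X_[m] = \prod_(r < n) x r ^+ m r.
Proof. by rewrite /peval msuppX big_seq1 mcoeffX eqxx rmorph1 mul1r. Qed.

Lemma peval1 : peval 1 = 1.
Proof.
by rewrite -mpolyX0 pevalM big1 // => r _; rewrite mnm0E expr0.
Qed.

Lemma peval_comm a g : (forall r, GRing.comm a (x r)) -> GRing.comm a (peval g).
Proof.
move=> ax; apply: (big_ind (fun b => GRing.comm a b)) => [||m _].
- exact: commr0.
- exact: commrD.
apply: commrM; first exact/commr_sym/pzscalC.
by apply: commr_prod => r _; apply/commrX/ax.
Qed.

Hypothesis xC : forall r s, GRing.comm (x r) (x s).

Lemma pevalXl r g : peval ('X_r * g) = x r * peval g.
Proof.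
elim/mpolyind: g => [|c m g _ _ IHg]; first by rewrite !(mulr0, peval0).
rewrite mulrDr !pevalD IHg mulrDr; congr (_ + _).
have -> : 'X_r * (c *: 'X_[m]) = c *: ('X_r * 'X_[m]) :> {mpoly k[n]}.
  by rewrite -mul_mpolyC mulrCA mul_mpolyC.
rewrite !pevalZ mulrA -pzscalC -mulrA -mpolyXD !pevalM; congr (_ * _).
rewrite (eq_bigr (fun s => x s ^+ (s == r) * x s ^+ m s)) => [|s _].
  rewrite prodrM_comm => [|s t _ _].
    congr (_ * _); rewrite -[RHS](big_pred1_eq *%R r) big_mkcond.
    by apply: eq_bigr => s _ /=; case: eqP.
  exact/commrX/commr_sym/commrX.
by rewrite mnmDE mnmE exprD eq_sym.
Qed.
End Evaluation.

Section KLRTheory.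
Variables (k : fieldType) (G : quiver) (alpha : {ffun G -> nat}).
Local Notation R := (klr k alpha).
Local Notation d := (height alpha).
Implicit Types (i : wseq alpha).

(** A property of the elements of the left ideal R b can be proved one generator
    at a time. *)
Lemma klr_left_ind (b : R) (P : R -> Prop) :
  P 0 -> (forall a a', P a -> P a' -> P (a + a')) -> P b ->
  (forall c a, P a -> P (pzscal c * a)) ->
  (forall i a, P a -> P (klr_e i * a)) ->
  (forall r a, P a -> P (klr_x r * a)) ->
  (forall r a, P a -> P (klr_tau r * a)) -> forall a, P (a * b).
Proof.
move=> P0 PD Pb PZ Pe Px Pt a; rewrite -[a]cls_repr.
elim/free_alg_ind: (repr a) => [|c c' Pc Pc'||z c Pc|[[i|r]|r] c Pc].
- by rewrite rmorph0 mul0r.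
- by rewrite rmorphD mulrDl; apply: PD.
- by rewrite rmorph1 mul1r.
- by rewrite rmorphM -mulrA; apply: PZ.
- by rewrite rmorphM -mulrA; apply: Pe.
- by rewrite rmorphM -mulrA; apply: Px.
- by rewrite rmorphM -mulrA; apply: Pt.
Qed.

Lemma sum_klr_e : \sum_i klr_e i = 1 :> R.
Proof.
by rewrite -[RHS](klr_relE (@klr_sum_e k G alpha)) rmorph_sum.
Qed.

Lemma klr_xxC r s : klr_x r * klr_x s = klr_x s * klr_x r :> R.
Proof. by rewrite -!clsM; apply/klr_relE/klr_xx. Qed.

End KLRTheory.

Lemma mpoly_gen_ind (k : fieldType) n (P : {mpoly k[n]} -> Prop) :
  P 0 -> (forall g h, P g -> P h -> P (g + h)) -> P 1 ->
  (forall c g, P g -> P (c *: g)) ->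
  (forall r g, P g -> P ('X_r * g)) -> forall g, P g.
Proof.
move=> P0 PD P1 PZ PX; elim/mpolyind=> // c m g _ _ Pg; apply: PD => //.
apply: PZ; rewrite mpolyXE_id; elim/big_rec: _ => //= r q _ Pq.
by elim: (m r) => [|e IHe]; rewrite ?expr0 ?mul1r // exprS -mulrA; apply: PX.
Qed.

(** * Demazure operators *)

Section Demazure.
Variables (k : fieldType) (n : nat).
Local Notation P := {mpoly k[n]}.
Implicit Types (a b c : 'I_n) (g h : P).

Definition swapv a b : P -> P := msym (tperm a b).

HB.instance Definition _ a b := GRing.RMorphism.on (swapv a b).
HB.instance Definition _ a b := GRing.Linear.on (swapv a b).

Lemma msymXU s a : msym s 'X_a = 'X_(s a) :> P.
Proof. by rewrite /msym mmapX mmap1U. Qed.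

Lemma swapvX a b c : swapv a b 'X_c = 'X_(tperm a b c).
Proof. exact: msymXU. Qed.

Lemma mpolyX_inj : injective (fun a => 'X_a : P).
Proof.
move=> a b /(congr1 (mcoeff U_(b))); rewrite !mcoeffXU eqxx.
by case: eqP => // _ /eqP; rewrite eq_sym oner_eq0.
Qed.

Lemma subX_neq0 a b : a != b -> 'X_a - 'X_b != 0 :> P.
Proof. by apply: contraNneq => /eqP; rewrite subr_eq0 => /eqP/mpolyX_inj/eqP. Qed.

(** The image of x_r under the exchange differs from x_r by a multiple of
    x_a - x_b, and the property passes to products by the Leibniz rule. *)
Lemma dem_subproof a b g : exists q : P, ('X_a - 'X_b) * q = swapv a b g - g.
Proof.
elim/mpoly_gen_ind: g => [|g h [q qE] [q' qE']||c g [q qE]|r g [q qE]].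
- by exists 0; rewrite rmorph0 mulr0 subr0.
- by exists (q + q'); rewrite mulrDr qE qE' rmorphD opprD addrACA.
- by exists 0; rewrite rmorph1 mulr0 subrr.
- by exists (c *: q); rewrite -scalerAr qE linearZ scalerBr.
pose z : P := if r == a then -1 else if r == b then 1 else 0.
have zE : ('X_a - 'X_b) * z = swapv a b 'X_r - 'X_r.
  rewrite /z swapvX; case: tpermP => [->|->|/eqP/negPf-> /eqP/negPf->].
  - by rewrite eqxx mulrN1 opprB.
  - by rewrite eqxx; case: eqP => [->|_]; rewrite ?subrr ?mul0r // mulr1.
  - by rewrite mulr0 subrr.
exists (z * swapv a b g + 'X_r * q).
rewrite mulrDr mulrA zE mulrCA qE rmorphM /=; ring.
Qed.

(** The divided difference (s g - g) / (x_a - x_b), with s exchanging x_a and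
    x_b. *)
Definition dem a b g : P := sval (cid (dem_subproof a b g)).

Lemma demE a b g : ('X_a - 'X_b) * dem a b g = swapv a b g - g.
Proof. exact: svalP (cid (dem_subproof a b g)). Qed.

Lemma demP a b g q :
  a != b -> ('X_a - 'X_b) * q = swapv a b g - g -> dem a b g = q.
Proof. by move=> ab qE; apply: (mulfI (subX_neq0 ab)); rewrite demE. Qed.

Lemma swapvK a b : involutive (swapv a b).
Proof. by move=> g; rewrite /swapv -msymMm tperm2 msym1m. Qed.

End Demazure.

Section Transpositions.
Variables (T : finType) (a b c d : T).

Lemma tperm_far : a != c -> a != d -> b != c -> b != d ->
  (tperm c d * tperm a b = tperm a b * tperm c d)%g.
Proof.
move=> ac ad bc bd; apply/perm.permP => e; rewrite !permM.
case: (tpermP c d e) => [->|->|/eqP ec /eqP ed].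
- by rewrite (tpermD ad bd) (tpermD ac bc) tpermL.
- by rewrite (tpermD ad bd) (tpermD ac bc) tpermR.
by case: (tpermP a b e) => *; rewrite tpermD // eq_sym.
Qed.

Lemma tperm_braid : a != b -> a != c -> b != c ->
  (tperm b c * (tperm a b * tperm b c) = tperm a b * (tperm b c * tperm a b))%g.
Proof.
move=> ab ac bc; transitivity (tperm a c).
  by rewrite -{1}(tpermV b c) -conjgE tpermJ tpermL tpermD // eq_sym.
by rewrite -{1}(tpermV a b) -conjgE tpermJ tpermR tpermD.
Qed.
End Transpositions.

Lemma subrACA (V : zmodType) (x y z t : V) : x - y - (z - t) = x - z - (y - t).
Proof. by rewrite !opprB addrACA [RHS]addrACA [- y - z]addrC. Qed.

Section KLROperators.
Variables (k : fieldType) (G : quiver) (n : nat).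
Local Notation P := {mpoly k[n]}.
Implicit Types (u v w : G) (a b c : 'I_n) (g h : P).

(** The operator of a crossing in the polynomial representation, where x_a and
    x_b are the variables of two strands coloured u and v. *)
Definition taup u v a b g : P :=
  if u == v then dem a b g else ('X_b - 'X_a) ^+ narrows v u * swapv a b g.

Lemma taup_is_linear u v a b : a != b -> linear (taup u v a b).
Proof.
move=> ab c g h; rewrite /taup; case: eqP => _.
  apply: demP => //; rewrite mulrDr -scalerAr !demE linearP /=.
  by rewrite scalerBr opprD addrACA.
by rewrite linearP mulrDr scalerAr.
Qed.

Lemma taup_hi u v a b g : a != b ->
  taup u v a b ('X_b * g) = 'X_a * taup u v a b g + (u == v)%:R * g.
Proof.
move=> ab; rewrite /taup; case: eqP => _; last first.
  by rewrite mul0r addr0 rmorphM /= swapvX tpermR mulrCA.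
apply: demP => //; rewrite mulrDr mulrCA demE rmorphM /= swapvX tpermR mul1r.
ring.
Qed.

Lemma taup_lo u v a b g : a != b ->
  'X_b * taup u v a b g = taup u v a b ('X_a * g) + (u == v)%:R * g.
Proof.
move=> ab; rewrite /taup; case: eqP => _; last first.
  by rewrite mul0r addr0 rmorphM /= swapvX tpermL mulrCA.
rewrite -[LHS](subrK g) mul1r; congr (_ + _); apply/esym/demP => //.
rewrite mulrBr mulrCA demE rmorphM /= swapvX tpermL; ring.
Qed.

Lemma taup_far u v a b c g : a != b -> c != a -> c != b ->
  taup u v a b ('X_c * g) = 'X_c * taup u v a b g.
Proof.
move=> ab ca cb; rewrite /taup; case: eqP => _; last first.
  by rewrite rmorphM /= swapvX tpermD ?(eq_sym _ c) // mulrCA.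
apply: demP => //; rewrite mulrCA demE rmorphM /= swapvX tpermD ?(eq_sym _ c) //.
by rewrite mulrBr.
Qed.

Lemma taup_sq u v a b g : a != b ->
  taup v u a b (taup u v a b g) = Qpol u v 'X_a 'X_b * g.
Proof.
move=> ab; rewrite /taup /Qpol (eq_sym v u); case: eqP => uv.
  rewrite mul0r; apply: demP => //; rewrite mulr0.
  apply/esym; apply: (mulfI (subX_neq0 k ab)); rewrite mulr0 mulrBr demE.
  have -> : 'X_a - 'X_b = - swapv a b ('X_a - 'X_b) :> P.
    by rewrite rmorphB /= !swapvX tpermL tpermR opprB.
  by rewrite mulNr -rmorphM demE rmorphB /= swapvK; ring.
rewrite rmorphM rmorphXn rmorphB /= !swapvX tpermL tpermR swapvK; ring.
Qed.

Lemma swapv_far a b c d g : a != c -> a != d -> b != c -> b != d ->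
  swapv a b (swapv c d g) = swapv c d (swapv a b g).
Proof. by move=> ac ad bc bd; rewrite /swapv -!msymMm tperm_far. Qed.

(** Divided differences are linear over the invariant polynomials. *)
Lemma dem_mulinv a b g h : a != b -> swapv a b h = h ->
  dem a b (h * g) = h * dem a b g.
Proof. by move=> ab hE; apply: demP; rewrite // mulrCA demE rmorphM /= hE mulrBr. Qed.

Lemma msym_dem s a b g : a != b ->
  msym s (dem a b g) = dem (s a) (s b) (msym s g).
Proof.
move=> ab; apply/esym/demP; first by rewrite (inj_eq perm_inj).
have -> : swapv (s a) (s b) (msym s g) = msym s (swapv a b g).
  by rewrite /swapv -!msymMm; congr (msym _ g); rewrite -tpermJ conjgE mulKVg.
by rewrite -(msymXU k s a) -(msymXU k s b) -rmorphB -rmorphM demE rmorphB.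
Qed.

Lemma swapv_dem a b c d g : c != d ->
  swapv a b (dem c d g) = dem (tperm a b c) (tperm a b d) (swapv a b g).
Proof. exact: msym_dem. Qed.

Lemma taup_farC u v u' v' a b c d g : a != b -> c != d ->
  a != c -> a != d -> b != c -> b != d ->
  taup u v a b (taup u' v' c d g) = taup u' v' c d (taup u v a b g).
Proof.
move=> ab cd ac ad bc bd; have Xab e : e != c -> e != d -> 'X_(tperm c d e) = 'X_e :> P.
  by move=> ec ed; rewrite tpermD // eq_sym.
have Xcd e : e != a -> e != b -> 'X_(tperm a b e) = 'X_e :> P.
  by move=> ec ed; rewrite tpermD // eq_sym.
have [ca da cb db] : [/\ c != a, d != a, c != b & d != b].
  by split; rewrite eq_sym.
have pab m : swapv a b (('X_d - 'X_c) ^+ m) = ('X_d - 'X_c) ^+ m :> P.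
  by rewrite rmorphXn rmorphB /= !swapvX !Xcd.
have pcd m : swapv c d (('X_b - 'X_a) ^+ m) = ('X_b - 'X_a) ^+ m :> P.
  by rewrite rmorphXn rmorphB /= !swapvX !Xab.
have swdem h : swapv c d (dem a b h) = dem a b (swapv c d h).
  by rewrite (swapv_dem _ _ _ ab) (tpermD ca da) (tpermD cb db).
have swdem' h : swapv a b (dem c d h) = dem c d (swapv a b h).
  by rewrite (swapv_dem _ _ _ cd) (tpermD ac bc) (tpermD ad bd).
rewrite /taup; case: eqP => _; case: eqP => _.
- apply: demP => //; apply: (mulfI (subX_neq0 k cd)).
  rewrite mulrCA demE swdem swdem' !mulrBr !demE (swapv_far _ ac ad bc bd).
  exact: subrACA.
- by rewrite dem_mulinv // swdem.
- by rewrite dem_mulinv // swdem'.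
- by rewrite !rmorphM /= pab pcd mulrCA swapv_far.
Qed.
End KLROperators.

(** * The braid relation for divided differences *)

(** The identities behind the braid relation. They are stated with the values of
    the permuted polynomials as indeterminates, so that they hold in any
    field. *)
Section FieldIdentities.
Variables (F : fieldType) (x y z g g1 g2 g12 g21 g121 p q : F).
Hypotheses (xy : x - y != 0) (xz : x - z != 0) (yz : y - z != 0).

Lemma nil_braid_identity :
  (((g121 - g21) / (x - y) - (g2 - g) / (y - z)) / (x - z) -
   ((g12 - g1) / (x - z) - (g2 - g) / (y - z)) / (x - y)) / (y - z) =
  (((g121 - g12) / (y - z) - (g1 - g) / (x - y)) / (x - z) -
   ((g21 - g2) / (x - z) - (g1 - g) / (x - y)) / (y - z)) / (x - y).
Proof. by field; rewrite xy xz yz. Qed.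

Lemma pull_quotient : (p * (q * g) - q * (p * g1)) / x = q * (p * ((g - g1) / x)).
Proof. by rewrite mulrCA -!mulrBr -!mulrA. Qed.

Lemma mid_quotient a b d :
  p * ((a * g - b * g1) / (x - z)) - a * ((p * g - d * g1) / (x - z)) =
  (b * p - a * d) / (z - x) * g1.
Proof. by field; rewrite xz -opprB oppr_eq0 xz. Qed.
End FieldIdentities.

(** The relations are proved in the fraction field, where a divided difference is
    an honest quotient; only the action of the two reflections on three
    elements x, y, z matters. *)
Section AbstractBraid.
Variables (P : idomainType) (s1 s2 : {rmorphism P -> P}) (d1 d2 : P -> P).
Variables (x y z : P).
Hypotheses (xy : x - y != 0) (xz : x - z != 0) (yz : y - z != 0).
Hypotheses (s1x : s1 x = y) (s1y : s1 y = x) (s1z : s1 z = z).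
Hypotheses (s2x : s2 x = x) (s2y : s2 y = z) (s2z : s2 z = y).
Hypotheses (s1K : involutive s1) (s2K : involutive s2).
Hypothesis s12 : forall g, s2 (s1 (s2 g)) = s1 (s2 (s1 g)).
Hypothesis d1E : forall g, (x - y) * d1 g = s1 g - g.
Hypothesis d2E : forall g, (y - z) * d2 g = s2 g - g.
Implicit Types (g h E : P).
Local Notation T := (@FracField.tofrac P).
Local Notation X := (T x).
Local Notation Y := (T y).
Local Notation Z := (T z).

Let divT p q r : p != 0 -> p * q = r -> T q = T r / T p.
Proof.
move=> p0 <-; rewrite tofracM mulrC mulKf // tofrac_eq0 //.
Qed.

Let d1F g : T (d1 g) = (T (s1 g) - T g) / (X - Y).
Proof. by rewrite -!tofracB; apply: divT. Qed.
Let d2F g : T (d2 g) = (T (s2 g) - T g) / (Y - Z).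
Proof. by rewrite -!tofracB; apply: divT. Qed.
Let s2d1F g : T (s2 (d1 g)) = (T (s2 (s1 g)) - T (s2 g)) / (X - Z).
Proof.
by rewrite -!tofracB; apply: divT => //; rewrite -[x]s2x -s2y -!rmorphB -rmorphM
  d1E.
Qed.
Let s1d2F g : T (s1 (d2 g)) = (T (s1 (s2 g)) - T (s1 g)) / (X - Z).
Proof.
by rewrite -!tofracB; apply: divT => //; rewrite -[z]s1z -s1y -!rmorphB -rmorphM
  d2E.
Qed.
Let s12d1F g :
  T (s1 (s2 (d1 g))) = (T (s1 (s2 (s1 g))) - T (s1 (s2 g))) / (Y - Z).
Proof.
rewrite -!tofracB; apply: divT => //.
by rewrite -{1}[y]s1x -{1}s1z -!rmorphB -{1}s2x -{1}s2y -!rmorphB -!rmorphM d1E.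
Qed.
Let s21d2F g :
  T (s2 (s1 (d2 g))) = (T (s1 (s2 (s1 g))) - T (s2 (s1 g))) / (X - Y).
Proof.
rewrite -!tofracB; apply: divT => //.
by rewrite -{1}[x]s2x -{1}s2z -!rmorphB -{1}s1y -{1}s1z -!rmorphB -!rmorphM d2E
  !rmorphB s12.
Qed.

Let XY : X - Y != 0. Proof. by rewrite -tofracB tofrac_eq0. Qed.
Let XZ : X - Z != 0. Proof. by rewrite -tofracB tofrac_eq0. Qed.
Let YZ : Y - Z != 0. Proof. by rewrite -tofracB tofrac_eq0. Qed.

Let T_inj g h : T g = T h -> g = h.
Proof. by move/eqP; rewrite tofrac_eq => /eqP. Qed.

Let s1xy : s1 (x - y) = - (x - y). Proof. by rewrite rmorphB s1x s1y opprB. Qed.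
Let s2yz : s2 (y - z) = - (y - z). Proof. by rewrite rmorphB s2y s2z opprB. Qed.

Let s1d1 g : s1 (d1 g) = d1 g.
Proof.
apply: (mulfI xy); rewrite d1E -[x - y]opprK -s1xy mulNr -rmorphM.
by rewrite d1E rmorphB s1K opprB.
Qed.

Let s2d2 g : s2 (d2 g) = d2 g.
Proof.
apply: (mulfI yz); rewrite d2E -[y - z]opprK -s2yz mulNr -rmorphM.
by rewrite d2E rmorphB s2K opprB.
Qed.

Let sE := (s1x, s1y, s1z, s2x, s2y, s2z).

Lemma braid_dem g : d2 (d1 (d2 g)) = d1 (d2 (d1 g)).
Proof.
apply: T_inj; rewrite !(d1F, d2F, s2d1F, s1d2F, s12d1F, s21d2F, s1d1, s2d2).
exact: nil_braid_identity.
Qed.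

Lemma braid_dem_left N g :
  d2 ((y - x) ^+ N * s1 ((z - y) ^+ N * s2 g)) =
  (y - x) ^+ N * s1 ((z - y) ^+ N * s2 (d1 g)).
Proof.
apply: T_inj; rewrite d2F !rmorphM /= !rmorphXn !rmorphB /= !sE s12 s12d1F.
exact: pull_quotient.
Qed.

Lemma braid_dem_right N g :
  (z - y) ^+ N * s2 ((y - x) ^+ N * s1 (d2 g)) =
  d1 ((z - y) ^+ N * s2 ((y - x) ^+ N * s1 g)).
Proof.
apply: T_inj; rewrite d1F !rmorphM /= !rmorphXn !rmorphB /= !sE s21d2F.
exact/esym/pull_quotient.
Qed.

Lemma braid_mid M N E g :
  (z - x) * E = (y - z) ^+ M * (z - y) ^+ N - (y - x) ^+ M * (x - y) ^+ N ->
  (z - y) ^+ N * s2 (d1 ((z - y) ^+ M * s2 g)) -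
  (y - x) ^+ M * s1 (d2 ((y - x) ^+ N * s1 g)) = E * g.
Proof.
move=> EE; have zx : z - x != 0 by rewrite -opprB oppr_eq0.
apply: T_inj; rewrite tofracB !tofracM s2d1F s1d2F (divT zx EE).
rewrite !rmorphB !rmorphM /= !rmorphXn !rmorphB /= !sE s12 s1K s2K.
exact: mid_quotient.
Qed.

Lemma braid_neq A B C g :
  (z - y) ^+ A * s2 ((y - x) ^+ B * s1 ((z - y) ^+ C * s2 g)) =
  (y - x) ^+ C * s1 ((z - y) ^+ B * s2 ((y - x) ^+ A * s1 g)).
Proof.
rewrite !rmorphM /= !rmorphXn !rmorphB /= !sE s12.
by rewrite mulrCA [RHS]mulrCA; congr (_ * _); rewrite mulrCA.
Qed.
End AbstractBraid.

Section Braid.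
Variables (k : fieldType) (G : quiver) (n : nat).
Local Notation P := {mpoly k[n]}.
Variables (a b c : 'I_n).
Hypotheses (ab : a != b) (ac : a != c) (bc : b != c).
Implicit Types (u v w : G) (g h : P).

Lemma swapv_braid g : swapv b c (swapv a b (swapv b c g)) = swapv a b (swapv b c (swapv a b g)).
Proof.
by rewrite /swapv -!msymMm tperm_braid.
Qed.

(** The three crossings of strands coloured u, v, w: the two ways to perform them
    differ only if u = w, and then the colour v decides which of the identities
    above applies. *)
Lemma taup_braid u v w g E :
  (u = w -> ('X_c - 'X_a) * E = Qpol u v 'X_c 'X_b - Qpol u v 'X_a 'X_b) ->
  taup u v b c (taup u w a b (taup v w b c g)) -
  taup v w a b (taup u w b c (taup u v a b g)) = (if u == w then E else 0) * g.
Proof.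
have xy := subX_neq0 k ab; have xz := subX_neq0 k ac; have yz := subX_neq0 k bc.
have s1x : swapv a b 'X_a = 'X_b :> P by rewrite swapvX tpermL.
have s1y : swapv a b 'X_b = 'X_a :> P by rewrite swapvX tpermR.
have s1z : swapv a b 'X_c = 'X_c :> P by rewrite swapvX tpermD.
have s2x : swapv b c 'X_a = 'X_a :> P by rewrite swapvX tpermD // eq_sym.
have s2y : swapv b c 'X_b = 'X_c :> P by rewrite swapvX tpermL.
have s2z : swapv b c 'X_c = 'X_b :> P by rewrite swapvX tpermR.
rewrite /taup /Qpol; case: (eqVneq u w) => [<-|uw].
  rewrite (eq_sym v u); case: (eqVneq u v) => [_|uv] /(_ erefl) EE.
    have -> : E = 0.
      move/eqP: EE; rewrite subrr mulf_eq0 -opprB oppr_eq0 (negPf xz) /=.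
      by move/eqP.
    apply/eqP; rewrite mul0r subr_eq0; apply/eqP.
    exact: (braid_dem xy xz yz s1x s1y s1z s2x s2y s2z (@swapvK _ _ _ _)
      (@swapvK _ _ _ _) swapv_braid (demE a b) (demE b c)).
  exact: (braid_mid xz s1x s1y s1z s2x s2y s2z (@swapvK _ _ _ _)
      (@swapvK _ _ _ _) swapv_braid (demE a b) (demE b c)).
move=> _; apply/eqP; rewrite mul0r subr_eq0; apply/eqP.
case: (eqVneq u v) => [<-|uv]; last case: (eqVneq v w) => [<-|vw].
- rewrite (negPf uw).
  exact: (braid_dem_left yz s1x s1y s1z s2x s2y s2z swapv_braid (demE a b) (demE b c)).
- rewrite ?(negPf uv).
  exact: (braid_dem_right xy s1x s1y s1z s2x s2y s2z swapv_braid (demE a b) (demE b c)).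
- exact: (braid_neq s1x s1y s1z s2x s2y s2z swapv_braid).
Qed.
End Braid.

(** * The polynomial representation *)

Section Positions.
Variables (I : finType) (alpha : {ffun I -> nat}).
Local Notation n := (height alpha).
Implicit Types (t : wseq alpha) (r s : 'I_n.-1) (p q : 'I_n).

Definition st r : 'S_n := tperm (lo r) (hi r).

Lemma wact_subproof (L : 'S_n) t :
  [forall i, count_mem i [tuple tnth (val t) (L p) | p < n] == alpha i].
Proof.
apply/forallP=> i; rewrite -(eqP (forallP (valP t) i)); apply/eqP.
by apply/seq.permP; apply/tuple_permP; exists L.
Qed.

(** The colours seen along an arrangement L of the strands, where L maps a
    position to the strand found there. *)
Definition wact (L : 'S_n) t : wseq alpha :=
  Sub [tuple tnth (val t) (L p) | p < n] (wact_subproof L t).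

Lemma tnth_wact L t p : tnth (val (wact L t)) p = tnth (val t) (L p).
Proof. by rewrite tnth_mktuple. Qed.

Lemma wseq_eqP t t' :
  (forall p, tnth (val t) p = tnth (val t') p) -> t = t'.
Proof. by move=> tt'; apply/val_inj/eq_from_tnth. Qed.

Lemma wact_swap r t : swap r t = wact (st r) t.
Proof. by apply: wseq_eqP => p; rewrite tnth_wact. Qed.

Lemma wactM L L' t : wact L (wact L' t) = wact (L * L')%g t.
Proof. by apply: wseq_eqP => p; rewrite !tnth_wact permM. Qed.

Lemma wact1 t : wact 1 t = t.
Proof. by apply: wseq_eqP => p; rewrite tnth_wact perm1. Qed.

Lemma tnth_swap r t p : tnth (val (swap r t)) p = tnth (val t) (st r p).
Proof. by rewrite wact_swap tnth_wact. Qed.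

Lemma st2 r : (st r * st r = 1)%g.
Proof. exact: tperm2. Qed.

Lemma swapK r : involutive (swap r).
Proof. by move=> t; rewrite !wact_swap wactM st2 wact1. Qed.

Lemma lo_hi r : lo r != hi r.
Proof. by rewrite -val_eqE /= neq_ltn ltnSn. Qed.

Lemma st_lo r : st r (lo r) = hi r. Proof. exact: tpermL. Qed.
Lemma st_hi r : st r (hi r) = lo r. Proof. exact: tpermR. Qed.
Lemma st_neq r p : p != lo r -> p != hi r -> st r p = p.
Proof. by move=> plo phi; rewrite /st tpermD // eq_sym. Qed.

Lemma far_pos r s : (r.+1 < s)%N || (s.+1 < r)%N ->
  [/\ lo r != lo s, lo r != hi s, hi r != lo s & hi r != hi s].
Proof.
by move=> rs; rewrite -!val_eqE /=; split; apply/eqP; lia.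
Qed.

Lemma st_far r s : (r.+1 < s)%N || (s.+1 < r)%N -> (st r * st s = st s * st r)%g.
Proof. by move=> rs; have [*] := far_pos rs; rewrite /st tperm_far // eq_sym. Qed.

Lemma next_pos r s : s = r.+1 :> nat ->
  [/\ lo s = hi r, lo r != hi s & hi r != hi s].
Proof. 
move=> rs; split; first exact/val_inj.
  by rewrite -val_eqE /=; lia.
by rewrite -val_eqE /=; lia.
 Qed.

Lemma st_braid r s : s = r.+1 :> nat ->
  (st s * st r * st s = st r * st s * st r)%g.
Proof.
move=> rs; have [los ac bc] := next_pos rs; rewrite /st los -!mulgA.
by rewrite tperm_braid // lo_hi.
Qed.

Lemma st_braid_mid r s : s = r.+1 :> nat ->
  (st s * st r * st s = tperm (lo r) (hi s))%g.
Proof.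
move=> rs; have [los ac bc] := next_pos rs; rewrite /st los -mulgA.
by rewrite -{1}(tpermV (hi r)) -conjgE tpermJ tpermL tpermD // 1?eq_sym // lo_hi.
Qed.

Lemma swap_id r t :
  tnth (val t) (lo r) = tnth (val t) (hi r) -> swap r t = t.
Proof.
move=> tt; apply: wseq_eqP => p; rewrite tnth_swap.
have [->|plo] := eqVneq p (lo r); first by rewrite st_lo.
have [->|phi] := eqVneq p (hi r); first by rewrite st_hi.
by rewrite st_neq.
Qed.

End Positions.

Section PolRep.
Variables (k : fieldType) (G : quiver) (alpha : {ffun G -> nat}).
Local Notation n := (height alpha).
Local Notation P := {mpoly k[n]}.
Local Notation V := {ffun wseq alpha -> P}.
Local Notation F := (free_alg k (klr_gen alpha)).
Implicit Types (i j : wseq alpha) (r s : 'I_n.-1) (p : 'I_n) (g h : P) (v : V).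

(** The polynomial representation is the sum, over the sequences i, of copies of
    the polynomial ring; this is g in the copy of i. *)
Definition single i g : V := [ffun j => if j == i then g else 0].

Lemma single_is_linear i : linear (single i).
Proof.
move=> c g h; apply/ffunP => j; rewrite !ffunE.
by case: eqP => _; rewrite ?scaler0 ?addr0.
Qed.
HB.instance Definition _ i :=
  GRing.isLinear.Build k P V _ (single i) (single_is_linear i).

Lemma single_sum v : v = \sum_i single i (v i).
Proof.
apply/ffunP => j; rewrite sum_ffunE (bigD1 j) //= ffunE eqxx big1 ?addr0 //.
by move=> i /negPf ij; rewrite ffunE eq_sym ij.
Qed.

Lemma sum_single (W : zmodType) j g (f : wseq alpha -> P -> W) :
  (forall i, f i 0 = 0) -> \sum_i f i (single j g i) = f j g.
Proof.
move=> f0; rewrite (bigD1 j) //= ffunE eqxx big1 ?addr0 // => i /negPf ij.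
by rewrite ffunE ij.
Qed.

Definition tauo i r : P -> P :=
  taup (tnth (val i) (lo r)) (tnth (val i) (hi r)) (lo r) (hi r).

Lemma tauo_is_linear i r : linear (tauo i r).
Proof. exact/taup_is_linear/lo_hi. Qed.
HB.instance Definition _ i r :=
  GRing.isLinear.Build k P P _ (tauo i r) (tauo_is_linear i r).

Definition eop i v : V := single i (v i).
Definition xop p v : V := \sum_i single i ('X_p * v i).
Definition top r v : V := \sum_i single (swap r i) (tauo i r (v i)).

Lemma eop_is_linear i : linear (eop i).
Proof. by move=> c u v; rewrite /eop !ffunE linearP. Qed.
Lemma xop_is_linear p : linear (xop p).
Proof.
move=> c u v; rewrite /xop scaler_sumr -big_split; apply: eq_bigr => i _.
by rewrite !ffunE mulrDr -scalerAr linearP.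
Qed.
Lemma top_is_linear r : linear (top r).
Proof.
move=> c u v; rewrite /top scaler_sumr -big_split; apply: eq_bigr => i _.
by rewrite !ffunE !linearP.
Qed.
HB.instance Definition _ i :=
  GRing.isLinear.Build k V V _ (eop i) (eop_is_linear i).
HB.instance Definition _ p :=
  GRing.isLinear.Build k V V _ (xop p) (xop_is_linear p).
HB.instance Definition _ r :=
  GRing.isLinear.Build k V V _ (top r) (top_is_linear r).

Definition pgen (x : klr_gen alpha) : {linear V -> V} :=
  match x with
  | inl (inl i) => eop i
  | inl (inr p) => xop p
  | inr r => top r
  end.

Local Notation fa := (free_act pgen).
Local Notation e i := (free_gen k (inl (inl i) : klr_gen alpha)).
Local Notation x r := (free_gen k (inl (inr r) : klr_gen alpha)).
Local Notation tau r := (free_gen k (inr r : klr_gen alpha)).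

Lemma fa_e i j g : fa (e i) (single j g) = if i == j then single j g else 0.
Proof.
rewrite free_act_gen /= /eop ffunE; case: eqP => [->|] //.
by rewrite linear0.
Qed.

Lemma fa_x p j g : fa (x p) (single j g) = single j ('X_p * g).
Proof.
rewrite free_act_gen /= /xop (@sum_single _ j g (fun i g => single i ('X_p * g))) // => i.
by rewrite mulr0 linear0.
Qed.

Lemma fa_tau r j g : fa (tau r) (single j g) = single (swap r j) (tauo j r g).
Proof.
rewrite free_act_gen /= /top (@sum_single _ j g (fun i g => single _ (tauo i r g))) // => i.
by rewrite !linear0.
Qed.

Lemma fa_single a b : (forall i g, fa a (single i g) = fa b (single i g)) ->
  forall v, fa a v = fa b v.
Proof.
move=> ab v; rewrite [v]single_sum !linear_sum; apply: eq_bigr => i _.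
exact: ab.
Qed.

Definition acts_by (a : F) h := forall i g, fa a (single i g) = single i (h * g).

Lemma acts_byM a b g h : acts_by a g -> acts_by b h -> acts_by (a * b) (g * h).
Proof. by move=> ag bh i f; rewrite free_actM bh ag mulrA. Qed.
Lemma acts_byD a b g h : acts_by a g -> acts_by b h -> acts_by (a + b) (g + h).
Proof. by move=> ag bh i f; rewrite free_actD ag bh mulrDl linearD. Qed.
Lemma acts_byB a b g h : acts_by a g -> acts_by b h -> acts_by (a - b) (g - h).
Proof. by move=> ag bh i f; rewrite free_actB ag bh mulrBl linearB. Qed.
Lemma acts_by0 : acts_by 0 0.
Proof. by move=> i g; rewrite free_act0 mul0r linear0. Qed.
Lemma acts_by1 : acts_by 1 1.
Proof. by move=> i g; rewrite free_act1 mul1r. Qed.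
Lemma acts_byX a h m : acts_by a h -> acts_by (a ^+ m) (h ^+ m).
Proof.
move=> ah; elim: m => [|m IHm]; first exact: acts_by1.
by rewrite !exprS; apply: acts_byM.
Qed.
Lemma acts_byZ c a h : acts_by a h -> acts_by (c *: a) (c *: h).
Proof. by move=> ah i g; rewrite free_actZ ah -scalerAl linearZ. Qed.
Lemma acts_by_x p : acts_by (x p) 'X_p.
Proof. by move=> i g; rewrite fa_x. Qed.

Lemma acts_by_Qpol u w a b g h : acts_by a g -> acts_by b h ->
  acts_by (@Qpol G F u w a b) (Qpol u w g h).
Proof.
move=> ag bh; rewrite /Qpol; case: eqP => _; first exact: acts_by0.
by apply: acts_byM; apply/acts_byX/acts_byB.
Qed.

Lemma acts_by_ev3 (D : mpoly 3 k) p q p' : acts_by (ev3 D (x p) (x q) (x p'))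
  (mmap (@mpolyC n k) (tnth [tuple 'X_p; 'X_q; 'X_p']) D).
Proof.
rewrite /ev3 /mmap; elim/big_rec2: _ => [|m h a _ ah]; first exact: acts_by0.
apply: acts_byD => //.
have -> : forall (z : k) (b : F), z%:A * b = z *: b.
  by move=> z b; rewrite -scalerAl mul1r.
rewrite mul_mpolyC; apply: acts_byZ; rewrite /mmap1.
elim/big_rec2: _ => [|l f b _ bf]; first exact: acts_by1.
apply: acts_byM => //; apply: acts_byX.
by case: l => [[|[|[|]]]] //= l; rewrite /tnth /=; apply: acts_by_x.
Qed.
End PolRep.

Section PolRelations.
Variables (k : fieldType) (G : quiver) (alpha : {ffun G -> nat}).
Local Notation n := (height alpha).
Local Notation P := {mpoly k[n]}.
Local Notation V := {ffun wseq alpha -> P}.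
Local Notation F := (free_alg k (klr_gen alpha)).
Implicit Types (i j : wseq alpha) (r s : 'I_n.-1) (p : 'I_n) (g h : P) (v : V).
Local Notation fa := (free_act (@pgen k G alpha)).

(** When the two colours agree the sequence is fixed by the exchange, so that the
    correction term of the mixed relations may be written in the component
    where the other two terms live. *)
Lemma fa_same_colour r i g :
  let b := tnth (val i) (lo r) == tnth (val i) (hi r) in
  fa b%:R (single i g) = single (swap r i) (b%:R * g).
Proof.
move=> b; rewrite {}/b; case: eqP => [/swap_id->|_].
  by rewrite free_act1 mul1r.
by rewrite free_act0 mul0r linear0.
Qed.

Lemma Qpol_rmorph (A B : pzRingType) (f : {rmorphism A -> B}) (u v : G) a b :
  f (Qpol u v a b) = Qpol u v (f a) (f b).
Proof.
by rewrite /Qpol; case: eqP; rewrite ?rmorph0 // rmorphM !rmorphXn !rmorphB.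
Qed.

Lemma divdiff_eval (u v : G) (D : mpoly 3 k) p q p' : is_divdiff u v D ->
  ('X_p' - 'X_p) * mmap (@mpolyC n k) (tnth [tuple 'X_p; 'X_q; 'X_p']) D =
  Qpol u v 'X_p' 'X_q - Qpol u v 'X_p 'X_q :> P.
Proof.
set h := tnth _; pose f : {rmorphism mpoly 3 k -> P} := mmap (@mpolyC n k) h.
rewrite /is_divdiff /= => /(congr1 f); rewrite rmorphM !rmorphB !Qpol_rmorph.
have fX l : f 'X_l = h l by rewrite /f /= mmapX mmap1U.
by rewrite !fX.
Qed.

Lemma fa_braid r s i E g : s = r.+1 :> nat ->
  let u := tnth (val i) (lo r) in let v := tnth (val i) (hi r) in
  let w := tnth (val i) (hi s) in
  (u = w -> ('X_(hi s) - 'X_(lo r)) * E =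
     Qpol u v 'X_(hi s) 'X_(hi r) - Qpol u v 'X_(lo r) 'X_(hi r)) ->
  fa (free_gen k (inr s : klr_gen alpha) * free_gen k (inr r : klr_gen alpha)
        * free_gen k (inr s : klr_gen alpha)
      - free_gen k (inr r : klr_gen alpha) * free_gen k (inr s : klr_gen alpha)
        * free_gen k (inr r : klr_gen alpha)) (single i g) =
  single (wact (st s * st r * st s) i) ((if u == w then E else 0) * g).
Proof.
move=> rs u v w EE; have [los ac bc] := next_pos rs.
rewrite free_actB [X in X - _]free_actM [X in _ - X]free_actM !fa_tau.
rewrite [X in X - _]free_actM [X in _ - X]free_actM !fa_tau.
rewrite !wact_swap !wactM -(st_braid rs) -linearB /=; congr single.
rewrite -(taup_braid (lo_hi r) ac bc g EE) /tauo !tnth_wact !permM los.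
have st_s_lo : st s (lo r) = lo r by rewrite st_neq ?los // lo_hi.
have st_r_hi : st r (hi s) = hi s by rewrite st_neq // eq_sym.
have st_s : st s (hi r) = hi s by rewrite -los st_lo.
have st_s' : st s (hi s) = hi r by rewrite st_hi los.
by rewrite !(st_s_lo, st_r_hi, st_s, st_s', st_lo, st_hi) los.
Qed.

Lemma pgen_rel a b : klr_rel a b -> forall v, fa a v = fa b v.
Proof.
move=> ab; apply: fa_single; case: ab => {a b}.
- move=> i j l g; rewrite free_actM fa_e.
  case: (eqVneq i j) => [->|ij]; rewrite ?fa_e ?free_act0.
    by case: eqP => [<-|_]; rewrite ?linear0 ?fa_e ?eqxx.
  by case: eqP => [<-|_]; rewrite ?linear0 ?fa_e ?(negPf ij).
- move=> l g; rewrite free_act_sum free_act1 (bigD1 l) //= fa_e eqxx big1 ?addr0 //.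
  by move=> i /negPf il; rewrite fa_e il.
- move=> p i l g; rewrite [LHS]free_actM [RHS]free_actM fa_e fa_x fa_e.
  by case: eqP; rewrite ?linear0 ?fa_x.
- move=> r i l g; rewrite [LHS]free_actM [RHS]free_actM fa_e fa_tau fa_e.
  rewrite (inj_eq (can_inj (swapK r))).
  by case: eqP; rewrite ?linear0 ?fa_tau.
- move=> p q l g; rewrite [LHS]free_actM [RHS]free_actM !fa_x; congr single.
  exact: mulrCA.
- move=> r i l g; rewrite [LHS]free_actM [RHS]free_actM fa_e.
  case: eqP => [<-|_]; last by rewrite !linear0.
  rewrite [LHS]free_actM fa_x fa_tau free_actD [X in X + _]free_actM fa_tau fa_x.
  rewrite fa_same_colour -linearD /=; congr single.
  exact: (taup_hi _ _ _ (lo_hi r)).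
- move=> r i l g; rewrite [LHS]free_actM [RHS]free_actM fa_e.
  case: eqP => [<-|_]; last by rewrite !linear0.
  rewrite [LHS]free_actM fa_tau fa_x free_actD [X in X + _]free_actM fa_x fa_tau.
  rewrite fa_same_colour -linearD /=; congr single.
  exact: (taup_lo _ _ _ (lo_hi r)).
- move=> r p plo phi l g; rewrite [LHS]free_actM [RHS]free_actM !fa_x !fa_tau fa_x.
  congr single; exact: (taup_far _ _ _ (lo_hi r)).
- move=> r s rs l g; have [e1 e2 e3 e4] := far_pos rs.
  have [e1' e2' e3' e4'] :
    [/\ lo s != lo r, hi s != lo r, lo s != hi r & hi s != hi r].
    by split; rewrite eq_sym.
  rewrite [LHS]free_actM [RHS]free_actM !fa_tau /tauo !tnth_swap.
  rewrite (st_neq e1 e2) (st_neq e3 e4) (st_neq e1' e3') (st_neq e2' e4').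
  rewrite taup_farC ?lo_hi // ; congr single.
  by rewrite !wact_swap !wactM st_far.
- move=> r i l g; rewrite [LHS]free_actM [RHS]free_actM fa_e.
  case: eqP => [<-|_]; last by rewrite !linear0.
  rewrite (acts_by_Qpol _ _ (acts_by_x _) (acts_by_x _)).
  rewrite [LHS]free_actM !fa_tau swapK.
  congr single; rewrite /tauo !tnth_swap st_lo st_hi.
  exact: (taup_sq _ _ _ (lo_hi r)).
- move=> r s i D rs ii DD l g; rewrite [LHS]free_actM [RHS]free_actM fa_e.
  case: eqP => [<-|_]; last by rewrite !linear0.
  have EE := divdiff_eval (lo r) (hi r) (hi s) DD.
  rewrite acts_by_ev3 (fa_braid g rs (fun _ => EE)) ii eqxx; congr single.
  apply: wseq_eqP => p; rewrite tnth_wact (st_braid_mid rs).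
  by case: tpermP => [->|->|//]; rewrite ii.
- move=> r s i rs ii l g; rewrite [LHS]free_actM fa_e free_act0.
  case: eqP => [<-|_]; last by rewrite !linear0.
  rewrite (fa_braid g rs (E := 0)) ?(negPf ii) ?mul0r ?linear0 //.
  by move=> eqi; rewrite eqi eqxx in ii.
Qed.

Definition pol_act := klr_act (@pgen k G alpha).

HB.instance Definition _ a := GRing.Linear.on (pol_act a).

Lemma pol_actD a b v : pol_act (a + b) v = pol_act a v + pol_act b v.
Proof. exact: (klr_actD pgen_rel). Qed.
Lemma pol_actN a v : pol_act (- a) v = - pol_act a v.
Proof. exact: (klr_actN pgen_rel). Qed.
Lemma pol_actM a b v : pol_act (a * b) v = pol_act a (pol_act b v).
Proof. exact: (klr_actM pgen_rel). Qed.
Lemma pol_act_scal c v : pol_act (pzscal c) v = c *: v.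
Proof. exact: (klr_act_scal pgen_rel). Qed.
Lemma pol_act0 v : pol_act 0 v = 0.
Proof. exact: (klr_act0 pgen_rel). Qed.
Lemma pol_act1 v : pol_act 1 v = v.
Proof. exact: (klr_act1 pgen_rel). Qed.
Lemma pol_act_sum (J : Type) (s : seq J) (Q : pred J) a v :
  pol_act (\sum_(j <- s | Q j) a j) v = \sum_(j <- s | Q j) pol_act (a j) v.
Proof. exact: (klr_act_sum pgen_rel). Qed.

Lemma pol_act_e i j g : pol_act (klr_e i) (single j g) = if i == j then single j g else 0.
Proof. by rewrite -fa_e free_act_gen; apply: (klr_act_e pgen_rel). Qed.
Lemma pol_act_x p j g : pol_act (klr_x p) (single j g) = single j ('X_p * g).
Proof. by rewrite -fa_x free_act_gen; apply: (klr_act_x pgen_rel). Qed.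
Lemma pol_act_tau r j g :
  pol_act (klr_tau r) (single j g) = single (swap r j) (tauo j r g).
Proof. by rewrite -fa_tau free_act_gen; apply: (klr_act_tau pgen_rel). Qed.
End PolRelations.

(** * Words in the simple transpositions *)

Section Words.
Variables (I : finType) (alpha : {ffun I -> nat}).
Local Notation n := (height alpha).
Implicit Types (L : 'S_n) (r s : 'I_n.-1) (u v : seq 'I_n.-1) (p q : 'I_n).

(** An arrangement L of the strands maps positions to strands; a crossing at r is
    the multiplication by st r on the left, so that words act from right to
    left. *)
Definition wperm u : 'S_n := foldr (fun r L => st r * L)%g 1%g u.

Lemma wperm_cons r u : wperm (r :: u) = (st r * wperm u)%g.
Proof. by []. Qed.

Lemma wperm_cat u v : wperm (u ++ v) = (wperm u * wperm v)%g.
Proof. by elim: u => /= [|r u IHu]; rewrite ?mul1g // IHu mulgA. Qed.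

(** Read from right to left, each letter of an ascending word exchanges two
    strands that have not met before; such a word is reduced. *)
Fixpoint up u : bool :=
  if u is r :: u' then up u' && (wperm u' (lo r) < wperm u' (hi r))%N else true.

Lemma up_cons r u :
  up (r :: u) = up u && (wperm u (lo r) < wperm u (hi r))%N.
Proof. by []. Qed.

Definition inversions L : {set 'I_n * 'I_n} :=
  [set pq : 'I_n * 'I_n | (pq.1 < pq.2)%N && (L pq.2 < L pq.1)%N].
Definition inv L := #|inversions L|.

Lemma stL r L p : (st r * L)%g p = L (st r p).
Proof. exact: permM. Qed.

Lemma val_st r p : st r p = (if p == r :> nat then r.+1
  else if p == r.+1 :> nat then r : nat else p) :> nat.
Proof.
rewrite /st; case: tpermP => [->|->|/eqP + /eqP]; rewrite -?val_eqE /=.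
- by rewrite eqxx.
- by rewrite eqxx gtn_eqF.
by move=> /negPf-> /negPf->.
Qed.

(** An adjacent transposition preserves the order of any pair but its own. *)
Lemma st_mono r p q : (p < q)%N -> (p, q) != (lo r, hi r) ->
  (st r p < st r q)%N.
Proof.
rewrite xpair_eqE -!val_eqE /= !val_st => pq.
by repeat (case: eqP => //= ?); lia.
Qed.

Lemma inv_st r L : (L (lo r) < L (hi r))%N -> inv (st r * L)%g = (inv L).+1.
Proof.
move=> asc; pose f (pq : 'I_n * 'I_n) := (st r pq.1, st r pq.2).
have f_inj : injective f.
  by move=> [p q] [p' q'] [/perm_inj-> /perm_inj->].
have stK p : st r (st r p) = p by rewrite -permM st2 perm1.
have -> : inv (st r * L)%g = #|(lo r, hi r) |: f @^-1: inversions L|.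
  rewrite /inv; congr #|pred_of_set _|; apply/setP => -[p q].
  rewrite !inE !stL /=; have [[-> ->]|ne] := eqVneq (p, q) (lo r, hi r).
    by rewrite st_lo st_hi asc /= ltnSn.
  have [pq|qp] := ltnP p q; first by rewrite st_mono.
  apply/esym/negP => /andP[spq sL].
  have [[splo sqhi]|ne'] := eqVneq (st r p, st r q) (lo r, hi r).
    by move: sL asc; rewrite splo sqhi; lia.
  by move: (st_mono spq ne'); rewrite !stK; lia.
rewrite cardsU1 !inE /= st_lo st_hi /= ltnNge leqnSn /= add1n.
by rewrite on_card_preimset //; exists f => -[p q] _; rewrite /f /= !stK.
Qed.

Lemma inv1 : inv 1%g = 0%N.
Proof.
apply/eqP; rewrite cards_eq0; apply/eqP/setP => -[p q].
by rewrite !inE !perm1 /=; lia.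
Qed.

Lemma inv_wperm u : up u -> inv (wperm u) = size u.
Proof.
elim: u => [|r u IHu] /=; first by rewrite inv1.
by case/andP=> /IHu <- /inv_st.
Qed.

Lemma wperm_desc r u : up (r :: u) ->
  (wperm (r :: u) (hi r) < wperm (r :: u) (lo r))%N.
Proof. by move=> /= /andP[_]; rewrite !stL st_lo st_hi. Qed.

Lemma descent L : L != 1%g -> exists r, (L (hi r) < L (lo r))%N.
Proof.
move=> L1; apply/existsP; apply: contraR L1 => /existsPn asc.
pose s := [seq val (L p) | p <- enum 'I_n].
have size_s : size s = n by rewrite size_map size_enum_ord.
have nth_s (p : 'I_n) : nth 0%N s p = L p.
  by rewrite (nth_map p) ?size_enum_ord // nth_ord_enum.
have sorted_s : sorted ltn s.
  apply/(sortedP 0%N) => m; rewrite size_s => lt_m.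
  have lt_r : (m < n.-1)%N by lia.
  have /= := asc (Ordinal lt_r); rewrite -(nth_s (hi _)) -(nth_s (lo _)) /=.
  rewrite -leqNgt leq_eqVlt => /orP[/eqP|] //.
  rewrite (nth_s (lo (Ordinal lt_r))) (nth_s (hi (Ordinal lt_r))).
  by move/val_inj/perm_inj/eqP; rewrite (negPf (lo_hi _)).
have sE : s = iota 0 n.
  apply: (irr_sorted_eq ltn_trans ltnn sorted_s (iota_ltn_sorted 0 n)) => m.
  rewrite mem_iota /=; apply/mapP/idP => [[p _ ->]|lt_m]; first exact: ltn_ord.
  by exists (L^-1 (Ordinal lt_m))%g; rewrite ?mem_enum // permKV.
apply/eqP/perm.permP => p; apply: val_inj.
by rewrite perm1 /= -nth_s sE nth_iota.
Qed.

Lemma not_up_split u : ~~ up u -> exists v r w,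
  [/\ u = v ++ r :: w, up w & (wperm w (hi r) < wperm w (lo r))%N].
Proof.
elim: u => [|r u IHu] //; rewrite up_cons.
have [upu|/IHu[v [s [w [-> upw desc]]]] _] := boolP (up u); last first.
  by exists (r :: v), s, w.
rewrite -leqNgt leq_eqVlt => /predU1P[/val_inj/perm_inj/eqP|desc].
  by rewrite eq_sym (negPf (lo_hi r)).
by exists [::], r, u.
Qed.

Lemma up_exists L : exists2 u, up u & wperm u = L.
Proof.
have [m] := ubnP (inv L); elim: m => // m IHm in L *; rewrite ltnS => leLm.
have [->|/descent[r desc]] := eqVneq L 1%g; first by exists [::].
have asc : ((st r * L)%g (lo r) < (st r * L)%g (hi r))%N.
  by rewrite !stL st_lo st_hi.
have LE : L = (st r * (st r * L))%g by rewrite mulgA st2 mul1g.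
have [|u up_u uE] := IHm (st r * L)%g.
  by move: leLm; rewrite {1}LE inv_st.
by exists (r :: u); rewrite /= ?uE -?LE // up_u.
Qed.
End Words.

(** * Straightening *)

Section Straightening.
Variables (k : fieldType) (A : pzAlgType k) (I : finType) (alpha : {ffun I -> nat}).
Local Notation n := (height alpha).
Variables (e : wseq alpha -> A) (x : 'I_n -> A) (tau : 'I_n.-1 -> A).
Local Notation P := {mpoly k[n]}.
Implicit Types (i j : wseq alpha) (r s : 'I_n.-1) (p : 'I_n) (g h : P).
Implicit Types (u v w : seq 'I_n.-1) (L : 'S_n) (a b : A).

Definition tau_word u : A := \prod_(r <- u) tau r.

Lemma tau_word0 : tau_word [::] = 1.
Proof. exact: big_nil. Qed.

Lemma tau_word_cons r u : tau_word (r :: u) = tau r * tau_word u.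
Proof. exact: big_cons. Qed.

Lemma tau_word_cat u v : tau_word (u ++ v) = tau_word u * tau_word v.
Proof. exact: big_cat. Qed.

(** The filtration used for straightening: the span of the tau_u g(x) e(i) with a
    word u shorter than m. *)
Inductive low i m : A -> Prop :=
| low0 : low i m 0
| lowD a b : low i m a -> low i m b -> low i m (a + b)
| low_gen u g : (size u < m)%N -> low i m (tau_word u * peval x g * e i).

Hypothesis xC : forall p q, GRing.comm (x p) (x q).
Hypothesis xe : forall p i, x p * e i = e i * x p.
Hypothesis te : forall r i, tau r * e i = e (swap r i) * tau r.
(* The relations used below, up to terms with fewer factors tau. *)
Hypothesis xt : forall p r i,
  exists c, x p * tau r * e i = (tau r * x (st r p) + pzscal c) * e i.
Hypothesis tt : forall r s, (r.+1 < s)%N || (s.+1 < r)%N ->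
  tau r * tau s = tau s * tau r.
Hypothesis t2 : forall r i, exists g, tau r * tau r * e i = peval x g * e i.
Hypothesis t3 : forall r s i, s = r.+1 :> nat -> exists g,
  (tau s * tau r * tau s - tau r * tau s * tau r) * e i = peval x g * e i.

Lemma peval_e g i : peval x g * e i = e i * peval x g.
Proof. by apply/esym/peval_comm => p; rewrite /GRing.comm xe. Qed.

Lemma tau_word_e u i : tau_word u * e i = e (wact (wperm u) i) * tau_word u.
Proof.
elim: u => [|r u IHu]; first by rewrite tau_word0 wact1 mulr1 mul1r.
by rewrite tau_word_cons -mulrA IHu mulrA te wact_swap wactM mulrA.
Qed.

Lemma low_le i m m' a : (m <= m')%N -> low i m a -> low i m' a.
Proof.
move=> mm'; elim=> [|b c _ lb _ lc|u g lt_u]; first exact: low0.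
  exact: lowD.
exact/low_gen/(leq_trans lt_u).
Qed.

Lemma low_tau i m r a : low i m a -> low i m.+1 (tau r * a).
Proof.
elim=> [|b c _ lb _ lc|u g lt_u].
- by rewrite mulr0; apply: low0.
- by rewrite mulrDr; apply: lowD.
by rewrite !mulrA -tau_word_cons; apply: low_gen.
Qed.

Lemma low_tau_word i m u a : low i m a -> low i (size u + m) (tau_word u * a).
Proof.
move=> la; elim: u => [|r u IHu]; first by rewrite tau_word0 mul1r.
by rewrite tau_word_cons -mulrA; apply: low_tau.
Qed.

Lemma low_scal i m c a : low i m a -> low i m (pzscal c * a).
Proof.
elim=> [|b d _ lb _ ld|u g lt_u].
- by rewrite mulr0; apply: low0.
- by rewrite mulrDr; apply: lowD.
by rewrite !mulrA pzscalC -[_ * _ * peval _ _]mulrA -pevalZ; apply: low_gen.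
Qed.

Lemma lowN i m a : low i m a -> low i m (- a).
Proof. by move/(low_scal (-1)); rewrite rmorphN1 mulN1r. Qed.

(** Moving x_p to the right through a word only produces shorter words. *)
Lemma low_x i m p a : low i m a -> low i m (x p * a).
Proof.
elim=> [|b c _ lb _ lc|u g lt_u].
- by rewrite mulr0; apply: low0.
- by rewrite mulrDr; apply: lowD.
apply: (low_le lt_u); elim: u p {m lt_u} => [|r u IHu] p.
  by rewrite mulrA tau_word0 mul1r -pevalXl // -[peval _ _]mul1r -tau_word0; apply: low_gen.
have [c xtE] := xt p r (wact (wperm u) i).
have -> : x p * (tau_word (r :: u) * peval x g * e i) =
    tau r * (x (st r p) * (tau_word u * peval x g * e i)) +
    pzscal c * (tau_word u * peval x g * e i).
  rewrite tau_word_cons -[tau r * _ * _]mulrA -[tau r * _ * _]mulrA.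
  have [b ->] : exists b, tau_word u * peval x g * e i = e (wact (wperm u) i) * b.
    by exists (tau_word u * peval x g); rewrite -mulrA peval_e !mulrA tau_word_e.
  by rewrite !mulrA xtE mulrDl mulrDl.
apply: lowD; first exact/low_tau/IHu.
by apply/low_scal/low_gen; rewrite /= ltnS.
Qed.

Lemma low_peval i m g a : low i m a -> low i m (peval x g * a).
Proof.
move=> la; elim/mpoly_gen_ind: g => [|g h lg lh||c g lg|p g lg].
- by rewrite peval0 mul0r; apply: low0.
- by rewrite pevalD mulrDl; apply: lowD.
- by rewrite peval1 mul1r.
- by rewrite pevalZ -mulrA; apply: low_scal.
- by rewrite pevalXl // -mulrA; apply: low_x.
Qed.

Lemma low_pevalr i m g a : low i m a -> low i m (a * peval x g).
Proof.
elim=> [|b c _ lb _ lc|u h lt_u].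
- by rewrite mul0r; apply: low0.
- by rewrite mulrDl; apply: lowD.
rewrite -mulrA -peval_e !mulrA -[tau_word u * _ * _]mulrA.
suff [f ->] : exists f, peval x h * peval x g = peval x f by apply: low_gen.
elim/mpoly_gen_ind: h => [|f f' [q E] [q' E']||c f [q E]|p f [q E]].
- by exists 0; rewrite peval0 mul0r.
- by exists (q + q'); rewrite !pevalD mulrDl E E'.
- by exists g; rewrite peval1 mul1r.
- by exists (c *: q); rewrite !pevalZ -mulrA E.
- by exists ('X_p * q); rewrite !pevalXl // -mulrA E.
Qed.

Lemma low_quad i r w : low i (size w).+1 (tau r * tau r * (tau_word w * e i)).
Proof.
have [g gE] := t2 r (wact (wperm w) i).
rewrite tau_word_e mulrA gE -mulrA -tau_word_e; apply: low_peval.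
by rewrite -[tau_word w]mulr1 -(peval1 x); apply: low_gen.
Qed.

Lemma low_braid i r s w : s = r.+1 :> nat -> low i (size w).+1
  ((tau s * tau r * tau s - tau r * tau s * tau r) * (tau_word w * e i)).
Proof.
move=> rs; have [g gE] := t3 (wact (wperm w) i) rs.
rewrite tau_word_e mulrA gE -mulrA -tau_word_e; apply: low_peval.
by rewrite -[tau_word w]mulr1 -(peval1 x); apply: low_gen.
Qed.

Lemma low_trans i m a b c : low i m (a - b) -> low i m (b - c) -> low i m (a - c).
Proof. by move=> ab bc; rewrite -[a](subrK b) -addrA; apply: lowD. Qed.

Lemma low_sym i m a b : low i m (a - b) -> low i m (b - a).
Proof. by move/lowN; rewrite opprB. Qed.

(** Two ascending words of the same permutation end, after their first
    letters, in words that can be compared by induction with ones to which a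
    commutation or braid relation applies. *)
Lemma low_up_uniq i m u v : size u = m -> up u -> up v -> wperm u = wperm v ->
  low i m (tau_word u * e i - tau_word v * e i).
Proof.
elim: m u v => [|m IHm] u v szu upu upv uv.
  have /eqP : size v = 0%N by rewrite -inv_wperm // -uv inv_wperm.
  by rewrite size_eq0 (size0nil szu) => /eqP->; rewrite subrr; apply: low0.
have szv : size v = m.+1 by rewrite -inv_wperm // -uv inv_wperm.
have same r w w' : size w = m -> up w -> up w' -> wperm w = wperm w' ->
    low i m.+1 (tau_word (r :: w) * e i - tau_word (r :: w') * e i).
  move=> szw upw upw' ww'; rewrite !tau_word_cons -!mulrA -mulrBr.
  exact/low_tau/IHm.
suff key r s u' v' : size u' = m -> size v' = m -> up (r :: u') ->
    up (s :: v') -> wperm (r :: u') = wperm (s :: v') -> (r <= s)%N ->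
    low i m.+1 (tau_word (r :: u') * e i - tau_word (s :: v') * e i).
  case: u v szu szv upu upv uv => [//|r u] [//|s v] [szu] [szv] upu upv uv.
  case: (leqP r s) => [|/ltnW] le_rs; first exact: key.
  by apply: low_sym; apply: key.
move=> {u v szu szv upu upv uv} szu szv upru upsv uv le_rs.
have [upu _] := andP upru; have [upv _] := andP upsv.
have := wperm_desc upru; have := wperm_desc upsv; rewrite -uv.
set L := wperm (r :: u') => dess desr.
have uE : wperm u' = (st r * L)%g by rewrite /L mulgA st2 mul1g.
have vE : wperm v' = (st s * L)%g by rewrite /L uv mulgA st2 mul1g.
clearbody L; clear uv; have [rs|ne_rs] := eqVneq r s.
  by rewrite -rs in upsv vE *; apply: same; rewrite // uE vE.
have [rs|ne_rs1] := eqVneq (s : nat) r.+1; last first.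
  have rs : (r.+1 < s)%N.
    by move: ne_rs ne_rs1 le_rs; rewrite -val_eqE /=; lia.
  have [e1 e2 e3 e4] := far_pos (introT orP (or_introl _ rs)).
  have stC := st_far (introT orP (or_introl _ rs)).
  have [w upw wE] := up_exists (st s * (st r * L))%g.
  have r_s : st r (lo s) = lo s /\ st r (hi s) = hi s.
    by rewrite !st_neq // eq_sym.
  have s_r : st s (lo r) = lo r /\ st s (hi r) = hi r by rewrite !st_neq.
  have up_s : up (s :: w).
    by rewrite up_cons upw wE !stL st_lo st_hi r_s.1 r_s.2.
  have up_r : up (r :: w).
    by rewrite up_cons upw wE !stL s_r.1 s_r.2 st_lo st_hi.
  have E1 : wperm u' = wperm (s :: w).
    by rewrite wperm_cons wE mulgA st2 mul1g.
  have E2 : wperm v' = wperm (r :: w).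
    rewrite wperm_cons wE vE [RHS]mulgA stC -mulgA; congr (_ * _)%g.
    by rewrite mulgA st2 mul1g.
  have szw : size (s :: w) = m by rewrite -(inv_wperm up_s) -E1 inv_wperm.
  have szw' : size (r :: w) = m by rewrite -(inv_wperm up_r) -E2 inv_wperm.
  apply: low_trans (same r _ _ szu upu up_s E1) _.
  apply: low_trans (low_sym (same s _ _ szv upv up_r E2)).
  by rewrite !tau_word_cons !mulrA tt ?rs // subrr; apply: low0.
have [los ac bc] := next_pos rs.
have [w upw wE] := up_exists (st r * (st s * (st r * L)))%g.
have [sa sc] : st s (lo r) = lo r /\ st s (hi s) = hi r.
  by rewrite st_hi los st_neq ?los // lo_hi.
have rc : st r (hi s) = hi s by rewrite st_neq // eq_sym.
have sb : st s (hi r) = hi s by rewrite -los st_lo.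
have stE := (los, stL, sa, sc, rc, sb, st_lo, st_hi).
rewrite los in dess.
have Lac := ltn_trans dess desr.
have wE' : wperm w = (st s * (st r * (st s * L)))%g.
  by rewrite wE !mulgA (st_braid rs).
have up_r : up (r :: w) by rewrite up_cons upw wE !stE.
have up_s : up (s :: w) by rewrite up_cons upw wE !stE.
have up_sr : up [:: s, r & w].
  by rewrite up_cons up_r wperm_cons wE !stE.
have up_rs : up [:: r, s & w].
  by rewrite up_cons up_s wperm_cons wE !stE.
have E1 : wperm u' = wperm [:: s, r & w].
  rewrite !wperm_cons wE uE !mulgA -[(st s * st r * st r)%g]mulgA st2 mulg1.
  by rewrite st2 mul1g.
have E2 : wperm v' = wperm [:: r, s & w].
  rewrite !wperm_cons wE' vE !mulgA -[(st r * st s * st s)%g]mulgA st2 mulg1.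
  by rewrite st2 mul1g.
have szw : size [:: s, r & w] = m by rewrite -(inv_wperm up_sr) -E1 inv_wperm.
have szw' : size [:: r, s & w] = m by rewrite -(inv_wperm up_rs) -E2 inv_wperm.
apply: low_trans (same r _ _ szu upu up_sr E1) _.
apply: low_trans (low_sym (same s _ _ szv upv up_rs E2)).
apply: low_sym; rewrite -mulrBl !tau_word_cons !mulrA -!mulrBl -mulrA.
by apply: low_le (low_braid _ _ rs); rewrite -szw /= ltnS leqW.
Qed.

(** A word that is not ascending can be rewritten so as to begin with a square,
    which the quadratic relation replaces by a polynomial. *)
Lemma low_not_up i r u : up u -> (wperm u (hi r) < wperm u (lo r))%N ->
  low i (size u).+1 (tau_word (r :: u) * e i).
Proof.
move=> upu desc; have [v upv vE] := up_exists (st r * wperm u)%g.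
have uE : wperm u = wperm (r :: v) by rewrite wperm_cons vE mulgA st2 mul1g.
have uprv : up (r :: v) by rewrite up_cons upv vE !stL st_lo st_hi.
have szu : size u = (size v).+1 by rewrite -inv_wperm // uE inv_wperm.
rewrite tau_word_cons -mulrA -[tau_word u * e i](subrK (tau_word (r :: v) * e i)) mulrDr.
apply: lowD; first exact/low_tau/low_up_uniq.
rewrite tau_word_cons -mulrA mulrA; apply: low_le (low_quad i r v).
by rewrite szu ltnS leqnSn.
Qed.

(** By induction on the filtration: a word is replaced by the one chosen for its
    permutation, up to shorter words. Any choice will do, and this freedom is
    what makes the spanning set of the balanced algebra accessible. *)
Lemma low_span i (sel : 'S_n -> seq 'I_n.-1) m a :
  (forall L, up (sel L)) -> (forall L, wperm (sel L) = L) -> low i m a ->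
  exists c : 'S_n -> P, a = \sum_L tau_word (sel L) * peval x (c L) * e i.
Proof.
move=> sel_up selK.
have z : \sum_(L : 'S_n) tau_word (sel L) * peval x 0 * e i = 0.
  by rewrite big1 // => L _; rewrite peval0 mulr0 mul0r.
elim: m a => [|m IHm] a la.
  by exists (fun=> 0); rewrite z; elim: la => [|b c _ -> _ ->|//]; rewrite ?addr0.
elim: la => [|b b' _ [c ->] _ [c' ->]|u g lt_u].
- by exists (fun=> 0); rewrite z.
- exists (fun L => c L + c' L); rewrite -big_split; apply: eq_bigr => L _.
  by rewrite pevalD mulrDr mulrDl.
have [upu|/not_up_split[v [r [w [uE upw desc]]]]] := boolP (up u); last first.
  apply: IHm; rewrite -mulrA peval_e mulrA; apply: low_pevalr.
  rewrite uE tau_word_cat -mulrA; apply: low_le (low_tau_word v (low_not_up i upw desc)).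
  by rewrite -ltnS (leq_trans _ lt_u) // uE size_cat.
set L := wperm u.
have [c cE] : exists c : 'S_n -> P, (tau_word u * e i - tau_word (sel L) * e i) * peval x g =
    \sum_L tau_word (sel L) * peval x (c L) * e i.
  apply/IHm/low_pevalr/(@low_le _ (size u)) => //.
  by apply: low_up_uniq; rewrite ?selK.
exists (fun L' => c L' + if L' == L then g else 0).
rewrite (eq_bigr (fun L' => tau_word (sel L') * peval x (c L') * e i +
    (if L' == L then tau_word (sel L) * peval x g * e i else 0))) => [|L' _].
  rewrite big_split /= -cE -big_mkcond big_pred1_eq mulrBl -!mulrA.
  by rewrite -!peval_e subrK.
rewrite pevalD mulrDr mulrDl; case: eqP => [->|] //.
by rewrite peval0 mulr0 mul0r.
Qed.
End Straightening.

(** * The KLR algebra is spanned by ascending words *)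

(** The relations are moved from the free algebra to the quotient by lemmas about
    an arbitrary quotient, which keeps the terms small. *)
Section ClsOfRelations.
Variables (k : fieldType) (A : pzAlgType k) (J : ideal A).
Implicit Types (a b d f z : A).

Lemma cls_mixed a b d f z : cls J (a * b * d) = cls J ((f * a + z) * d) ->
  cls J a * cls J b * cls J d = (cls J f * cls J a + cls J z) * cls J d.
Proof. by rewrite !clsM clsD clsM. Qed.

Lemma cls_mixed' a b d f z : cls J (b * a * d) = cls J ((a * f + z) * d) ->
  cls J b * cls J a * cls J d = (cls J a * cls J f + cls J z) * cls J d.
Proof. by rewrite !clsM clsD clsM. Qed.

Lemma cls_square a d z : cls J (a * a * d) = cls J (z * d) ->
  cls J a * cls J a * cls J d = cls J z * cls J d.
Proof. by rewrite !clsM. Qed.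

Lemma cls_braid a b d z : cls J ((a * b * a - b * a * b) * d) = cls J z ->
  (cls J a * cls J b * cls J a - cls J b * cls J a * cls J b) * cls J d = cls J z.
Proof. by rewrite clsM (rmorphB (cls J)) /= !clsM. Qed.
End ClsOfRelations.

Section KLRSpan.
Variables (k : fieldType) (G : quiver) (alpha : {ffun G -> nat}).
Local Notation R := (klr k alpha).
Local Notation n := (height alpha).
Local Notation P := {mpoly k[n]}.
Local Notation F := (free_alg k (klr_gen alpha)).
Local Notation X := (@klr_x k G alpha).
Local Notation J := (ideal_gen (fun f : F => exists a b, klr_rel a b /\ f = a - b)).
Implicit Types (i : wseq alpha) (r s : 'I_n.-1) (p : 'I_n) (g h : P).

Let c : {rmorphism F -> R} := cls J.

Lemma klr_xC p q : GRing.comm (X p) (X q).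
Proof. exact: klr_xxC. Qed.

Lemma klr_tx_hiE r i : klr_tau r * X (hi r) * klr_e i =
  (X (lo r) * klr_tau r +
     (tnth (val i) (lo r) == tnth (val i) (hi r))%:R) * klr_e i.
Proof.
by rewrite -(rmorph_nat (cls J)); apply/cls_mixed/klr_relE/klr_tx_hi.
Qed.

Lemma klr_xt_hiE r i : X (hi r) * klr_tau r * klr_e i =
  (klr_tau r * X (lo r) +
     (tnth (val i) (lo r) == tnth (val i) (hi r))%:R) * klr_e i.
Proof.
by rewrite -(rmorph_nat (cls J)); apply/cls_mixed'/klr_relE/klr_xt_hi.
Qed.

Lemma klr_xt p r i : exists z,
  X p * klr_tau r * klr_e i = (klr_tau r * X (st r p) + pzscal z) * klr_e i.
Proof.
have [->|plo] := eqVneq p (lo r).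
  exists (- (tnth (val i) (lo r) == tnth (val i) (hi r))%:R).
  rewrite rmorphN rmorph_nat st_lo [RHS]mulrDl klr_tx_hiE mulrDl mulNr.
  by rewrite addrK.
have [->|phi] := eqVneq p (hi r).
  exists (tnth (val i) (lo r) == tnth (val i) (hi r))%:R.
  by rewrite rmorph_nat st_hi klr_xt_hiE.
exists 0; rewrite rmorph0 addr0 st_neq //; congr (_ * _).
by rewrite /klr_x /klr_tau -!clsM; apply/esym/klr_relE/klr_tx.
Qed.

Lemma klr_ttE r s : (r.+1 < s)%N || (s.+1 < r)%N ->
  klr_tau r * klr_tau s = klr_tau s * klr_tau r :> R.
Proof. by move=> rs; rewrite /klr_tau -!clsM; apply/klr_relE/klr_tt. Qed.

Definition xpoly (a : R) := exists g, a = peval X g.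

Lemma xpoly0 : xpoly 0. Proof. by exists 0; rewrite peval0. Qed.
Lemma xpoly1 : xpoly 1. Proof. by exists 1; rewrite peval1. Qed.
Lemma xpolyX p : xpoly (X p).
Proof.
by exists ('X_p * 1); rewrite pevalXl ?peval1 ?mulr1 //; apply: klr_xC.
Qed.
Lemma xpolyB a b : xpoly a -> xpoly b -> xpoly (a - b).
Proof. by move=> [g ->] [h ->]; exists (g - h); rewrite pevalB. Qed.
Lemma xpolyD a b : xpoly a -> xpoly b -> xpoly (a + b).
Proof. by move=> [g ->] [h ->]; exists (g + h); rewrite pevalD. Qed.
Lemma xpolyM a b : xpoly a -> xpoly b -> xpoly (a * b).
Proof.
move=> [g ->] [h ->].
elim/mpoly_gen_ind: g => [|f f' Ef Ef'||z f [q E]|p f [q E]].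
- by rewrite peval0 mul0r; apply: xpoly0.
- by rewrite pevalD mulrDl; apply: xpolyD.
- by rewrite peval1 mul1r; exists h.
- by rewrite pevalZ -mulrA E; exists (z *: q); rewrite pevalZ.
- rewrite pevalXl -?mulrA ?E; last exact: klr_xC.
  by exists ('X_p * q); rewrite pevalXl //; apply: klr_xC.
Qed.
Lemma xpoly_exp a m : xpoly a -> xpoly (a ^+ m).
Proof.
by move=> xa; elim: m => [|m IHm]; [exact: xpoly1 | rewrite exprS; apply: xpolyM].
Qed.

Lemma xpoly_Qpol (u v : G) (a b : F) :
  xpoly (c a) -> xpoly (c b) -> xpoly (c (Qpol u v a b)).
Proof.
move=> xa xb; rewrite Qpol_rmorph /Qpol; case: eqP => _; first exact: xpoly0.
by apply: xpolyM; apply/xpoly_exp/xpolyB.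
Qed.

Lemma xpoly_ev3 (D : mpoly 3 k) a b d : xpoly (c a) -> xpoly (c b) ->
  xpoly (c d) -> xpoly (c (ev3 D a b d)).
Proof.
move=> xa xb xd; rewrite /ev3 /mmap rmorph_sum.
apply: (big_ind xpoly) => [||m _]; [exact: xpoly0 | exact: xpolyD|].
rewrite rmorphM; apply: xpolyM.
  exists (D@_m *: 1); rewrite pevalZ peval1 mulr1; congr (cls J _).
  by rewrite -[LHS]monalg.mul_malgC mulr1.
rewrite /mmap1 rmorph_prod.
apply: (big_ind xpoly) => [||l _]; [exact: xpoly1 | exact: xpolyM|].
rewrite rmorphXn; apply: xpoly_exp.
by case: l => [[|[|[|]]]].
Qed.

Lemma klr_t2 r i : exists g, klr_tau r * klr_tau r * klr_e i = peval X g * klr_e i.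
Proof.
set u := tnth (val i) (lo r); set v := tnth (val i) (hi r).
have [g gE] := xpoly_Qpol u v (xpolyX (lo r)) (xpolyX (hi r)).
exists g; rewrite -gE; exact: cls_square (klr_relE (klr_tau2 _ _ _)).
Qed.

Lemma klr_t3 r s i : s = r.+1 :> nat -> exists g,
  (klr_tau s * klr_tau r * klr_tau s - klr_tau r * klr_tau s * klr_tau r) *
    klr_e i = peval X g * klr_e i.
Proof.
move=> rs; have [ii|ii] := eqVneq (tnth (val i) (lo r)) (tnth (val i) (hi s)).
  have [D DE] := divdiff_exists k (tnth (val i) (lo r)) (tnth (val i) (hi r)).
  have [g gE] := xpoly_ev3 D (xpolyX (lo r)) (xpolyX (hi r)) (xpolyX (hi s)).
  exists g; rewrite -gE; apply: etrans (clsM _ _ _).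
  exact: cls_braid (klr_relE (klr_braid_eq rs ii DE)).
exists 0; rewrite peval0 mul0r -(rmorph0 (cls J)).
exact: cls_braid (klr_relE (klr_braid_neq k rs ii)).
Qed.

(** Each generator maps every step of the filtration into the next one, so that the
    whole left ideal of e(i) is exhausted. *)
Lemma klr_span i (sel : 'S_n -> seq 'I_n.-1) (a : R) :
  (forall L, up (sel L)) -> (forall L, wperm (sel L) = L) ->
  exists c : 'S_n -> P,
    a * klr_e i = \sum_L tau_word klr_tau (sel L) * peval X (c L) * klr_e i.
Proof.
move=> sel_up selK.
suff [m la] : exists m, low klr_e X klr_tau i m (a * klr_e i).
  exact: (low_span klr_xC (@klr_xeC _ _ _) (@klr_teC _ _ _) klr_xt klr_ttE
    klr_t2 klr_t3 sel_up selK la).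
apply: (klr_left_ind (P := fun a => exists m, low klr_e X klr_tau i m a)).
- by exists 0%N; apply: low0.
- move=> b b' [m lb] [m' lb']; exists (maxn m m').
  by apply: lowD; [move: lb | move: lb']; apply: low_le;
    rewrite ?leq_maxl ?leq_maxr.
- exists 1%N; rewrite -[klr_e i]mul1r -[1]mul1r -{1}(tau_word0 klr_tau) -(peval1 X).
  exact: low_gen.
- by move=> z b [m lb]; exists m; apply: low_scal.
- move=> j b [m lb]; exists m; elim: lb => [|b1 b2 _ l1 _ l2|u g lt_u].
  + by rewrite mulr0; apply: low0.
  + by rewrite mulrDr; apply: lowD.
  rewrite -mulrA (peval_e (@klr_xeC _ _ _)) [tau_word _ _ * _]mulrA.
  rewrite (tau_word_e (@klr_teC _ _ _)) !mulrA klr_eM; case: eqP => [->|_].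
    rewrite -(tau_word_e (@klr_teC _ _ _)) -mulrA -(peval_e (@klr_xeC _ _ _)) mulrA.
    exact: low_gen.
  by rewrite !mul0r; apply: low0.
- by move=> p b [m lb]; exists m; apply: (low_x klr_xC _ _ klr_xt) => //;
    [exact: klr_xeC | exact: klr_teC].
- by move=> r b [m lb]; exists m.+1; apply: low_tau.
Qed.
End KLRSpan.

(** * Independence of the operators attached to ascending words *)

Section Dedekind.
Variables (k : fieldType) (n : nat).
Local Notation P := {mpoly k[n]}.
Implicit Types (L : 'S_n) (f g h : P).

(** Dedekind's independence of characters, for the permutations of the variables:
    a relation is shortened by comparing its values at f and at x_p f, where p
    tells two of the permutations apart. *)
Lemma msym_indep (c : 'S_n -> P) :
  (forall f, \sum_L c L * msym L f = 0) -> forall L, c L = 0.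
Proof.
move=> c0 L; have: L \in enum 'S_n by rewrite mem_enum.
have {}c0 f : \sum_(L <- enum 'S_n) c L * msym L f = 0.
  by rewrite -[RHS](c0 f) big_enum.
elim: (enum 'S_n) (enum_uniq 'S_n) c c0 L => // L0 s IHs /= /andP[L0s uniq_s] c c0.
have cs L : L \in s -> c L = 0.
  move=> Ls; have LL0 : L != L0 by apply: contraNneq L0s => <-.
  have [p pP] : exists p, L p != L0 p.
    apply/existsP; apply: contraR LL0 => /existsPn LL0.
    by apply/eqP/perm.permP => p; apply/eqP; have := LL0 p; rewrite negbK.
  suff /eqP : c L * ('X_(L p) - 'X_(L0 p)) = 0.
    by rewrite mulf_eq0 (negPf (subX_neq0 k pP)) orbF => /eqP.
  rewrite -!msymXU; set h := 'X_p.
  apply: (IHs _ (fun L => c L * (msym L h - msym L0 h))) => // f.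
  have tailE f' : \sum_(L <- s) c L * msym L f' = - (c L0 * msym L0 f').
    by apply/eqP; rewrite -addr_eq0 addrC; have := c0 f'; rewrite big_cons => ->.
  transitivity (\sum_(L <- s) c L * msym L (h * f) -
                msym L0 h * \sum_(L <- s) c L * msym L f).
    rewrite mulr_sumr -sumrB; apply: eq_bigr => L' _.
    by rewrite rmorphM /=; ring.
  by rewrite !tailE rmorphM /=; ring.
move=> L; rewrite inE => /predU1P[->|/cs//].
have := c0 1; rewrite big_cons big_seq big1 => [|L' /cs->]; last by rewrite mul0r.
by rewrite addr0 rmorph1 mulr1.
Qed.
End Dedekind.

Lemma factor_sum (A : comNzRingType) (a s m b c : A) :
  a * (s * m) + b * (c * m) = (a * s + b * c) * m.
Proof. by rewrite mulrDl !mulrA. Qed.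

Section LeadingTerms.
Variables (k : fieldType) (G : quiver) (alpha : {ffun G -> nat}).
Local Notation R := (klr k alpha).
Local Notation n := (height alpha).
Local Notation P := {mpoly k[n]}.
Implicit Types (i : wseq alpha) (r s : 'I_n.-1) (p : 'I_n) (f g h : P).
Implicit Types (L : 'S_n) (u : seq 'I_n.-1).

(** The operator of tau_u on the component of i, the colours being read off the
    sequence reached so far. *)
Fixpoint word_op u i g : P :=
  if u is r :: u' then tauo (wact (wperm u') i) r (word_op u' i g) else g.

Lemma word_op_is_linear u i : linear (word_op u i).
Proof. by elim: u => //= r u IHu c g h; rewrite IHu linearP. Qed.
HB.instance Definition _ u i :=
  GRing.isLinear.Build k P P _ (word_op u i) (word_op_is_linear u i).

Lemma pol_act_tau_word u i g :
  pol_act (tau_word klr_tau u) (single i g) = single (wact (wperm u) i) (word_op u i g).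
Proof.
elim: u => [|r u IHu] /=; first by rewrite tau_word0 pol_act1 wact1.
by rewrite tau_word_cons pol_actM IHu pol_act_tau wact_swap wactM.
Qed.

Lemma pol_act_peval h i g : pol_act (peval (@klr_x k G alpha) h) (single i g) = single i (h * g).
Proof.
elim/mpoly_gen_ind: h => [|h h' IH IH'||c h IH|p h IH].
- by rewrite peval0 pol_act0 mul0r linear0.
- rewrite pevalD [LHS]pol_actD mulrDl [RHS]linearD.
  by congr (_ + _); [exact: IH | exact: IH'].
- by rewrite peval1 pol_act1 mul1r.
- by rewrite pevalZ pol_actM IH pol_act_scal -scalerAl linearZ.
- by rewrite pevalXl ?pol_actM ?IH ?pol_act_x ?mulrA //; apply: klr_xC.
Qed.

Lemma inv_st_le r L : (inv (st r * L)%g <= (inv L).+1)%N.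
Proof.
have [asc|] := ltnP (L (lo r)) (L (hi r)); first by rewrite inv_st.
rewrite leq_eqVlt => /predU1P[/val_inj/perm_inj/eqP|desc].
  by rewrite eq_sym (negPf (lo_hi r)).
have := @inv_st _ _ r (st r * L)%g; rewrite !stL st_lo st_hi => /(_ desc).
by rewrite mulgA st2 mul1g => ->; rewrite leqW.
Qed.

(** Up to a denominator, a single tau is a combination of the reflection and
    the identity in which the reflection does occur. *)
Lemma tauo_lead i r D : D != 0 -> exists E a b : P, [/\ E != 0, a != 0 &
  forall h, E * tauo i r h =
    a * swapv (lo r) (hi r) (D * h) + b * (D * h)].
Proof.
move=> D0; have lohi := lo_hi r.
have SD0 : swapv (lo r) (hi r) D != 0.
  by rewrite -(rmorph0 (swapv (lo r) (hi r))) (inj_eq (can_inj (@swapvK _ _ _ _))).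
rewrite /tauo /taup; case: eqP => _; last first.
  exists (swapv (lo r) (hi r) D),
    (('X_(hi r) - 'X_(lo r)) ^+ narrows (tnth (val i) (hi r)) (tnth (val i) (lo r))), 0.
  split=> // [|h]; first by rewrite expf_neq0 // subX_neq0 // eq_sym.
  by rewrite mul0r addr0 rmorphM /= mulrCA.
exists (('X_(lo r) - 'X_(hi r)) * D * swapv (lo r) (hi r) D), D,
  (- swapv (lo r) (hi r) D).
split=> // [|h]; first by rewrite !mulf_neq0 // subX_neq0.
have -> : ('X_(lo r) - 'X_(hi r)) * D * swapv (lo r) (hi r) D * dem (lo r) (hi r) h
  = D * swapv (lo r) (hi r) D * (('X_(lo r) - 'X_(hi r)) * dem (lo r) (hi r) h).
  by ring.
rewrite demE rmorphM /=; ring.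
Qed.

(** Triangularity: up to a denominator, the operator of an ascending word of L is
    a combination of permutations in which the one of L does occur and all the
    others have fewer inversions. *)
Lemma word_op_lead u i : up u -> exists (D : P) (c : 'S_n -> P),
  [/\ D != 0, c (wperm u) != 0,
      forall L, c L != 0 -> L = wperm u \/ (inv L < size u)%N &
      forall g, D * word_op u i g = \sum_L c L * msym L^-1%g g].
Proof.
elim: u => [|r u IHu] => [_|/[dup] upru].
  exists 1, (fun L => (L == 1%g)%:R); split; rewrite ?oner_neq0 //= ?eqxx.
  - exact: oner_neq0.
  - by move=> L; case: (eqVneq L 1%g) => [->|]; [left | rewrite eqxx].
  - move=> g; rewrite (bigD1 1%g) //= eqxx big1 => [|L /negPf->].
      by rewrite invg1 msym1m addr0.
    by rewrite mul0r.
rewrite up_cons => /andP[upu asc].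
have [D [c [D0 cu cL cE]]] := IHu upu.
have [E [a [b [E0 a0 Eab]]]] := tauo_lead (wact (wperm u) i) r D0.
pose S := @swapv k n (lo r) (hi r).
have S_eq0 h : (S h == 0) = (h == 0).
  by rewrite -{1}(rmorph0 S) (inj_eq (can_inj (@swapvK _ _ _ _))).
have stK L : (st r * (st r * L))%g = L by rewrite mulgA st2 mul1g.
exists E, (fun L => a * S (c (st r * L)%g) + b * c L); split=> //.
- have -> : c (wperm (r :: u)) = 0.
    apply: contraTeq (isT) => /cL[]; rewrite ?inv_wperm //= ?ltnNge ?leqnSn //.
    move/(congr1 (fun L => L (lo r))); rewrite stL st_lo => E1.
    by rewrite E1 ltnn in asc.
  by rewrite mulr0 addr0 wperm_cons stK mulf_neq0 // S_eq0.
- move=> L; have [cL0|/cL cLn] := eqVneq (c L) 0; last first.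
    case: cLn => [->|lt_L] _; right; last by rewrite /= ltnS ltnW.
    by rewrite inv_wperm.
  rewrite cL0 mulr0 addr0 mulf_eq0 S_eq0 negb_or => /andP[_ /cL].
  case=> [E'|lt_L]; [by left; rewrite wperm_cons -E' stK | right].
  by rewrite -[L]stK (leq_ltn_trans (inv_st_le _ _)).
move=> g; rewrite /= Eab cE rmorph_sum mulr_sumr (reindex_inj (mulgI (st r))) /=.
rewrite mulr_sumr -big_split; apply: eq_bigr => L _ /=.
have <- : S (msym (st r * L)^-1%g g) = msym L^-1%g g.
  by rewrite /S /swapv -msymMm invMg -mulgA tpermV tperm2 mulg1.
rewrite (rmorphM S).
exact: (@factor_sum P a _ _ b).
Qed.

(** In a relation, the coefficient of a permutation with the largest number of
    inversions is isolated by the independence of the permutations. *)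
Lemma word_op_indep i (sel : 'S_n -> seq 'I_n.-1) (c : 'S_n -> P) :
  (forall L, up (sel L)) -> (forall L, wperm (sel L) = L) ->
  (forall f, \sum_L word_op (sel L) i (c L * f) = 0) -> forall L, c L = 0.
Proof.
move=> sel_up selK c0.
have [D DP] := choice (fun L => @word_op_lead (sel L) i (sel_up L)).
have [C CP] := choice DP.
have nzD L : D L != 0 by have [] := CP L.
pose D' L := \prod_(L' | L' != L) D L'.
pose d L' := \sum_L D' L * (C L L' * msym L'^-1%g (c L)).
have d0 L : d L = 0.
  rewrite -[L]invgK; move: (L^-1)%g; apply: msym_indep => f.
  transitivity ((\prod_L D L) * \sum_L word_op (sel L) i (c L * f)); last first.
    by rewrite c0 mulr0.
  rewrite (reindex_inj invg_inj) mulr_sumr.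
  under eq_bigr do rewrite invgK mulr_suml.
  rewrite exchange_big; apply: eq_bigr => L1 _.
  have -> : \prod_L D L = D' L1 * D L1 by rewrite (bigD1 L1) //= mulrC.
  have [_ _ _ CE] := CP L1; rewrite -[RHS]mulrA CE mulr_sumr.
  by apply: eq_bigr => L2 _; rewrite (rmorphM (msym L2^-1%g)) -!mulrA.
move=> L1; apply/eqP; apply: contraT => cL1.
have [L0 cL0 max_L0] := @arg_maxnP _ L1 (fun L => c L != 0) (@inv _ _) cL1.
move/eqP: (d0 L0); rewrite /d (bigD1 L0) //= big1 ?addr0 => [|L ne_L].
  have [_ + _ _] := CP L0; rewrite selK => CL0.
  have mL0 : msym L0^-1%g (c L0) != 0.
    by rewrite -(msym0 k L0^-1%g) (inj_eq (@inj_msym _ _ _)).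
  have D'0 : D' L0 != 0 by apply/prodf_neq0.
  by rewrite !mulf_eq0 (negPf CL0) (negPf mL0) (negPf D'0).
have [->|cL] := eqVneq (c L) 0; first by rewrite msym0 !mulr0.
have [_ _ CL _] := CP L; have [->|/CL] := eqVneq (C L L0) 0.
  by rewrite mul0r mulr0.
rewrite selK -(inv_wperm (sel_up L)) selK => -[E|]; first by rewrite E eqxx in ne_L.
by rewrite ltnNge; case/negP; apply: max_L0.
Qed.
End LeadingTerms.

(** * Matchings and the vanishing submodule *)

Section DoubledArrows.
Variables (G : quiver) (I1 : {set G}).
Local Notation DQ := (dquiver I1).
Implicit Types (i j : vert1 I1) (v w : DQ).

Lemma narrows_v1v2 i j : narrows (v1 i : DQ) (v2 j : DQ) = (i == j).
Proof.
rewrite /narrows; case: eqP => [->|ij].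
  rewrite (@eq_card1 _ (inr j)) // => -[h|l]; rewrite !inE /=.
    by rewrite /vsrc; case: split_vert.
  by apply/andP/eqP => [[/eqP[->]]|[->]].
apply/eqP/pred0P => -[h|l] /=; first by rewrite /vsrc; case: split_vert.
by apply/negP => /andP[/eqP[li] /eqP[lj]]; case: ij; rewrite -li.
Qed.

Lemma narrows_to_v2 v j : ~~ is1 v -> narrows v (v2 j : DQ) = 0%N.
Proof.
move=> v1; apply/eqP/pred0P => -[h|l] /=; apply/negP => /andP[/eqP E /eqP].
  by rewrite /vtgt; case: split_vert.
by rewrite -E in v1.
Qed.

Lemma narrows_from_v1 i v : ~~ is2 v -> narrows (v1 i : DQ) v = 0%N.
Proof.
move=> v2; apply/eqP/pred0P => -[h|l] /=; apply/negP => /andP[/eqP E /eqP E'].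
  by move: E; rewrite /vsrc; case: split_vert.
by rewrite -E' in v2.
Qed.

Lemma split_vert0 (b : vert0 I1) : split_vert I1 (val b) = inl b.
Proof.
case: split_vert (split_vertK I1 (val b)) => l /= lb.
  by congr inl; apply: val_inj.
by have := valP b; rewrite /= -lb (valP l).
Qed.

Lemma split_vert1 (b : vert1 I1) : split_vert I1 (val b) = inr b.
Proof.
case: split_vert (split_vertK I1 (val b)) => l /= lb.
  by have := valP l; rewrite /= lb (valP b).
by congr inr; apply: val_inj.
Qed.

Lemma base_vsrc (i : G) : base (vsrc I1 i) = i.
Proof. by rewrite /vsrc; case: split_vert (split_vertK I1 i). Qed.
Lemma base_vtgt (i : G) : base (vtgt I1 i) = i.
Proof. by rewrite /vtgt; case: split_vert (split_vertK I1 i). Qed.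
Lemma vsrcK v : ~~ is1 v -> vsrc I1 (base v) = v.
Proof. by case: v => [[b|b]|b] //= _; rewrite /vsrc ?split_vert0 ?split_vert1. Qed.
Lemma vtgtK v : ~~ is2 v -> vtgt I1 (base v) = v.
Proof. by case: v => [[b|b]|b] //= _; rewrite /vtgt ?split_vert0 ?split_vert1. Qed.

Lemma narrows_base v w : ~~ is1 v -> ~~ is2 w ->
  narrows v w = narrows (base v) (base w).
Proof.
move=> v1 w2; pose inlG (h : arrow G) : arrow DQ := inl h.
have inlG_inj : injective inlG by move=> h h' [].
rewrite /narrows -[RHS](card_image inlG_inj); apply: eq_card => -[h|l].
  rewrite (mem_image inlG_inj _ h) !inE /=.
  congr (_ && _); apply/eqP/eqP => [<-|->].
  - by rewrite base_vsrc.
  - by rewrite vsrcK.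
  - by rewrite base_vtgt.
  - by rewrite vtgtK.
rewrite !inE /=; apply/idP/imageP => [/andP[/eqP E _]|[h _]] //.
by rewrite -E in v1.
Qed.
End DoubledArrows.

Section RenamingVariables.
Variable k : fieldType.

Definition subm n d (m : 'I_n -> 'I_d) : {mpoly k[n]} -> {mpoly k[d]} :=
  comp_mpoly [tuple 'X_(m p) | p < n].

HB.instance Definition _ n d (m : 'I_n -> 'I_d) := GRing.RMorphism.on (subm m).
HB.instance Definition _ n d (m : 'I_n -> 'I_d) := GRing.Linear.on (subm m).

Lemma submX n d (m : 'I_n -> 'I_d) p : subm m 'X_p = 'X_(m p).
Proof. by rewrite /subm comp_mpolyXU -tnth_nth tnth_mktuple. Qed.

Lemma eq_subm n d (m m' : 'I_n -> 'I_d) : m =1 m' -> subm m =1 subm m'.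
Proof.
move=> mm' f; congr (comp_mpoly _ f).
by apply: eq_from_tnth => p; rewrite !tnth_mktuple mm'.
Qed.

Lemma subm_sym n d (m : 'I_n -> 'I_d) (s : 'S_n) f :
  subm m (msym s f) = subm (m \o s) f.
Proof.
rewrite /subm msym_mPo; congr (comp_mpoly _ f).
by apply: eq_from_tnth => p; rewrite !tnth_mktuple.
Qed.

Lemma sym_subm n d (m : 'I_n -> 'I_d) (s : 'S_d) f :
  msym s (subm m f) = subm (s \o m) f.
Proof.
elim/mpoly_gen_ind: f => [|f g Ef Eg||c f Ef|r f Ef].
- by rewrite !rmorph0.
- by rewrite !rmorphD /= Ef Eg.
- by rewrite !rmorph1.
- by rewrite !linearZ /= Ef.
- by rewrite !rmorphM /= Ef !submX msymXU.
Qed.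

Lemma subm_comp n d l (m : 'I_d -> 'I_l) (m' : 'I_n -> 'I_d) f :
  subm m (subm m' f) = subm (m \o m') f.
Proof.
elim/mpoly_gen_ind: f => [|f g Ef Eg||c f Ef|r f Ef].
- by rewrite !rmorph0.
- by rewrite !rmorphD /= Ef Eg.
- by rewrite !rmorph1.
- by rewrite !linearZ /= Ef.
- by rewrite !rmorphM /= Ef !submX.
Qed.

Lemma subm_id n (m : 'I_n -> 'I_n) f : m =1 id -> subm m f = f.
Proof.
move=> mid; rewrite (eq_subm mid) /subm -[RHS]comp_mpoly_id.
by congr (comp_mpoly _ f); apply: eq_from_tnth => p; rewrite !tnth_mktuple.
Qed.

Lemma subm_swap n d (m : 'I_n -> 'I_d) (a b : 'I_n) f :
  subm m (swapv a b f) = subm (m \o tperm a b) f.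
Proof. exact: subm_sym. Qed.
End RenamingVariables.

Section Matchings.
Variables (k : fieldType) (G : quiver) (I1 : {set G}).
Variables (beta : {ffun dquiver I1 -> nat}) (d : nat).
Local Notation n := (height beta).
Local Notation R := (klr k beta).
Local Notation V := {ffun wseq beta -> {mpoly k[n]}}.
Implicit Types (j : wseq beta) (p q : 'I_n) (m : 'I_n -> 'I_d) (r : 'I_n.-1).
Implicit Types (f g : {mpoly k[n]}) (v w : V).

(** A matching of the strands of I_2 with earlier strands of I_1 of the same
    colour is encoded by a map whose fibres are the matched pairs and the
    remaining strands; identifying the variables of matched strands is then the
    substitution along that map. *)
Definition matching j m : Prop :=
  (forall p q : 'I_n, (p < q)%N -> m p = m q ->
     exists i : vert1 I1, tnth (val j) p = v1 i /\ tnth (val j) q = v2 i) /\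
  (forall q, is2 (tnth (val j) q) -> exists2 p : 'I_n, (p < q)%N & m p = m q).

(** The component at j of the submodule by which the polynomial representation
    is divided. If j has no matching it is the whole polynomial ring. *)
Definition vanishing j f := forall m, matching j m -> subm m f = 0.
Definition vanishingv v := forall j, vanishing j (v j).

Lemma matching_swap j r m : matching (swap r j) m -> m (lo r) != m (hi r) ->
  matching j (m \o st r).
Proof.
move=> [m1 m2] m_r.
have jE p : tnth (val j) p = tnth (val (swap r j)) (st r p).
  by rewrite tnth_swap -permM st2 perm1.
have stK p : st r (st r p) = p by rewrite -permM st2 perm1.
split=> [p q pq /= mpq|q]; last rewrite jE => /m2[p pq mpq].
  rewrite !jE; apply: m1 => //; apply: st_mono => //.
  apply: contraNneq m_r => -[plo qhi]; move: mpq.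
  by rewrite plo qhi st_lo st_hi => ->.
exists (st r p); rewrite /= ?stK // -[q]stK; apply: st_mono => //.
by apply: contraNneq m_r => -[<- <-]; rewrite mpq.
Qed.

(** A matching of s_r(j) that does not pair r with r + 1 comes from a matching
    of j. If it does pair them, the crossing carries the factor x_{r+1} - x_r of
    the arrow from i^1 to i^2, which vanishes under the identification. *)
Lemma vanishing_tauo j r f :
  vanishing j f -> vanishing (swap r j) (tauo j r f).
Proof.
move=> jf m mm; rewrite /tauo /taup; have lohi := lo_hi r.
have jlo : tnth (val (swap r j)) (lo r) = tnth (val j) (hi r).
  by rewrite tnth_swap st_lo.
have jhi : tnth (val (swap r j)) (hi r) = tnth (val j) (lo r).
  by rewrite tnth_swap st_hi.
have [m_r|m_r] := eqVneq (m (lo r)) (m (hi r)).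
  have [i] := mm.1 (lo r) (hi r) (ltnSn _) m_r.
  rewrite jlo jhi => -[-> ->]; have -> : (v2 i == v1 i :> dquiver I1) = false by [].
  by rewrite narrows_v1v2 eqxx expr1 rmorphM rmorphB /= !submX m_r subrr mul0r.
have sf : subm m (swapv (lo r) (hi r) f) = 0.
  by rewrite subm_swap; apply/jf/matching_swap.
case: eqP => [E|_]; last by rewrite rmorphM /= sf mulr0.
have mj : matching j m by rewrite -(swap_id E).
apply: (mulfI (subX_neq0 k m_r)).
rewrite mulr0 -(submX k m (lo r)) -(submX k m (hi r)) -rmorphB -rmorphM demE.
by apply: etrans (rmorphB _ _ _) _; rewrite /= [X in X - _]sf jf // subrr.
Qed.

Lemma vanishing0 j : vanishing j 0.
Proof. by move=> m _; rewrite rmorph0. Qed.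
Lemma vanishingD j f g : vanishing j f -> vanishing j g -> vanishing j (f + g).
Proof. by move=> jf jg m mm; rewrite rmorphD /= jf // jg // addr0. Qed.
Lemma vanishingM j f g : vanishing j g -> vanishing j (f * g).
Proof. by move=> jg m mm; rewrite rmorphM /= jg // mulr0. Qed.

Lemma vanishing_single j f : vanishing j f -> vanishingv (single j f).
Proof.
move=> jf l; rewrite ffunE; case: eqP => [->|_] //; exact: vanishing0.
Qed.

Lemma vanishingv_sum (J : Type) (s : seq J) (F : J -> V) :
  (forall l, vanishingv (F l)) -> vanishingv (\sum_(l <- s) F l).
Proof.
move=> sF; apply: (big_ind vanishingv) => // [j|u v uK vK j].
  by rewrite ffunE; apply: vanishing0.
by rewrite ffunE; apply: vanishingD.
Qed.

Lemma vanishing_pol_act (a : R) v : vanishingv v -> vanishingv (pol_act a v).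
Proof.
have ext b : (forall j f, vanishing j f -> vanishingv (pol_act b (single j f))) ->
    forall w, vanishingv w -> vanishingv (pol_act b w).
  move=> bK w wK; rewrite [w]single_sum linear_sum; apply: vanishingv_sum => j.
  by apply: bK; apply: wK.
rewrite -[a]mulr1.
apply: (klr_left_ind
  (P := fun a => forall v, vanishingv v -> vanishingv (pol_act a v))) v.
- by move=> v _; rewrite pol_act0 => j; rewrite ffunE; apply: vanishing0.
- move=> b b' bK b'K v vK; rewrite pol_actD => j; rewrite ffunE.
  by apply: vanishingD; [apply: bK | apply: b'K].
- by move=> v vK; rewrite pol_act1.
- move=> c b bK v vK; rewrite pol_actM pol_act_scal => j; rewrite ffunE -mul_mpolyC.
  by apply: vanishingM; apply: bK.
- move=> i b bK v vK; rewrite pol_actM; apply: ext (bK _ vK) => j f jf.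
  rewrite pol_act_e; case: eqP => _; first exact: vanishing_single.
  by move=> l; rewrite ffunE; apply: vanishing0.
- move=> p b bK v vK; rewrite pol_actM; apply: ext (bK _ vK) => j f jf.
  by rewrite pol_act_x; apply/vanishing_single/vanishingM.
- move=> r b bK v vK; rewrite pol_actM; apply: ext (bK _ vK) => j f jf.
  by rewrite pol_act_tau; apply/vanishing_single/vanishing_tauo.
Qed.

Lemma count_take (T : eqType) (N : nat) (t : N.-tuple T) (Q : pred T) l :
  count Q (take l t) = #|[set p : 'I_N | (p < l)%N && Q (tnth t p)]|.
Proof.
elim: l => [|l IHl].
  by rewrite take0; apply/esym/eqP; rewrite cards_eq0; apply/eqP/setP=> p; rewrite !inE.
have [le_N|lt_l] := leqP N l.
  rewrite (take_oversize (leqW _)) ?size_tuple //.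
  rewrite take_oversize ?size_tuple // in IHl; rewrite IHl.
  apply: eq_card => p; have lt_p := leq_trans (ltn_ord p) le_N.
  by rewrite !inE lt_p ltnW.
pose p := Ordinal lt_l.
rewrite (take_nth (tnth t p)) ?size_tuple // -cats1 count_cat IHl /= addn0.
rewrite -(tnth_nth _ t p) [RHS](cardsD1 p) addnC !inE ltnSn /=; congr (_ + _)%N.
apply: eq_card => q; rewrite !inE ltnS.
have [->|qp] := eqVneq q p; first by rewrite ltnn.
by rewrite [in RHS]leq_eqVlt -[_ == l]/(q == p) (negPf qp).
Qed.

(** Partners are earlier, so that in any prefix of a sequence with a matching the
    strands of I_2 inject into those of I_1. *)
Lemma unordered_no_matching j m : unordered j -> ~ matching j m.
Proof.
move=> /existsP[r]; rewrite !count_take => lt12 [m1 m2]; move: lt12.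
apply/negP; rewrite -leqNgt.
have partner (q : 'I_n) : exists p : 'I_n,
    is2 (tnth (val j) q) -> (p < q)%N /\ m p = m q.
  have [/m2[p pq mpq]|_] := boolP (is2 (tnth (val j) q)); first by exists p.
  by exists q.
have [f fP] := choice partner.
rewrite -[X in (X <= _)%N](@card_in_imset _ _ f).
  apply/subset_leq_card/subsetP => p /imsetP[q]; rewrite !inE => /andP[qr q2] ->.
  have [lt_f mf] := fP q q2; have [i [-> _]] := m1 _ _ lt_f mf.
  by rewrite andbT (ltn_trans lt_f).
move=> q q'; rewrite !inE => /andP[_ q2] /andP[_ q2'] fqq'.
have mqq' : m q = m q' by rewrite -(fP q q2).2 fqq' (fP q' q2').2.
have no (l l' : 'I_n) : is2 (tnth (val j) l) -> (l < l')%N -> m l <> m l'.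
  by move=> l2 ll' /(m1 _ _ ll')[i [li _]]; rewrite li in l2.
apply: val_inj; case: (ltngtP q q') => // ll'.
  by case: (no q q' q2 ll').
by case: (no q' q q2' ll').
Qed.
End Matchings.

(** * Blocks of the doubled sequences *)

Section Blocks.
Variables (G : quiver) (I1 : {set G}) (alpha : {ffun G -> nat}).
Local Notation d := (height alpha).
Local Notation n := (height (phiW I1 alpha)).
Implicit Types (t : wseq alpha) (r : 'I_d) (p q : 'I_n).
Local Notation pos := (pos I1).
Local Notation phi1 := (phi1 I1).

Lemma posS t r : pos t r.+1 = (pos t r + size (phi1 (tnth (val t) r)))%N.
Proof.
rewrite /Defs.pos (take_nth (tnth (val t) r)) ?size_tuple //.
by rewrite -cats1 phi_cat size_cat phi_cons cats0 -(tnth_nth _ _ r).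
Qed.

Lemma pos0 t : pos t 0 = 0%N.
Proof. by rewrite /Defs.pos take0. Qed.

Lemma pos_height t : pos t d = n.
Proof.
by rewrite /Defs.pos take_oversize ?size_tuple //; exact: size_tuple (val (phiS I1 t)).
Qed.

Lemma size_phi1_gt0 (i : G) : (0 < size (phi1 i))%N.
Proof. by rewrite /Defs.phi1; case: split_vert. Qed.

Lemma pos_le t a b : (a <= b)%N -> (pos t a <= pos t b)%N.
Proof.
move=> ab; rewrite /Defs.pos -(subnKC ab) takeD phi_cat size_cat.
exact: leq_addr.
Qed.

Lemma pos_lt t r (b : nat) : (r < b)%N -> (pos t r < pos t b)%N.
Proof.
move=> rb; apply: leq_trans (pos_le t rb); rewrite posS -addn1 leq_add2l.
exact: size_phi1_gt0.
Qed.

Lemma blk_ex t p : exists r, (pos t r <= p < pos t r.+1)%N.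
Proof.
have ex0 : exists a, (pos t a <= p)%N by exists 0%N; rewrite pos0.
have le_d a : (pos t a <= p)%N -> (a <= d)%N.
  move=> ap; rewrite leqNgt; apply/negP => /ltnW/(pos_le t); rewrite pos_height.
  by have := ltn_ord p; lia.
have [a ap max_a] := ex_maxnP ex0 le_d.
have lt_a : (a < d)%N.
  rewrite ltn_neqAle le_d // andbT; apply: contraTneq ap => ->.
  by rewrite pos_height -ltnNge.
exists (Ordinal lt_a) => /=; rewrite ap /= ltnNge; apply/negP => /max_a.
by rewrite ltnn.
Qed.

(** The strand of t from which a position of its doubled sequence comes. *)
Definition blk t p : 'I_d := sval (cid (blk_ex t p)).

Lemma blk_bounds t p : (pos t (blk t p) <= p < pos t (blk t p).+1)%N.
Proof. exact: svalP (cid (blk_ex t p)). Qed.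

Lemma blk_eq t p r : (pos t r <= p < pos t r.+1)%N -> blk t p = r.
Proof.
move=> /andP[rp pr]; have /andP[bp pb] := blk_bounds t p.
apply: val_inj; case: (ltngtP (blk t p) r) => // lt_br.
  by have := leq_trans pb (leq_trans (pos_le t lt_br) rp); rewrite ltnn.
by have := leq_trans pr (leq_trans (pos_le t lt_br) bp); rewrite ltnn.
Qed.

Definition first_pos t r : 'I_n := Ordinal (pos_x_lt I1 t r).

Lemma blk_first_pos t r : blk t (first_pos t r) = r.
Proof. by apply: blk_eq; rewrite /= leqnn pos_lt. Qed.

Lemma tnth_phiS t r p x0 : (pos t r <= p < pos t r.+1)%N ->
  tnth (val (phiS I1 t)) p = nth x0 (phi1 (tnth (val t) r)) (p - pos t r).
Proof.
rewrite posS => /andP[rp pr]; rewrite (tnth_nth x0) /=.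
rewrite -{1}(cat_take_drop r (val t)) phi_cat nth_cat ltnNge rp /=.
rewrite (drop_nth (tnth (val t) r)) ?size_tuple // phi_cons nth_cat.
rewrite -(tnth_nth _ _ r) ifT // -/(Defs.pos I1 t r).
by rewrite -(ltn_add2l (pos t r)) subnKC.
Qed.

Variant block_spec t p : 'I_d -> dquiver I1 -> Prop :=
| Block0 (a : vert0 I1) r of tnth (val t) r = val a & p = first_pos t r :
    block_spec t p r (v0 a)
| Block1 (a : vert1 I1) r of tnth (val t) r = val a & p = first_pos t r :
    block_spec t p r (v1 a)
| Block2 (a : vert1 I1) r of tnth (val t) r = val a & p = (first_pos t r).+1 :> nat :
    block_spec t p r (v2 a).

Lemma blockP t p : block_spec t p (blk t p) (tnth (val (phiS I1 t)) p).
Proof.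
have bnd := blk_bounds t p; set r := blk t p in bnd *.
have [x0 _] : {x0 : dquiver I1 | true} by exists (tnth (val (phiS I1 t)) p).
rewrite (tnth_phiS x0 bnd); move: bnd; rewrite posS /Defs.phi1.
case: split_vert (split_vertK I1 (tnth (val t) r)) => a /= aE bnd.
  have pE : p = first_pos t r by apply: val_inj => /=; lia.
  by rewrite pE /= subnn; apply: Block0.
have [pE|pE] : (p = pos t r :> nat) \/ (p = (pos t r).+1 :> nat).
    by move: bnd => /=; lia.
  by rewrite pE subnn; apply: Block1 => //; apply: val_inj.
by rewrite pE subSn // subnn; apply: Block2.
Qed.

Lemma blk_matching t : matching (phiS I1 t) (blk t).
Proof.
split=> [p q pq|q].
  case: (blockP t p) => a r ra pE; case: (blockP t q) => b s sb qE rs;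
    subst s; move: pq; rewrite ?pE ?qE //= ?ltnn //; try lia.
  - by move=> _; have := valP a; rewrite /= -ra sb (valP b).
  - by exists a; split=> //; congr v2; apply: val_inj; rewrite -sb ra.
case: (blockP t q) => // a r ra qE _; exists (first_pos t r); first by rewrite qE.
by rewrite blk_first_pos.
Qed.

Lemma nxt_subproof t p : is1 (tnth (val (phiS I1 t)) p) -> (p.+1 < n)%N.
Proof.
case: (blockP t p) => // a r ra -> _ /=.
rewrite -(pos_height t); apply: leq_trans (pos_le t (ltn_ord r)).
by rewrite posS ra /Defs.phi1 split_vert1 /= addn2.
Qed.

Lemma nxt_is2 t p q : is1 (tnth (val (phiS I1 t)) p) -> q = p.+1 :> nat ->
  is2 (tnth (val (phiS I1 t)) q) /\ blk t q = blk t p.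
Proof.
case: (blockP t p) => // a r ra -> _ /= qE.
have q_bnd : (pos t r <= q < pos t r.+1)%N.
  by rewrite posS ra /Defs.phi1 split_vert1 qE /=; lia.
have [x0 _] : {x0 : dquiver I1 | true} by exists (tnth (val (phiS I1 t)) q).
rewrite (blk_eq q_bnd) (tnth_phiS x0 q_bnd) ra /Defs.phi1 split_vert1.
by rewrite qE subSn ?subnn.
Qed.

(** A well-ordered sequence has no matching besides the one of its blocks: the
    partner of a strand of I_2 other than its neighbour would itself be
    matched with its own neighbour. *)
Lemma matching_blk t (e : nat) (m : 'I_n -> 'I_e) : matching (phiS I1 t) m ->
  forall p, m p = m (first_pos t (blk t p)).
Proof.
move=> [m1 m2].
have nxt N p q : (p < N)%N -> is1 (tnth (val (phiS I1 t)) p) ->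
    q = p.+1 :> nat -> m q = m p.
  elim: N p q => // N IHN p q lt_p p1 qE.
  have [q2 _] := nxt_is2 p1 qE; have [p' lt_p'q mp'] := m2 q q2.
  have [i [p'i _]] := m1 p' q lt_p'q mp'.
  have p'1 : is1 (tnth (val (phiS I1 t)) p') by rewrite p'i.
  have [lt_p'p|] := ltnP p' p; last first.
    move=> le_pp'; have -> // : p = p'.
    by apply/val_inj/eqP; rewrite eqn_leq le_pp' -ltnS -qE.
  pose q' := Ordinal (nxt_subproof p'1).
  have mq' : m q' = m p' by apply: (IHN p') => //; lia.
  have [q'2 _] := nxt_is2 p'1 (erefl (val q')).
  have lt_q'q : (q' < q)%N by rewrite qE ltnS.
  have [l [q'l _]] := m1 q' q lt_q'q (etrans mq' mp').
  by rewrite q'l in q'2.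
move=> p; case: (blockP t p) => a r ra pE; rewrite ?pE //.
apply: (nxt (first_pos t r).+1 (first_pos t r)) => //.
have [x0 _] : {x0 : dquiver I1 | true} by exists (tnth (val (phiS I1 t)) p).
have bnd : (pos t r <= first_pos t r < pos t r.+1)%N by rewrite /= leqnn pos_lt.
by rewrite (tnth_phiS x0 bnd) ra /Defs.phi1 split_vert1 /= subnn.
Qed.
End Blocks.

(** * The balanced algebra acts on polynomials *)

Section WellOrdered.
Variables (G : quiver) (I1 : {set G}) (alpha : {ffun G -> nat}).
Implicit Types (l : seq (dquiver I1)).

Definition wo_seq l := forall n (i : vert1 I1),
  onth l n = Some (v1 i : dquiver I1) -> onth l n.+1 = Some (v2 i : dquiver I1).

Definition unphi l : seq G := map (@base G I1) (filter (predC is2) l).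

(** In a well-ordered list every 1 is followed by its 2, so that the count of 2s
    is at least the count of 1s; when they are equal there is no 2 left over,
    and the list is a doubled one. *)
Lemma wo_seqP l : wo_seq l -> (count is1 l <= count is2 l)%N /\
  ((count is2 l <= count is1 l)%N -> phi I1 (unphi l) = l).
Proof.
have [N] := ubnP (size l); elim: N l => // N IHN [|v l] // lt_l wl.
have wl' : wo_seq l by move=> m i /(wl m.+1).
have [le1 phil] := IHN l lt_l wl'.
case: v wl lt_l => [[a|a]|a] wl lt_l; rewrite /= ?add0n.
- split=> // le2; rewrite phi_cons /phi1 split_vert0 /=; congr (_ :: _).
  exact: phil.
- have := wl 0%N a erefl; case: l lt_l wl' {wl le1 phil} => // b l lt_l wl' [bE].
  have [|le1 phil] := IHN l (ltnW lt_l); first by move=> m i /(wl' m.+1).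
  rewrite bE /= add0n !add1n !ltnS; split=> // le2.
  rewrite phi_cons /phi1 split_vert1 /=; congr [:: _, _ & _]; exact: phil.
- split=> [|le2]; first exact: leqW.
  by move: (leq_trans le2 le1); rewrite ltnn.
Qed.

Lemma base_onto (i : G) : exists2 v : dquiver I1, base v = i & ~~ is2 v.
Proof.
have [a aE] : exists a, split_vert I1 i = a by exists (split_vert I1 i).
move: (split_vertK I1 i); rewrite aE; case: a {aE} => a ai.
  by exists (v0 a).
by exists (v1 a).
Qed.

Lemma sum_pred1 (T : finType) (a : T) : (\sum_(i : T) (a == i) = 1)%N.
Proof.
by rewrite (bigD1 a) //= eqxx big1 // => i; rewrite eq_sym => /negPf->.
Qed.

Lemma count_sum (T : finType) (v : T -> dquiver I1) (Q : pred (dquiver I1)) l :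
  (forall w, Q w = (\sum_i (w == v i))%N :> nat) ->
  count Q l = (\sum_i count_mem (v i) l)%N.
Proof.
move=> Qv; elim: l => [|w l IHl] /=; first by rewrite big1.
by rewrite IHl Qv big_split.
Qed.

Lemma wo_phi (u : wseq (phiW I1 alpha)) :
  well_ordered u -> exists t : wseq alpha, phiS I1 t = u.
Proof.
move=> wu; pose l : seq (dquiver I1) := val (val u).
have countE v : count_mem v l = alpha (base v).
  by rewrite (eqP (forallP (valP u) v)) ffunE.
have wl : wo_seq l.
  move=> m i li; have lt_m : (m < height (phiW I1 alpha))%N.
    by rewrite -(size_tuple (val u)) -onthTE li.
  have := wu => /forallP/(_ (Ordinal lt_m))/forallP/(_ i)/implyP.
  have -> : tnth (val u) (Ordinal lt_m) = v1 i by apply/tnth_onth.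
  by move=> /(_ (eqxx _))/eqP.
have count12 : count is1 l = count is2 l.
  rewrite (@count_sum _ (fun i : vert1 I1 => v1 i : dquiver I1) is1 l).
    rewrite (@count_sum _ (fun i : vert1 I1 => v2 i : dquiver I1) is2 l).
  - by apply: eq_bigr => i _; rewrite !countE.
  - by case=> [[a|a]|a] /=; rewrite ?sum_pred1 ?big1.
  - by case=> [[a|a]|a] /=; rewrite ?sum_pred1 ?big1.
have phil : phi I1 (unphi l) = l by apply: (wo_seqP wl).2; rewrite count12.
have count_un i : count_mem i (unphi l) = alpha i.
  by have [v <- _] := base_onto i; rewrite -count_phi phil countE.
have sz : size (unphi l) == height alpha by apply/eqP/size_weight.
have wt : [forall i, count_mem i (Tuple sz) == alpha i].
  by apply/forallP => i; apply/eqP/count_un.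
by exists (Sub (Tuple sz) wt); apply/val_inj/val_inj.
Qed.
End WellOrdered.

Section BalancedAction.
Variables (k : fieldType) (G : quiver) (I1 : {set G}) (alpha : {ffun G -> nat}).
Local Notation beta := (phiW I1 alpha).
Local Notation d := (height alpha).
Local Notation n := (height beta).
Local Notation R := (klr k beta).
Local Notation S := (bal_klr k beta).
Local Notation C := (corner (idem_ord k beta)).
Local Notation P := {mpoly k[d]}.
Local Notation P' := {mpoly k[n]}.
Local Notation V := {ffun wseq alpha -> P}.
Local Notation V' := {ffun wseq beta -> P'}.
Implicit Types (t : wseq alpha) (j : wseq beta) (f : P') (g : P).
Implicit Types (v : V') (w : V) (a b : R).

(** Restriction identifies the variables of each block of phi(t), lifting gives
    the variable of a strand to the first strand of its block. *)
Definition res t : P' -> P := subm (blk t).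
Definition lft t : P -> P' := subm (first_pos I1 t).

HB.instance Definition _ t := GRing.RMorphism.on (res t).
HB.instance Definition _ t := GRing.Linear.on (res t).
HB.instance Definition _ t := GRing.RMorphism.on (lft t).
HB.instance Definition _ t := GRing.Linear.on (lft t).

Lemma resK t g : res t (lft t g) = g.
Proof. by rewrite /res /lft subm_comp subm_id // => r; rewrite /= blk_first_pos. Qed.

Lemma res_vanishing t f : vanishing d (phiS I1 t) f -> res t f = 0.
Proof. by apply; apply: blk_matching. Qed.

(** A doubled sequence has a single matching, the one by blocks. *)
Lemma lft_res t f : vanishing d (phiS I1 t) (lft t (res t f) - f).
Proof.
move=> m mm; rewrite rmorphB /= /lft /res !subm_comp; apply/eqP.
rewrite subr_eq0; apply/eqP/eq_subm => p /=.
by rewrite -(matching_blk mm).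
Qed.

Definition resv v : V := [ffun t => res t (v (phiS I1 t))].
Definition lftv w : V' := \sum_t single (phiS I1 t) (lft t (w t)).

Lemma resv_is_linear : linear resv.
Proof. by move=> c u v; apply/ffunP => t; rewrite !ffunE linearP. Qed.
Lemma lftv_is_linear : linear lftv.
Proof.
move=> c u v; rewrite /lftv scaler_sumr -big_split; apply: eq_bigr => t _.
by rewrite !ffunE !linearP.
Qed.
HB.instance Definition _ :=
  GRing.isLinear.Build k V' V _ resv resv_is_linear.
HB.instance Definition _ :=
  GRing.isLinear.Build k V V' _ lftv lftv_is_linear.

Lemma lftv_single t g : lftv (single t g) = single (phiS I1 t) (lft t g).
Proof.
apply: (@sum_single _ _ _ _ t g (fun t g => single (phiS I1 t) (lft t g))) => u.
by rewrite !linear0.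
Qed.

Lemma lftv_phiS w t : lftv w (phiS I1 t) = lft t (w t).
Proof.
rewrite sum_ffunE (bigD1 t) //= ffunE eqxx big1 ?addr0 // => u /negPf ut.
by rewrite ffunE (inj_eq (@phiS_inj _ _ _)) eq_sym ut.
Qed.

Lemma lftv_out w j : ~~ well_ordered j -> lftv w j = 0.
Proof.
move=> wj; rewrite sum_ffunE big1 // => t _; rewrite ffunE; case: eqP => // jt.
by rewrite jt phiS_well_ordered in wj.
Qed.

Lemma resv_single t f : resv (single (phiS I1 t) f) = single t (res t f).
Proof.
apply/ffunP => u; rewrite !ffunE (inj_eq (@phiS_inj _ _ _)).
by case: eqP => [->|] //; rewrite linear0.
Qed.

Lemma pol_act_klr_e (H : quiver) (al : {ffun H -> nat}) (j : wseq al) (v : {ffun wseq al -> _}) :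
  pol_act (klr_e j : klr k al) v = single j (v j).
Proof.
rewrite {1}[v]single_sum linear_sum /= (bigD1 j) //= pol_act_e eqxx big1 ?addr0 // => i.
by rewrite pol_act_e eq_sym => /negPf->.
Qed.

Lemma pol_act_e_ord v j :
  pol_act (e_ord k beta) v j = if well_ordered j then v j else 0.
Proof.
rewrite pol_act_sum sum_ffunE; case: ifP => wj.
  rewrite (bigD1 j) //= pol_act_klr_e ffunE eqxx big1 ?addr0 // => i.
  by rewrite pol_act_klr_e ffunE eq_sym => /andP[_ /negPf->].
rewrite big1 // => i wi; rewrite pol_act_klr_e ffunE; case: eqP => // ji.
by rewrite ji wi in wj.
Qed.

Lemma resv_vanishing v : vanishingv d v -> resv v = 0.
Proof.
by move=> vK; apply/ffunP => t; rewrite !ffunE; apply/res_vanishing/vK.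
Qed.

Lemma lftv_resv v : vanishingv d (lftv (resv v) - pol_act (e_ord k beta) v).
Proof.
move=> j; rewrite ffunE [X in _ + X]ffunE pol_act_e_ord.
have [wj|wj] := boolP (well_ordered j); last first.
  by rewrite lftv_out // subr0; apply: vanishing0.
have [t <-] := wo_phi wj; rewrite lftv_phiS ffunE; exact: lft_res.
Qed.

(** The restriction of an action does not depend on the lift, since the defect is
    in a submodule on which the restriction vanishes. *)
Lemma resv_pol_actM a b w : resv (pol_act (a * e_ord k beta * b) (lftv w)) =
  resv (pol_act a (lftv (resv (pol_act b (lftv w))))).
Proof.
apply/eqP; rewrite eq_sym -subr_eq0 !pol_actM -!linearB /=; apply/eqP/resv_vanishing.
exact/vanishing_pol_act/lftv_resv.
Qed.

(** The balanced algebra acts on the polynomials in the variables of the original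
    strands, a model of the quotient of the polynomial representation of the
    corner by the vanishing families. *)
Definition bal_act (s : S) w : V := resv (pol_act (val (repr s : C)) (lftv w)).

(** An unordered sequence has no matching, so every polynomial there vanishes. *)
Lemma resv_pol_act_unordered a b j v :
  unordered j -> resv (pol_act (a * klr_e j * b) v) = 0.
Proof.
move=> uj; rewrite !pol_actM pol_act_klr_e; apply/resv_vanishing/vanishing_pol_act.
by apply: vanishing_single => m mm; case: (unordered_no_matching uj mm).
Qed.

Lemma pol_act_e_lftv w : pol_act (e_ord k beta) (lftv w) = lftv w.
Proof.
apply/ffunP => j; rewrite pol_act_e_ord; case: ifPn => // wj.
by rewrite lftv_out.
Qed.

Lemma resv_e_ord v : resv (pol_act (e_ord k beta) v) = resv v.
Proof.
by apply/ffunP => t; rewrite [LHS]ffunE [RHS]ffunE pol_act_e_ord phiS_well_ordered.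
Qed.

Lemma bal_act_cls (c : C) w : bal_act (cls _ c) w = resv (pol_act (val c) (lftv w)).
Proof.
rewrite /bal_act; have := repr_cls (bal_ideal k beta) c; set c' := repr _.
case=> s [su sE]; rewrite -[val c'](subrK (val c)) pol_actD linearD /=.
have -> : val c' - val c = val (c' - c) by [].
rewrite sE pol_act_sum linear_sum big_seq big1 ?add0r //= => -[[x j] y] /= xs.
rewrite -[X in pol_act X]mulrA; apply: resv_pol_act_unordered.
exact: allP su _ xs.
Qed.

Lemma bal_act_is_linear s : linear (bal_act s).
Proof. by move=> c u w; rewrite /bal_act !linearP. Qed.

Lemma bal_actD s s' w : bal_act (s + s') w = bal_act s w + bal_act s' w.
Proof.
rewrite -[s]cls_repr -[s']cls_repr -clsD !bal_act_cls -linearD -pol_actD.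
by congr (resv (pol_act _ _)).
Qed.

Lemma bal_actB s s' w : bal_act (s - s') w = bal_act s w - bal_act s' w.
Proof.
apply/eqP; rewrite eq_sym subr_eq -bal_actD; apply/eqP; congr (bal_act _ w).
exact: esym (subrK _ _).
Qed.

Lemma bal_actM s s' w : bal_act (s * s') w = bal_act s (bal_act s' w).
Proof.
rewrite -[s]cls_repr -[s']cls_repr; move: (repr s) (repr s') => c c'.
have e_c : val c * e_ord k beta = val c := corner_mulr (valP c).
transitivity (resv (pol_act (val c * e_ord k beta * val c') (lftv w))).
  by rewrite e_c -clsM; apply: bal_act_cls.
have E := bal_act_cls c' w; rewrite resv_pol_actM -E; exact: esym (bal_act_cls c _).
Qed.

Lemma bal_act_scal c w : bal_act (pzscal c) w = c *: w.
Proof.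
rewrite bal_act_cls /= pol_actM pol_act_scal !linearZ /=; congr (_ *: _).
apply/ffunP => t; rewrite ffunE pol_act_e_ord phiS_well_ordered lftv_phiS.
exact: resK.
Qed.

Definition bcl a : S := cls _ (Corner (in_corner_proj (idem_ord k beta) a)).

Lemma bal_act_bcl a w : bal_act (bcl a) w = resv (pol_act a (lftv w)).
Proof.
rewrite bal_act_cls /= pol_actM pol_actM pol_act_e_lftv; exact: resv_e_ord.
Qed.
End BalancedAction.

(** * Products of crossings acting on doubled sequences *)

Section TauAtPosition.
Variables (k : fieldType) (G : quiver) (al : {ffun G -> nat}).
Local Notation n := (height al).
Implicit Types (u : wseq al) (r : 'I_n.-1) (p q : seq G) (a b : G).

Lemma swap_cat u r p q a b : val u = p ++ a :: b :: q :> seq _ ->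
  size p = r -> val (swap r u) = p ++ b :: a :: q :> seq _.
Proof.
move=> uE szp; have szu := size_tuple (val u); have := szu; rewrite uE => szu'.
apply: (@eq_from_nth _ a) => [|m].
  by rewrite size_tuple -szu' !size_cat.
rewrite size_tuple => lt_m.
rewrite -(tnth_nth a _ (Ordinal lt_m)) tnth_swap (tnth_nth a) uE val_st /=.
rewrite -szp !nth_cat; have [->|ne1] := eqVneq m (size p).
  by rewrite ltnn subnn ltnNge leqnSn /= subSnn.
have [->|ne2] := eqVneq m (size p).+1.
  by rewrite ltnn subnn ltnNge leqnSn /= subSnn.
case: ltnP => // le_pm; case E: (m - size p)%N => [|[|l]] //=; lia.
Qed.

Lemma pol_act_taun u p q a b : val u = p ++ a :: b :: q :> seq _ ->
  exists2 u' : wseq al, val u' = p ++ b :: a :: q :> seq _ &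
  forall x y : 'I_n, x = size p :> nat -> y = (size p).+1 :> nat -> forall f,
    pol_act (klr_taun (size p) : klr k al) (single u f) = single u' (taup a b x y f).
Proof.
move=> uE; have lt_p : (size p < n.-1)%N.
  by rewrite -(size_tuple (val u)) uE size_cat /= !addnS ltnS leq_addr.
pose r := Ordinal lt_p; exists (swap r u); first exact: (swap_cat uE).
move=> x y xE yE f; rewrite /klr_taun insubT /= pol_act_tau /tauo.
have -> : lo r = x by apply: val_inj.
have -> : hi r = y by apply: val_inj.
by rewrite !(tnth_nth a) uE xE yE !nth_cat ltnn subnn ltnNge leqnSn /= subSnn.
Qed.
End TauAtPosition.

Section SwapBlocks.
Variables (k : fieldType) (G : quiver) (I1 : {set G}) (alpha : {ffun G -> nat}).
Local Notation d := (height alpha).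
Local Notation n := (height (phiW I1 alpha)).
Variables (t : wseq alpha) (r : 'I_d.-1).
Local Notation t' := (swap r t).
Local Notation pos := (pos I1).
Local Notation si := (size (phi1 I1 (tnth (val t) (lo r)))).
Local Notation sj := (size (phi1 I1 (tnth (val t) (hi r)))).

Lemma pos_swap_le a : (a <= r)%N -> pos t' a = pos t a.
Proof.
elim: a => [|a IHa] le_ar; first by rewrite !pos0.
have lt_a : (a < d)%N by apply: leq_trans le_ar (ltnW (ltn_ord (lo r))).
rewrite -[a]/(val (Ordinal lt_a)) !posS IHa ?(ltnW le_ar) //.
rewrite tnth_swap st_neq // -val_eqE /= neq_ltn ?le_ar //.
by rewrite ltnW.
Qed.

Lemma pos_swap1 : pos t' r.+1 = (pos t r + sj)%N.
Proof. by rewrite -[val r]/(val (lo r)) posS tnth_swap st_lo pos_swap_le. Qed.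

Lemma pos1 : pos t r.+1 = (pos t r + si)%N.
Proof. by rewrite -[val r]/(val (lo r)) posS. Qed.

Lemma pos2 : pos t r.+2 = (pos t r + si + sj)%N.
Proof. by rewrite -[r.+1]/(val (hi r)) posS pos1. Qed.

Lemma pos_swap2 : pos t' r.+2 = (pos t r + sj + si)%N.
Proof. by rewrite -[r.+1]/(val (hi r)) posS tnth_swap st_hi pos_swap1. Qed.

Lemma pos_swap_ge a : (r.+2 <= a <= d)%N -> pos t' a = pos t a.
Proof.
elim: a => // a IHa /andP[le_ra le_ad].
move: le_ra; rewrite leq_eqVlt => /predU1P[[<-]|lt_ra].
  by rewrite pos_swap2 pos2 addnAC.
rewrite -[a]/(val (Ordinal le_ad)) !posS IHa ?(ltnW le_ad) ?andbT //.
by rewrite tnth_swap st_neq // -val_eqE /= neq_ltn; lia.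
Qed.

Lemma blk_swap_lo (p : 'I_n) : (pos t r <= p < pos t r + sj)%N ->
  blk t' p = lo r.
Proof. by move=> pE; apply: blk_eq; rewrite pos_swap_le //= pos_swap1. Qed.

Lemma blk_swap_hi (p : 'I_n) :
  (pos t r + sj <= p < pos t r + sj + si)%N -> blk t' p = hi r.
Proof. by move=> pE; apply: blk_eq; rewrite /= pos_swap1 pos_swap2. Qed.

Lemma first_pos_out (q : 'I_d) : q != lo r -> q != hi r ->
  ((first_pos I1 t q < pos t r) || (pos t r + si + sj <= first_pos I1 t q))%N /\
  blk t' (first_pos I1 t q) = q.
Proof.
rewrite -!val_eqE /= => qlo qhi; have [lt_qr|lt_rq] : (q < r)%N \/ (r.+2 <= q)%N.
    by case: (ltngtP q r) => E; [left | right; lia | rewrite E eqxx in qlo].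
  split; first by rewrite (pos_lt I1 t lt_qr).
  by apply: blk_eq; rewrite !pos_swap_le ?(ltnW lt_qr) //= leqnn pos_lt.
split; first by rewrite -pos2 pos_le ?orbT.
have q_le := ltn_ord q.
by apply: blk_eq; rewrite !pos_swap_ge ?lt_rq ?(ltnW q_le) ?leqW // leqnn pos_lt.
Qed.

(** A lifted polynomial only involves the first positions of the blocks, and the
    restriction only sees the block in which a position ends up. *)
Lemma res_subm_swap (s : 'I_n -> 'I_n) (g : {mpoly k[d]}) :
  (forall p : 'I_n, ((p < pos t r) || (pos t r + si + sj <= p))%N -> s p = p) ->
  (pos t r + sj <= s (first_pos I1 t (lo r)) < pos t r + sj + si)%N ->
  (pos t r <= s (first_pos I1 t (hi r)) < pos t r + sj)%N ->
  res t' (subm s (lft I1 t g)) = swapv (lo r) (hi r) g.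
Proof.
move=> s_out s_lo s_hi; rewrite /res /lft !subm_comp.
rewrite -[g in RHS](@subm_id _ _ id) // [RHS]sym_subm; apply: eq_subm => q /=.
have [->|qlo] := eqVneq q (lo r); first by rewrite tpermL blk_swap_hi.
have [->|qhi] := eqVneq q (hi r); first by rewrite tpermR blk_swap_lo.
have [out blk_q] := first_pos_out qlo qhi.
by rewrite s_out // tpermD 1?eq_sym.
Qed.
End SwapBlocks.

Lemma swapv_subm (k : fieldType) n (x y : 'I_n) (f : {mpoly k[n]}) :
  swapv x y f = subm (tperm x y) f.
Proof. by rewrite -[f in LHS](@subm_id k _ id) // [LHS]sym_subm. Qed.

Lemma far_block p m : ((p < m) || (m + 2 + 2 <= p))%N ->
  [/\ m != p, m.+1 != p, m.+2 != p & m.+3 != p]%N.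
Proof. by move=> pE; split; lia. Qed.

Section TauElt.
Variables (k : fieldType) (G : quiver) (I1 : {set G}) (alpha : {ffun G -> nat}).
Hypothesis no_arrow_I1 : forall a : arrow G,
  ~~ ((source a \in I1) && (target a \in I1)).
Local Notation d := (height alpha).
Local Notation n := (height (phiW I1 alpha)).
Local Notation R := (klr k (phiW I1 alpha)).
Local Notation DQ := (dquiver I1).
Implicit Types (t : wseq alpha) (r : 'I_d.-1) (f h : {mpoly k[n]}).

Lemma phi1_0 (a : vert0 I1) : phi1 I1 (val a) = [:: v0 a].
Proof. by rewrite /phi1 split_vert0. Qed.

Lemma phi1_1 (a : vert1 I1) : phi1 I1 (val a) = [:: v1 a; v2 a].
Proof. by rewrite /phi1 split_vert1. Qed.

Lemma val_tperm m (x y p : 'I_m) : tperm x y p =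
  (if p == x :> nat then y : nat else if p == y :> nat then x : nat else p) :> nat.
Proof.
case: tpermP => [->|->|/eqP px /eqP py]; first by rewrite eqxx.
  by rewrite eqxx; case: eqP => // ->.
by rewrite -[_ == x :> nat]/(p == x) -[_ == y :> nat]/(p == y) (negPf px) (negPf py).
Qed.

Lemma narrows_I1 (i j : G) : i \in I1 -> j \in I1 -> narrows i j = 0%N.
Proof.
move=> i1 j1; apply/eqP/pred0P => a /=; apply/negP => /andP[/eqP ai /eqP aj].
by have := no_arrow_I1 a; rewrite ai aj i1 j1.
Qed.

Lemma taup_noarrow (v w : DQ) (x y : 'I_n) f :
  v != w -> narrows w v = 0%N -> taup v w x y f = swapv x y f.
Proof. by move=> /negPf vw wv; rewrite /taup vw wv expr0 mul1r. Qed.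

Lemma taup_neq (v w : DQ) (x y : 'I_n) f : v != w ->
  taup v w x y f = ('X_y - 'X_x) ^+ narrows w v * swapv x y f.
Proof. by move=> /negPf vw; rewrite /taup vw. Qed.

(** Divided differences are recognised by their defining equation, which survives
    the restriction. *)
Lemma res_dem t r (h g : {mpoly k[d]}) : tnth (val t) (lo r) = tnth (val t) (hi r) ->
  ('X_(lo r) - 'X_(hi r)) * h = swapv (lo r) (hi r) g - g -> h = tauo t r g.
Proof. by move=> E hE; rewrite /tauo /taup E eqxx; apply/esym/demP; first exact: lo_hi. Qed.

(** The factor x_c - x_b, which comes from the arrow between the two strands of a
    pair, cancels one of the two divided differences up to sign. This is the
    sign in the image of tau_r for two strands of one colour in I_1. *)
Lemma dem_dem_pair (a b c e : 'I_n) f : a != b -> c != e ->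
  a != c -> a != e -> b != c -> b != e -> swapv c e f = f ->
  dem c e (dem a b (('X_c - 'X_b) * f)) = - dem a b f.
Proof.
move=> ab ce ac ae bc be fce.
have swa : swapv c e 'X_a = 'X_a :> {mpoly k[n]} by rewrite swapvX tpermD // eq_sym.
have h_inv : swapv c e (dem a b f) = dem a b f.
  by rewrite [LHS]msym_dem // [msym _ f]fce !tpermD // eq_sym.
have -> : dem a b (('X_c - 'X_b) * f) = ('X_c - 'X_a) * dem a b f - f.
  apply: demP => //; rewrite mulrBr mulrCA demE rmorphM rmorphB /= !swapvX tpermR.
  by rewrite tpermD //; ring.
apply: demP => //; rewrite rmorphB rmorphM rmorphB /= swa swapvX tpermL h_inv fce.
by ring.
Qed.

(** The product of crossings that moves one block of a doubled sequence across the
    next acts, after restriction, as the single crossing of the two strands.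
    The arrows between two different vertices are seen by one only of the
    crossings of their strands, so that they contribute the same factor on both
    sides. *)
Lemma res_tau_elt t r g :
  resv (pol_act (tau_elt k I1 t r) (lftv I1 (single t g))) = single (swap r t) (tauo t r g).
Proof.
rewrite lftv_single; set F := lft I1 t g.
have out := @res_subm_swap k G I1 alpha t r.
set i := tnth (val t) (lo r); set j := tnth (val t) (hi r).
have uE := phiS_split I1 t r; rewrite -/i -/j in uE.
set Q := phi I1 (drop _ _) in uE; set Pr := phi I1 (take _ _) in uE.
have szP : size Pr = pos I1 t r by [].
have t'E : val (swap r t) = take r (val t) ++ j :: i :: drop r.+2 (val t) :> seq _.
  apply: swap_cat (wseq_split t r) _; rewrite size_take size_tuple.
  by rewrite ifT // (ltn_ord (lo r)).
have u'P (u' : wseq (phiW I1 alpha)) :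
    val u' = Pr ++ phi1 I1 j ++ phi1 I1 i ++ Q :> seq _ -> u' = phiS I1 (swap r t).
  move=> u'E; apply/val_inj/val_inj; apply: etrans u'E _.
  by rewrite -[RHS]/(phi I1 (tval (val (swap r t)))) t'E phi_cat !phi_cons.
have finish (u' : wseq (phiW I1 alpha)) h :
    val u' = Pr ++ phi1 I1 j ++ phi1 I1 i ++ Q :> seq _ ->
    res (swap r t) h = tauo t r g -> resv (single u' h) = single (swap r t) (tauo t r g).
  by move=> /u'P -> hE; rewrite resv_single hE.
have lt_n e : (e < size (phi1 I1 i) + size (phi1 I1 j))%N -> (e + pos I1 t r < n)%N.
  have posE : pos I1 t r.+2 = (pos I1 t r + size (phi1 I1 i) + size (phi1 I1 j))%N.
    exact: pos2.
  move=> lt_e; apply: (@leq_trans (pos I1 t r.+2)).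
    by rewrite posE -addnA addnC ltn_add2l.
  by rewrite -(pos_height I1 t); apply/pos_le/(ltn_ord (hi r)).
have res_lo (p : 'I_n) : (pos I1 t r <= p < pos I1 t r + size (phi1 I1 j))%N ->
    res (swap r t) 'X_p = 'X_(lo r) :> {mpoly k[d]}.
  by move=> pE; rewrite /res submX blk_swap_lo.
have res_hi (p : 'I_n) : (pos I1 t r + size (phi1 I1 j) <= p <
    pos I1 t r + size (phi1 I1 j) + size (phi1 I1 i))%N ->
    res (swap r t) 'X_p = 'X_(hi r) :> {mpoly k[d]}.
  by move=> pE; rewrite /res submX blk_swap_hi.
have tauoE : i != j -> tauo t r g =
    ('X_(hi r) - 'X_(lo r)) ^+ narrows j i * swapv (lo r) (hi r) g.
  by move=> /negPf ij; rewrite /tauo /taup -/i -/j ij.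
rewrite /tau_elt -/i -/j -szP.
case: (boolP (i \in I1)) => [i1|i0]; case: (boolP (j \in I1)) => [j1|j0].
- have [a ai] : exists a : vert1 I1, val a = i by exists (exist _ i i1).
  have [b bj] : exists b : vert1 I1, val b = j by exists (exist _ j j1).
  have [ia jb] := (phi1_1 a, phi1_1 b); rewrite ai in ia; rewrite bj in jb.
  rewrite ia jb in uE lt_n finish out res_lo res_hi.
  have uE' : val (phiS I1 t) = (Pr ++ [:: v1 a]) ++ [:: v2 a, v1 b, v2 b & Q]
      :> seq _ by rewrite -catA.
  have [u1 u1E u1act] := pol_act_taun k uE'; rewrite -catA in u1E.
  have [u2 u2E u2act] := pol_act_taun k u1E.
  have u2E' : val u2 = (Pr ++ [:: v1 b; v1 a]) ++ [:: v2 a, v2 b & Q] :> seq _.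
    by rewrite -catA.
  have [u3 u3E u3act] := pol_act_taun k u2E'.
  have u3E' : val u3 = (Pr ++ [:: v1 b]) ++ [:: v1 a, v2 b, v2 a & Q] :> seq _.
    by rewrite -catA in u3E; rewrite -catA.
  have [u4 u4E u4act] := pol_act_taun k u3E'; rewrite -catA in u4E.
  have szP1 (v : DQ) : size (Pr ++ [:: v]) = (pos I1 t r).+1.
    by rewrite size_cat szP addn1.
  rewrite szP1 in u1act; rewrite szP1 in u4act; rewrite szP in u2act *.
  rewrite size_cat addn2 szP in u3act.
  have lt0 : (pos I1 t r < n)%N := lt_n 0%N isT.
  have lt1 : ((pos I1 t r).+1 < n)%N := lt_n 1%N isT.
  have lt2 : ((pos I1 t r).+2 < n)%N := lt_n 2 isT.
  have lt3 : ((pos I1 t r).+3 < n)%N := lt_n 3 isT.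
  pose x0 := Ordinal lt0; pose x1 := Ordinal lt1.
  pose x2 := Ordinal lt2; pose x3 := Ordinal lt3.
  have act : pol_act (klr_taun (pos I1 t r).+1 * klr_taun (pos I1 t r).+2 *
      klr_taun (pos I1 t r) * klr_taun (pos I1 t r).+1 * klr_e (phiS I1 t) : R)
      (single (phiS I1 t) F) =
    single u4 (taup (v1 a : DQ) (v2 b : DQ) x1 x2 (taup (v2 a : DQ) (v2 b : DQ) x2 x3
      (taup (v1 a : DQ) (v1 b : DQ) x0 x1
        (taup (v2 a : DQ) (v1 b : DQ) x1 x2 F)))).
    rewrite pol_actM pol_act_e eqxx 3!pol_actM (u1act x1 x2) // (u2act x0 x1) //.
    by rewrite (u3act x2 x3) // (u4act x1 x2).
  have first_pos_lo : first_pos I1 t (lo r) = x0 by apply: val_inj.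
  have first_pos_hi : first_pos I1 t (hi r) = x2.
    by apply: val_inj; rewrite /= pos1 -/i ia /= addn2.
  have x10 : x1 != x0 by rewrite -val_eqE /= neq_ltn ?ltnS ?leqnn ?leqnSn ?leqW ?orbT.
  have x20 : x2 != x0 by rewrite -val_eqE /= neq_ltn ?ltnS ?leqnn ?leqnSn ?leqW ?orbT.
  have x30 : x3 != x0 by rewrite -val_eqE /= neq_ltn ?ltnS ?leqnn ?leqnSn ?leqW ?orbT.
  have x21 : x2 != x1 by rewrite -val_eqE /= neq_ltn ?ltnS ?leqnn ?leqnSn ?leqW ?orbT.
  have x31 : x3 != x1 by rewrite -val_eqE /= neq_ltn ?ltnS ?leqnn ?leqnSn ?leqW ?orbT.
  have x32 : x3 != x2 by rewrite -val_eqE /= neq_ltn ?ltnS ?leqnn ?leqnSn ?leqW ?orbT.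
  have far (p : 'I_n) : ((p < pos I1 t r) || (pos I1 t r + 2 + 2 <= p))%N ->
      [/\ x0 != p, x1 != p, x2 != p & x3 != p].
    by rewrite -!(inj_eq val_inj) /=; exact: far_block.
  have n12 : narrows (v2 b : DQ) (v1 a : DQ) = 0%N.
    by rewrite narrows_base // narrows_I1 //= ?(valP a) ?(valP b).
  rewrite (@taup_noarrow (v1 a : DQ) (v2 b : DQ)) // in act.
  (* no arrow joins vertices of I_1, so every crossing is a mere exchange *)
  have [ij|ij] := eqVneq i j; last first.
    have ab : a != b by apply: contraNneq ij => ab; rewrite -ai -bj ab.
    rewrite act; apply: finish => //.
    rewrite tauoE // narrows_I1 // expr0 mul1r.
    rewrite taup_noarrow ?narrows_to_v2 //.
    rewrite taup_noarrow ?narrows_from_v1 //.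
    rewrite taup_noarrow //; last by rewrite narrows_v1v2 eq_sym (negPf ab).
    rewrite ![in LHS]swapv_subm 3!subm_comp; apply: out => [p pE||] /=.
    + by have [? ? ? ?] := far p pE; rewrite !tpermD // eq_sym.
    + rewrite first_pos_lo (@tpermD _ x1 x2 x0) // tpermL (@tpermD _ x2 x3 x1) // tpermL /=.
      by rewrite addn2 addnS addn1 leqnn leqW.
    + rewrite first_pos_hi tpermR tpermR.
      rewrite (@tpermD _ x2 x3 x0) // (@tpermD _ x1 x2 x0) //= leqnn addn2.
      by rewrite leqW.
  have ab : b = a by apply: val_inj; rewrite ai bj.
  rewrite ab in act u4E finish *; rewrite pol_actN act linearN.
  rewrite {1 2 3}/taup !eqxx (_ : (v2 a == v1 a :> DQ) = false) //.
  rewrite narrows_v1v2 eqxx expr1; set f := swapv x1 x2 F.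
  have swapv_f : swapv x2 x3 f = f.
    rewrite /f ![swapv _ _ F]swapv_subm swapv_subm !subm_comp; apply: eq_subm => q /=.
    have [->|qlo] := eqVneq q (lo r).
      by rewrite first_pos_lo [tperm x1 x2 x0]tpermD // tpermD.
    have [->|qhi] := eqVneq q (hi r).
      by rewrite first_pos_hi tpermR tpermD // eq_sym.
    have [far_q _] := first_pos_out I1 t qlo qhi.
    move: far_q; rewrite -/i -/j ia jb => far_q; have [? ? ? ?] := far _ far_q.
    by rewrite !tpermD.
  rewrite dem_dem_pair //; try by rewrite eq_sym.
  rewrite -linearN -linearN -linearN opprK; apply: finish => //; apply: res_dem => //.
  have swapv_lo : 'X_(lo r) = res (swap r t) (swapv x1 x2 'X_x0) :> {mpoly k[d]}.
    by rewrite swapvX (@tpermD _ x1 x2 x0) // res_lo //= leqnn addn2 leqW.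
  have swapv_hi : 'X_(hi r) = res (swap r t) (swapv x1 x2 'X_x1) :> {mpoly k[d]}.
    by rewrite swapvX tpermL res_hi //= addn2 leqnn addn2 leqW.
  rewrite swapv_lo swapv_hi -rmorphB -rmorphB -rmorphM -rmorphM demE // rmorphB rmorphB /=.
  congr (_ - _).
    rewrite /f ![in LHS]swapv_subm 2!subm_comp; apply: out => [p pE||] /=.
    + by have [? ? ? ?] := far p pE; rewrite !tpermD // eq_sym.
    + rewrite first_pos_lo (@tpermD _ x1 x2 x0) // tpermL tpermL /=.
      by rewrite addn2 addnS addn1 leqnn leqW.
    + by rewrite first_pos_hi tpermR tpermR (@tpermD _ x1 x2 x0) //= leqnn addn2 leqW.
  by rewrite /f swapvK (swap_id ij) resK.
- have [a ai] : exists a : vert1 I1, val a = i by exists (exist _ i i1).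
  have [b bj] : exists b : vert0 I1, val b = j by exists (exist _ j j0).
  have [ia jb] := (phi1_1 a, phi1_0 b); rewrite ai in ia; rewrite bj in jb.
  rewrite ia jb in uE lt_n finish out res_lo res_hi.
  have uE' : val (phiS I1 t) = (Pr ++ [:: v1 a]) ++ [:: v2 a, v0 b & Q] :> seq _.
    by rewrite -catA.
  have [u1 u1E u1act] := pol_act_taun k uE'; rewrite -catA in u1E.
  have [u2 u2E u2act] := pol_act_taun k u1E.
  have szP1 : size (Pr ++ [:: v1 a]) = (size Pr).+1 by rewrite size_cat addn1.
  rewrite szP1 in u1act; rewrite szP in u1act u2act *.
  have lt0 : (pos I1 t r < n)%N := lt_n 0%N isT.
  have lt1 : ((pos I1 t r).+1 < n)%N := lt_n 1%N isT.
  have lt2 : ((pos I1 t r).+2 < n)%N := lt_n 2 isT.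
  rewrite pol_actM pol_act_e eqxx pol_actM (u1act (Ordinal lt1) (Ordinal lt2)) //.
  rewrite (u2act (Ordinal lt0) (Ordinal lt1)) //; apply: finish => //.
  have ij : i != j by apply: contraNneq j0 => <-.
  have nE : narrows (v0 b : DQ) (v1 a : DQ) = narrows j i.
    by rewrite narrows_base // -ai -bj.
  rewrite [X in taup _ _ _ _ X]taup_noarrow ?narrows_to_v2 // taup_neq // tauoE //.
  rewrite nE.
  rewrite rmorphM rmorphXn rmorphB /=.
  rewrite (res_lo (Ordinal lt0)) ?(res_hi (Ordinal lt1)) /= ?leqnn ?addn1 ?ltnSn //.
    congr (_ * _); rewrite ![in LHS]swapv_subm subm_comp; apply: out => [p pE||].
    + apply: val_inj; rewrite /= !val_tperm /= in pE *.
      by repeat case: eqP; move: pE => /=; lia.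
    + by rewrite /= !val_tperm /=; repeat case: eqP; lia.
    + by rewrite /= !val_tperm /= pos1 -/i ia /=; repeat case: eqP; lia.
  by rewrite addn2 ltnS leqnSn.
- have [a ai] : exists a : vert0 I1, val a = i by exists (exist _ i i0).
  have [b bj] : exists b : vert1 I1, val b = j by exists (exist _ j j1).
  have [ia jb] := (phi1_0 a, phi1_1 b); rewrite ai in ia; rewrite bj in jb.
  rewrite ia jb in uE lt_n finish out res_lo res_hi.
  have [u1 u1E u1act] := pol_act_taun k uE.
  have u1E' : val u1 = (Pr ++ [:: v1 b]) ++ [:: v0 a, v2 b & Q] :> seq _.
    by rewrite -catA.
  have [u2 u2E u2act] := pol_act_taun k u1E'; rewrite -catA in u2E.
  rewrite size_cat addn1 in u2act; rewrite szP in u1act u2act *.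
  have lt0 : (pos I1 t r < n)%N := lt_n 0%N isT.
  have lt1 : ((pos I1 t r).+1 < n)%N := lt_n 1%N isT.
  have lt2 : ((pos I1 t r).+2 < n)%N := lt_n 2 isT.
  rewrite pol_actM pol_act_e eqxx pol_actM (u1act (Ordinal lt0) (Ordinal lt1)) //.
  rewrite (u2act (Ordinal lt1) (Ordinal lt2)) //; apply: finish => //.
  have ij : i != j by apply: contraNneq i0 => ->.
  have nE : narrows (v2 b : DQ) (v0 a : DQ) = narrows j i.
    by rewrite narrows_base // -ai -bj.
  rewrite [X in taup _ _ _ _ X]taup_noarrow ?narrows_from_v1 // taup_neq //.
  rewrite tauoE // nE rmorphM rmorphXn rmorphB /=.
  rewrite (res_lo (Ordinal lt1)) ?(res_hi (Ordinal lt2)) /=; last 2 first.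
  + by lia.
  + by lia.
  congr (_ * _); rewrite ![in LHS]swapv_subm subm_comp; apply: out => [p pE||].
  + apply: val_inj; rewrite /= !val_tperm /= in pE *.
    by repeat case: eqP; move: pE => /=; lia.
  + by rewrite /= !val_tperm /=; repeat case: eqP; lia.
  + by rewrite /= !val_tperm /= pos1 -/i ia /=; repeat case: eqP; lia.
have [a ai] : exists a : vert0 I1, val a = i by exists (exist _ i i0).
have [b bj] : exists b : vert0 I1, val b = j by exists (exist _ j j0).
have [ia jb] := (phi1_0 a, phi1_0 b); rewrite ai in ia; rewrite bj in jb.
rewrite ia jb in uE lt_n finish out res_lo res_hi.
have [u1 u1E u1act] := pol_act_taun k uE; rewrite szP in u1act *.
have lt0 : (pos I1 t r < n)%N := lt_n 0%N isT.
have lt1 : ((pos I1 t r).+1 < n)%N := lt_n 1%N isT.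
rewrite pol_actM pol_act_e eqxx (u1act (Ordinal lt0) (Ordinal lt1)) //.
apply: finish => //.
have sF : res (swap r t) (swapv (Ordinal lt0) (Ordinal lt1) F) = swapv (lo r) (hi r) g.
  rewrite [in LHS]swapv_subm; apply: out => [p pE||].
  - by apply: val_inj; rewrite /= val_tperm /=; repeat case: eqP; move: pE => /=; lia.
  - by rewrite val_tperm /=; repeat case: eqP; lia.
  - by rewrite val_tperm /= pos1 -/i ia /=; repeat case: eqP; lia.
have [ij|ij] := eqVneq i j.
  apply: res_dem; rewrite // /taup.
  have -> : v0 a = v0 b by congr v0; apply: val_inj; rewrite ai bj.
  rewrite eqxx -(res_lo (Ordinal lt0)) ?leqnn ?addn1 ?ltnSn //.
  rewrite -(res_hi (Ordinal lt1)) /= ?addn1 ?leqnn ?ltnSn //.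
  rewrite -rmorphB -rmorphM demE rmorphB /= sF; congr (_ - _).
  by rewrite (swap_id ij) resK.
have nE : narrows (v0 b : DQ) (v0 a : DQ) = narrows j i.
  by rewrite narrows_base // -ai -bj.
rewrite taup_neq; last by apply: contraNneq ij => -[ab]; rewrite -ai -bj ab.
rewrite tauoE // nE rmorphM rmorphXn rmorphB /= sF.
by rewrite (res_lo (Ordinal lt0)) ?(res_hi (Ordinal lt1)) /= ?leqnn ?addn1 ?ltnSn.
Qed.
End TauElt.

(** * Crossings of two blocks *)

Section WordsEndingWith.
Variables (I : finType) (alpha : {ffun I -> nat}).
Local Notation n := (height alpha).
Implicit Types (L : 'S_n) (r a : 'I_n.-1) (u : seq 'I_n.-1) (p q : 'I_n).

(** The strands a and a + 1 have not crossed in u, so no step of u sees the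
    exchange of their labels. *)
Lemma up_rcons u a : up u ->
  (forall p q, wperm u p = lo a -> wperm u q = hi a -> (p < q)%N) ->
  up (u ++ [:: a]).
Proof.
elim: u => [|r u IHu] //=.
  by move=> _ _; rewrite !perm1 /=.
move=> /andP[up_u lt_r] ord.
have stE p : (st r * wperm u)%g (st r p) = wperm u p by rewrite stL tpermK.
have {}IHu : up (u ++ [:: a]).
  apply: IHu => // p q pE qE; rewrite ltnNge leq_eqVlt negb_or.
  have -> /= : q != p :> nat.
    by apply: contraTneq (lo_hi a) => /val_inj qp; rewrite -pE -qE qp eqxx.
  apply/negP => lt_qp; have := ord (st r p) (st r q).
  rewrite !stE => /(_ pE qE); apply/negP; rewrite -leqNgt ltnW //.
  apply: st_mono => //; apply: contraTneq lt_r => -[<- <-].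
  by rewrite pE qE /= -leqNgt.
rewrite IHu wperm_cat /= !permM !perm1; apply: st_mono => //.
apply: contraT; rewrite negbK => /eqP[loE hiE].
have := ord (hi r) (lo r); rewrite !stL st_lo st_hi => /(_ loE hiE) /=.
by rewrite ltnNge leqnSn.
Qed.

(** Words act from right to left, so the crossing performed first is the last
    letter. *)
Lemma up_ending L a : (forall p q, L p = lo a -> L q = hi a -> (q < p)%N) ->
  exists u, up (u ++ [:: a]) /\ wperm (u ++ [:: a]) = L.
Proof.
move=> ord; have [u up_u uE] := up_exists (L * st a)%g.
exists u; split; last by rewrite wperm_cat uE /= mulg1 -mulgA st2 mulg1.
apply: up_rcons => // p q; rewrite uE !permM => pE qE; apply: ord.
  by rewrite -[L q](tpermK (lo a) (hi a)) qE tpermR.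
by rewrite -[L p](tpermK (lo a) (hi a)) pE tpermL.
Qed.
End WordsEndingWith.

Lemma shift_bounds x b p c l :
  (x + b = p + c -> b <= p < b + l -> c <= x < c + l)%N.
Proof. lia. Qed.

Section Balanced.
Variables (G : quiver) (I1 : {set G}) (alpha : {ffun G -> nat}).
Local Notation d := (height alpha).
Local Notation n := (height (phiW I1 alpha)).
Local Notation pos := (pos I1).
Local Notation len i := (size (phi1 I1 i)).
Implicit Types (t : wseq alpha) (M : 'S_d) (L : 'S_n) (p q : 'I_n).

(** L permutes the blocks of t by M, without altering the order inside them. *)
Definition bal t M L := forall p, let b := blk (wact M t) p in
  (L p + pos (wact M t) b = p + pos t (M b))%N.

Lemma bal1 t : bal t 1%g 1%g.
Proof. by move=> p; rewrite /= wact1 !perm1. Qed.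

Lemma bal_uniq t M L L' : bal t M L -> bal t M L' -> L = L'.
Proof.
move=> bL bL'; apply/perm.permP => p; apply/val_inj/eqP => /=.
by rewrite -(eqn_add2r (pos (wact M t) (blk (wact M t) p))) bL bL'.
Qed.

Lemma bal_blk t M L p : bal t M L -> blk t (L p) = M (blk (wact M t) p).
Proof.
move=> bL; apply: blk_eq; rewrite posS; apply: shift_bounds (bL p) _.
by rewrite -tnth_wact -posS blk_bounds.
Qed.

Lemma bal_mul t M L M' L' : bal t M L -> bal (wact M t) M' L' ->
  bal t (M' * M)%g (L' * L)%g.
Proof.
move=> bL bL' p; rewrite -wactM; set b := blk _ p => /=; rewrite !permM.
have := bL (L' p); rewrite (bal_blk p bL') -/b /= => E.
have := bL' p; rewrite -/b /= => E'.
apply/eqP; rewrite -(eqn_add2r (pos (wact M t) (M' b))) addnAC E addnAC E'.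
by rewrite addnAC.
Qed.

Lemma bal_lt t M L p q : bal t M L ->
  (M (blk (wact M t) p) < M (blk (wact M t) q))%N -> (L p < L q)%N.
Proof.
move=> bL; rewrite -!(bal_blk _ bL) => lt_b.
have /andP[_ p_lt] := blk_bounds t (L p).
have /andP[q_le _] := blk_bounds t (L q).
exact: leq_trans p_lt (leq_trans (pos_le I1 t lt_b) q_le).
Qed.

Section Cross.
Variables (t : wseq alpha) (r : 'I_d.-1).
Local Notation t' := (swap r t).
Local Notation P := (pos t r).
Local Notation si := (len (tnth (val t) (lo r))).
Local Notation sj := (len (tnth (val t) (hi r))).

Lemma bal_cross L :
  (forall p, (p < P)%N || (P + si + sj <= p)%N -> L p = p) ->
  (forall p, (P <= p < P + sj)%N -> L p = (p + si)%N :> nat) ->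
  (forall p, (P + sj <= p < P + sj + si)%N -> (L p + sj)%N = p) ->
  bal t (st r) L.
Proof.
move=> L_out L_lo L_hi p; rewrite -wact_swap /=.
have [lt_p|le_p] := ltnP p P.
  have [lt_b lt_b'] : (blk t p < r)%N /\ blk t' p = blk t p.
    have /andP[b_le b_lt] := blk_bounds t p.
    have lt_b : (blk t p < r)%N.
      rewrite ltnNge; apply: contraL lt_p => /(pos_le I1 t); rewrite -leqNgt.
      by move=> /leq_trans; apply.
    by split=> //; apply: blk_eq; rewrite !pos_swap_le ?(ltnW lt_b) // b_le.
  rewrite lt_b' L_out ?lt_p // st_neq ?pos_swap_le ?(ltnW lt_b) //.
    by rewrite -val_eqE /= neq_ltn lt_b.
  by rewrite -val_eqE /= neq_ltn leqW.
have [lt1_p|le1_p] := ltnP p (P + sj).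
  have p_lo : (P <= p < P + sj)%N by rewrite le_p.
  rewrite (blk_swap_lo p_lo) L_lo // st_lo pos_swap_le //= pos1.
  by rewrite -addnA [(si + _)%N]addnC.
have [lt2_p|le2_p] := ltnP p (P + sj + si).
  have p_hi : (P + sj <= p < P + sj + si)%N by rewrite le1_p.
  by rewrite (blk_swap_hi p_hi) st_hi /= pos_swap1 addnCA (L_hi p p_hi) addnC.
have out_p : (P + si + sj <= p)%N by rewrite addnAC.
have [lt_b blkE] : (r.+2 <= blk t p)%N /\ blk t' p = blk t p.
  have /andP[b_le b_lt] := blk_bounds t p.
  have lt_b : (r.+2 <= blk t p)%N.
    rewrite ltnNge; apply: contraL out_p => b_r; rewrite -ltnNge -pos2.
    by apply: leq_trans b_lt _; apply: pos_le.
  have b_d := ltn_ord (blk t p).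
  by split=> //; apply: blk_eq; rewrite !pos_swap_ge ?b_le ?lt_b ?leqW // ltnW.
rewrite blkE L_out ?out_p ?orbT // st_neq ?pos_swap_ge ?lt_b ?(ltnW (ltn_ord _)) //.
  by rewrite -val_eqE /= neq_ltn (ltnW lt_b) orbT.
by rewrite -val_eqE /= neq_ltn lt_b orbT.
Qed.
End Cross.
End Balanced.

Lemma range1 m p : (m <= p < m + 1 -> p = m)%N. Proof. lia. Qed.
Lemma range2 m p : (m <= p < m + 2 -> p = m \/ p = m.+1)%N. Proof. lia. Qed.

Lemma off4 m p : ((p < m) || (m + 2 + 2 <= p) -> [/\ (p < m) || (m.+1 < p),
  (p < m.+1) || (m.+2 < p) & (p < m.+2) || (m.+3 < p)])%N.
Proof. by move=> pE; split; lia. Qed.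
Lemma off3 m l p : (l = m.+3 -> (p < m) || (l <= p) ->
  (p < m) || (m.+1 < p) /\ (p < m.+1) || (m.+2 < p))%N.
Proof. by move=> -> pE; split; lia. Qed.

Lemma addn_block21 m : (m + 2 + 1 = m.+3)%N. Proof. lia. Qed.
Lemma addn_block12 m : (m + 1 + 2 = m.+3)%N. Proof. lia. Qed.

Section StepAt.
Variables (I : finType) (alpha : {ffun I -> nat}).
Local Notation n := (height alpha).
Implicit Types (c : 'I_n.-1) (x y : 'I_n).

Lemma st_at c x y : x = c :> nat -> y = c.+1 :> nat -> st c x = y /\ st c y = x.
Proof.
move=> xE yE; have -> : x = lo c by apply: val_inj.
have -> : y = hi c by apply: val_inj.
by rewrite st_lo st_hi.
Qed.

Lemma st_off c x : (x < c)%N || (c.+1 < x)%N -> st c x = x.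
Proof. by move=> ne; apply: st_neq; rewrite -val_eqE /=; lia. Qed.
End StepAt.

Section CrossingWord.
Variables (k : fieldType) (G : quiver) (I1 : {set G}) (alpha : {ffun G -> nat}).
Local Notation d := (height alpha).
Local Notation n := (height (phiW I1 alpha)).
Local Notation R := (klr k (phiW I1 alpha)).
Local Notation pos := (pos I1).
Local Notation len i := (size (phi1 I1 i)).
Local Notation e t := (klr_e (phiS I1 t) : R).

Lemma klr_taunE (c : 'I_n.-1) : klr_taun c = klr_tau c :> R.
Proof. by rewrite /klr_taun valK. Qed.

(** Moving a block across the next one crosses each of its strands with each of
    the other's, once. *)
Lemma cross (t : wseq alpha) (r : 'I_d.-1) : exists w : seq 'I_n.-1,
  [/\ exists b : bool, tau_word (@klr_tau k _ (phiW I1 alpha)) w * e t =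
        (-1) ^+ b * tau_elt k I1 t r,
      bal t (st r) (wperm w) &
      forall u, up u ->
        (forall p q : 'I_n, blk t p = lo r -> blk t q = hi r ->
           (wperm u p < wperm u q)%N) -> up (w ++ u)].
Proof.
have blk_lo (p : 'I_n) :
  (pos t r <= p < pos t r + len (tnth (val t) (lo r)))%N -> blk t p = lo r.
  by move=> pE; apply: blk_eq; rewrite /= pos1.
have blk_hi (p : 'I_n) : (pos t r + len (tnth (val t) (lo r)) <= p <
  pos t r + len (tnth (val t) (lo r)) + len (tnth (val t) (hi r)))%N ->
  blk t p = hi r.
  by move=> pE; apply: blk_eq; rewrite /= pos1 pos2.
have lt_n := pos_tau_lt I1 t r.
have cross_bal := @bal_cross G I1 alpha t r.
rewrite /tau_elt.
set i := tnth (val t) (lo r) in blk_lo blk_hi lt_n cross_bal *.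
set j := tnth (val t) (hi r) in blk_hi lt_n cross_bal *.
set P := pos t r in blk_lo blk_hi lt_n cross_bal *.
case: (boolP (i \in I1)) => [/phi1_in|/phi1_notin] [a ia];
  case: (boolP (j \in I1)) => [/phi1_in|/phi1_notin] [b jb];
  rewrite ia jb /= in lt_n blk_lo blk_hi cross_bal;
  rewrite ?addn0 ?addnS ?addn0 in lt_n.
- have lt1 : (P.+1 < n.-1)%N by apply: ltnW.
  have lt0 : (P < n.-1)%N by apply: ltnW.
  pose c0 : 'I_n.-1 := Ordinal lt0; pose c1 : 'I_n.-1 := Ordinal lt1.
  pose c2 : 'I_n.-1 := Ordinal lt_n.
  pose x0 := lo c0; pose x1 := lo c1; pose x2 := lo c2; pose x3 := hi c2.
  have [s00 s01] := @st_at _ _ c0 x0 x1 erefl erefl.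
  have [s11 s12] := @st_at _ _ c1 x1 x2 erefl erefl.
  have [s22 s23] := @st_at _ _ c2 x2 x3 erefl erefl.
  have s02 : st c0 x2 = x2 by apply: st_off; rewrite ltnSn orbT.
  have s03 : st c0 x3 = x3 by apply: st_off; rewrite ltnS leqnSn orbT.
  have s10 : st c1 x0 = x0 by apply: st_off; rewrite ltnSn.
  have s13 : st c1 x3 = x3 by apply: st_off; rewrite ltnSn orbT.
  have s20 : st c2 x0 = x0 by apply: st_off; rewrite ltnS leqnSn.
  have s21 : st c2 x1 = x1 by apply: st_off; rewrite ltnSn.
  have h0 : hi c0 = x1 by apply: val_inj.
  have h1 : hi c1 = x2 by apply: val_inj.
  exists [:: c1; c2; c0; c1]; split.
  + exists (i == j); rewrite !tau_word_cons tau_word0 mulr1 !mulrA -!klr_taunE.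
    by case: eqP => _; rewrite ?expr1 ?mulN1r ?opprK ?expr0 ?mul1r.
  + rewrite !wperm_cons mulg1; apply: cross_bal => p pE; rewrite !permM.
    * by have [? ? ?] := off4 pE; rewrite !st_off.
    * have [pP|pP] := range2 pE.
        by rewrite (_ : p = x0) ?s10 ?s20 ?s00 ?s11 ?addn2 //; apply: val_inj.
      by rewrite (_ : p = x1) ?s11 ?s22 ?s03 ?s13 ?addn2 //; apply: val_inj.
    * have [pP|pP] := range2 pE; rewrite addn2 in pP.
        by rewrite (_ : p = x2) ?s12 ?s21 ?s01 ?s10 ?addn2 //; apply: val_inj.
      by rewrite (_ : p = x3) ?s13 ?s23 ?s02 ?s12 ?addn2 //; apply: val_inj.
  move=> u up_u ord; rewrite !cat_cons !up_cons up_u !wperm_cons !permM.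
  rewrite h0 h1 -[lo c0]/x0 -[lo c1]/x1 -[lo c2]/x2 -[hi c2]/x3.
  rewrite s10 s11 s02 s12 s03 s13 s21 s22 s01 s10 s03 s13.
  have [b0 b1] : blk t x0 = lo r /\ blk t x1 = lo r.
    by split; apply: blk_lo; rewrite /= addn2 leqnn ?leqnSn ?leqW /=.
  have [b2 b3] : blk t x2 = hi r /\ blk t x3 = hi r.
    by split; apply: blk_hi; rewrite /= !addn2 leqnn ?leqnSn ?leqW /=.
  by rewrite !ord.
- have lt0 : (P < n.-1)%N by apply: ltnW.
  pose c0 : 'I_n.-1 := Ordinal lt0; pose c1 : 'I_n.-1 := Ordinal lt_n.
  pose x0 := lo c0; pose x1 := lo c1; pose x2 := hi c1.
  have [s00 s01] := @st_at _ _ c0 x0 x1 erefl erefl.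
  have [s11 s12] := @st_at _ _ c1 x1 x2 erefl erefl.
  have s02 : st c0 x2 = x2 by apply: st_off; rewrite ltnSn orbT.
  have s10 : st c1 x0 = x0 by apply: st_off; rewrite ltnSn.
  have h0 : hi c0 = x1 by apply: val_inj.
  exists [:: c0; c1]; split.
  + by exists false; rewrite !tau_word_cons tau_word0 mulr1 expr0 mul1r -!klr_taunE.
  + rewrite !wperm_cons mulg1; apply: cross_bal => p pE; rewrite !permM.
    * by have [? ?] := off3 (addn_block21 P) pE; rewrite !st_off.
    * have pP := range1 pE.
      by rewrite (_ : p = x0) ?s00 ?s11 ?addn2 //; apply: val_inj.
    * have [pP|pP] := range2 pE; rewrite addn1 in pP.
        by rewrite (_ : p = x1) ?s01 ?s10 ?addn1 //; apply: val_inj.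
      by rewrite (_ : p = x2) ?s02 ?s12 ?addn1 //; apply: val_inj.
  move=> u up_u ord; rewrite !cat_cons !up_cons up_u !wperm_cons !permM.
  rewrite h0 -[lo c0]/x0 -[lo c1]/x1 -[hi c1]/x2 s10 s11.
  have [b0 b1] : blk t x0 = lo r /\ blk t x1 = lo r.
    by split; apply: blk_lo; rewrite /= addn2 leqnn ?leqnSn ?leqW /=.
  have b2 : blk t x2 = hi r.
    by apply: blk_hi; rewrite /= addn1 !addn2 leqnn ltnSn.
  by rewrite !ord.
- have lt0 : (P < n.-1)%N by apply: ltnW.
  pose c0 : 'I_n.-1 := Ordinal lt0; pose c1 : 'I_n.-1 := Ordinal lt_n.
  pose x0 := lo c0; pose x1 := lo c1; pose x2 := hi c1.
  have [s00 s01] := @st_at _ _ c0 x0 x1 erefl erefl.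
  have [s11 s12] := @st_at _ _ c1 x1 x2 erefl erefl.
  have s02 : st c0 x2 = x2 by apply: st_off; rewrite ltnSn orbT.
  have s10 : st c1 x0 = x0 by apply: st_off; rewrite ltnSn.
  have h0 : hi c0 = x1 by apply: val_inj.
  exists [:: c1; c0]; split.
  + by exists false; rewrite !tau_word_cons tau_word0 mulr1 expr0 mul1r -!klr_taunE.
  + rewrite !wperm_cons mulg1; apply: cross_bal => p pE; rewrite !permM.
    * by have [? ?] := off3 (addn_block12 P) pE; rewrite !st_off.
    * have [pP|pP] := range2 pE.
        by rewrite (_ : p = x0) ?s10 ?s00 ?addn1 //; apply: val_inj.
      by rewrite (_ : p = x1) ?s11 ?s02 ?addn1 //; apply: val_inj.
    * have pP := range1 pE; rewrite addn2 in pP.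
      by rewrite (_ : p = x2) ?s12 ?s01 ?addn2 //; apply: val_inj.
  move=> u up_u ord; rewrite !cat_cons !up_cons up_u !wperm_cons !permM.
  rewrite h0 -[lo c0]/x0 -[lo c1]/x1 -[hi c1]/x2 s01 s02.
  have b0 : blk t x0 = lo r by apply: blk_lo; rewrite /= addn1 leqnn ltnSn.
  have [b1 b2] : blk t x1 = hi r /\ blk t x2 = hi r.
    by split; apply: blk_hi; rewrite /= addn2 addn1 leqnn ?leqnSn ?leqW /=.
  by rewrite !ord.
have lt0 : (P < n.-1)%N by [].
pose c0 : 'I_n.-1 := Ordinal lt0; exists [:: c0]; split.
- exists false; rewrite expr0 mul1r tau_word_cons tau_word0 mulr1.
  by rewrite -[P]/(val c0) klr_taunE.
- have [s0 s1] := @st_at _ _ c0 (lo c0) (hi c0) erefl erefl.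
  rewrite wperm_cons mulg1; apply: cross_bal => p pE.
  + by rewrite st_off //=; lia.
  + rewrite (_ : p = lo c0) ?s0 ?addn1 //; apply: val_inj; exact: range1.
  + rewrite (_ : p = hi c0) ?s1 ?addn1 //; apply: val_inj.
    by rewrite /= -addn1; apply: range1.
move=> u up_u ord; rewrite cat_cons up_cons up_u /=; apply: ord.
  by apply: blk_lo; rewrite leqnn addn1 ltnSn.
by apply: blk_hi; rewrite /= addn1 leqnn addn1 ltnSn.
Qed.
End CrossingWord.

Lemma inj_ge_id m (f : 'I_m -> 'I_m) :
  injective f -> (forall x : 'I_m, (x <= f x)%N) -> forall x, f x = x.
Proof.
move=> f_inj f_ge x.
have [_] := leqif_sum (P := predT) (fun x _ => leqif_eq (f_ge x)).
rewrite [X in X == _](reindex_inj f_inj) eqxx => /esym/forallP/(_ x)/eqP fx.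
exact/esym/val_inj.
Qed.

Section BalancedPermutations.
Variables (G : quiver) (I1 : {set G}) (alpha : {ffun G -> nat}).
Local Notation d := (height alpha).
Local Notation n := (height (phiW I1 alpha)).
Local Notation pos := (pos I1).
Local Notation first_pos := (first_pos I1).
Local Notation phiS := (phiS I1).
Implicit Types (t : wseq alpha) (M : 'S_d) (L : 'S_n) (p q : 'I_n) (r : 'I_d).

Lemma first_pos_letter t r : [/\ ~~ is2 (tnth (val (phiS t)) (first_pos t r)),
  is1 (tnth (val (phiS t)) (first_pos t r)) = (tnth (val t) r \in I1) &
  base (tnth (val (phiS t)) (first_pos t r)) = tnth (val t) r].
Proof.
have := blk_first_pos I1 t r; case: (blockP t (first_pos t r)) => a s sa E rs.
- by rewrite -rs sa (negPf (valP a)).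
- by rewrite -rs sa (valP a).
by move: E; rewrite rs => /eqP; rewrite ltn_eqF.
Qed.

Lemma not_is2_first_pos t p : ~~ is2 (tnth (val (phiS t)) p) -> p = first_pos t (blk t p).
Proof. by case: (blockP t p). Qed.

Lemma is2_first_pos t p : is2 (tnth (val (phiS t)) p) ->
  p = (first_pos t (blk t p)).+1 :> nat /\ tnth (val t) (blk t p) \in I1.
Proof. by case: (blockP t p) => // a r -> -> _; split=> //; apply: valP. Qed.

Lemma bal_phi t M L : bal t M L -> wact L (phiS t) = phiS (wact M t).
Proof.
move=> bL; apply: wseq_eqP => p; rewrite tnth_wact.
have [x0 _] : {x0 : dquiver I1 | true} by exists (tnth (val (phiS t)) p).
have pb := blk_bounds (wact M t) p; have Lb := blk_bounds t (L p).
rewrite (tnth_phiS x0 pb) (tnth_phiS x0 Lb) (bal_blk p bL) tnth_wact.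
congr nth; apply/eqP; move: Lb; rewrite (bal_blk p bL) => /andP[Lb _].
move/andP: pb => [pb _].
rewrite -(eqn_add2r (pos (wact M t) (blk (wact M t) p))) subnK //.
rewrite -(eqn_add2r (pos t (M (blk (wact M t) p)))) addnAC subnK //.
exact/eqP/(bL p).
Qed.

(** Since the arrangement is a doubled sequence, the second strand of each pair
    lies in a block, and since it is to the right of its first strand, this
    block is not before the one that starts with the first strand. This defines
    an injection of the finite set of blocks into itself that nowhere
    decreases; it is the identity, so that the strands of each pair are
    neighbours. *)
Lemma bal_exists t t' L :
  (forall p q, is1 (tnth (val (phiS t)) (L p)) -> L q = (L p).+1 :> nat ->
     (p < q)%N) ->
  wact L (phiS t) = phiS t' -> exists M, bal t M L.
Proof.
move=> ord Lt; have letter p : tnth (val (phiS t')) p = tnth (val (phiS t)) (L p).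
  by rewrite -Lt tnth_wact.
pose m r := blk t (L (first_pos t' r)).
have mE r : L (first_pos t' r) = first_pos t (m r).
  by apply: not_is2_first_pos; rewrite -letter; have [] := first_pos_letter t' r.
have m_inj : injective m.
  move=> r r' mm; have : first_pos t' r = first_pos t' r' by apply: (@perm_inj _ L); rewrite !mE mm.
  by move=> /(congr1 (blk t')); rewrite !blk_first_pos.
have tm r : tnth (val t) (m r) = tnth (val t') r.
  have [_ _ <-] := first_pos_letter t (m r); have [_ _ <-] := first_pos_letter t' r.
  by rewrite letter mE.
have tM : wact (perm m_inj) t = t'.
  by apply: wseq_eqP => r; rewrite tnth_wact permE tm.
(* the second strand of the pair that starts at the head of block r *)
have ex_nxt r : {q : 'I_n | tnth (val t') r \in I1 ->
    [/\ L q = (first_pos t (m r)).+1 :> nat, (first_pos t' r < q)%N,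
        is2 (tnth (val (phiS t')) q) & q = (first_pos t' (blk t' q)).+1 :> nat]}.
  have [r1|r1] := boolP (tnth (val t') r \in I1); last by exists (first_pos t' r).
  have head1 : is1 (tnth (val (phiS t)) (first_pos t (m r))).
    by have [_ -> _] := first_pos_letter t (m r); rewrite tm.
  pose q' := Ordinal (nxt_subproof head1).
  have [q'2 _] := nxt_is2 (q := q') head1 erefl.
  exists (L^-1%g q') => _.
  have q2 : is2 (tnth (val (phiS t')) (L^-1%g q')) by rewrite letter permKV.
  have Lq : L (L^-1%g q') = (first_pos t (m r)).+1 :> nat by rewrite permKV.
  split=> //; last by have [] := is2_first_pos q2.
  by apply: ord; rewrite ?mE.
pose nx r := sval (ex_nxt r).
pose f r := if tnth (val t') r \in I1 then blk t' (nx r) else r.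
have nxP r : tnth (val t') r \in I1 ->
    [/\ L (nx r) = (first_pos t (m r)).+1 :> nat, (first_pos t' r < nx r)%N,
        is2 (tnth (val (phiS t')) (nx r)) & nx r = (first_pos t' (blk t' (nx r))).+1 :> nat].
  exact: svalP (ex_nxt r).
have f_ge r : (r <= f r)%N.
  rewrite /f; case: ifP => // r1; have [_ lt_nx _ nxE] := nxP r r1.
  rewrite leqNgt; apply: contraL lt_nx => /(pos_lt I1 t') lt_first_pos.
  by rewrite nxE -leqNgt.
have f_in r : (tnth (val t') (f r) \in I1) = (tnth (val t') r \in I1).
  rewrite /f; case: ifP => // r1; have [_ _ nx2 _] := nxP r r1.
  by have [_ ->] := is2_first_pos nx2.
have f_inj : injective f.
  move=> r r' ff; have := f_in r; rewrite ff f_in => r1E.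
  move: ff; rewrite /f r1E; case: ifP => // r1 bb.
  have [Lr _ _ Er] := nxP r r1; have [Lr' _ _ Er'] := nxP r' (etrans r1E r1).
  have nxx : nx r = nx r' by apply: val_inj; rewrite /= Er Er' bb.
  apply: (m_inj); rewrite -[m r](blk_first_pos I1 t) -[m r'](blk_first_pos I1 t); congr blk.
  by apply: val_inj; apply: succn_inj; rewrite -Lr -Lr' nxx.
exists (perm m_inj) => p; rewrite tM /= permE; set b := blk t' p.
have [p2|p2] := boolP (is2 (tnth (val (phiS t')) p)); last first.
  by rewrite {1 2}(not_is2_first_pos p2) mE /= addnC.
have [pE b1] := is2_first_pos p2; rewrite -/b in pE b1.
have := inj_ge_id f_inj f_ge b; rewrite /f b1 => blk_nx.
have [Lb _ _ nxE] := nxP b b1; rewrite blk_nx -pE in nxE.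
by rewrite -(val_inj nxE) Lb nxE pE /= !addSn addnC.
Qed.
End BalancedPermutations.

(** * The spanning set of the balanced algebra *)

(** Variables that f cannot distinguish may be replaced one at a time. *)
Lemma peval_subm (k : fieldType) (A : pzAlgType k) (W : zmodType) m (x : 'I_m -> A)
    (e : A) (f : A -> W) (s : 'I_m -> 'I_m) :
  (forall p q, GRing.comm (x p) (x q)) -> {morph f : a b / a + b} ->
  (forall a p, f (a * x p * e) = f (a * x (s p) * e)) ->
  forall h a, f (a * peval x h * e) = f (a * peval x (subm s h) * e).
Proof.
move=> xC fD fx; elim/mpoly_gen_ind => [|g h IHg IHh||c g IHg|p g IHg] a.
- by rewrite rmorph0.
- by rewrite rmorphD /= !pevalD !mulrDr !mulrDl !fD IHg IHh.
- by rewrite rmorph1.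
- by rewrite linearZ /= !pevalZ !mulrA IHg.
rewrite rmorphM /= submX !pevalXl // mulrA IHg.
have zC q : a * x q * peval x (subm s g) = a * peval x (subm s g) * x q.
  by rewrite -!mulrA; congr (_ * _); apply: peval_comm => q'; apply: xC.
by rewrite zC fx -zC mulrA.
Qed.

Section Lifts.
Variables (k : fieldType) (G : quiver) (I1 : {set G}) (alpha : {ffun G -> nat}).
Hypothesis no_arrow_I1 : forall a : arrow G,
  ~~ ((source a \in I1) && (target a \in I1)).
Local Notation beta := (phiW I1 alpha).
Local Notation d := (height alpha).
Local Notation n := (height beta).
Local Notation R := (klr k beta).
Local Notation P' := {mpoly k[n]}.
Local Notation P := {mpoly k[d]}.
Local Notation e t := (klr_e (phiS I1 t) : R).
Local Notation X := (@klr_x k _ beta).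
Local Notation bcl := (@bcl k G I1 alpha).
Implicit Types (t : wseq alpha) (a b : R) (h : P').

Lemma bclD a b : bcl (a + b) = bcl a + bcl b.
Proof. by rewrite /bcl -clsD; congr cls; apply: val_inj; rewrite /= mulrDr mulrDl. Qed.

Lemma bclB a b : bcl (a - b) = bcl a - bcl b.
Proof. by apply/(addIr (bcl b)); rewrite -bclD !subrK. Qed.

Lemma bcl0 : bcl 0 = 0.
Proof. by rewrite -[X in bcl X](subrr 0) bclB subrr. Qed.

Lemma bclN a : bcl (- a) = - bcl a.
Proof. by rewrite -sub0r bclB bcl0 sub0r. Qed.

Lemma bcl_sum (J : finType) (f : J -> R) : bcl (\sum_j f j) = \sum_j bcl (f j).
Proof. exact: (big_morph bcl bclD bcl0). Qed.

Lemma bcl_onto s : exists a, bcl a = s.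
Proof.
exists (val (repr s : corner (idem_ord k beta))); rewrite -[RHS]cls_repr.
by congr cls; apply: val_inj; apply/in_cornerP/valP.
Qed.

Lemma bcl_unordered a b j : unordered j -> bcl (a * klr_e j * b) = 0.
Proof.
move=> uj; rewrite -[RHS](rmorph0 (@cls k (corner (idem_ord k beta)) (bal_ideal k beta))).
apply/clsP; exists [:: (a, j, b)]; split; first by rewrite /= uj.
by rewrite subr0 big_seq1 /= !mulrA.
Qed.

Lemma bcl_not_ordered a j : ~~ well_ordered j -> bcl (klr_e j * a) = 0.
Proof.
move=> wj; rewrite -[RHS]bcl0; congr cls; apply: val_inj; rewrite /= mulrA.
rewrite [e_ord k beta * klr_e j]mulr_suml big1 ?mul0r ?mulr0 ?mul0r // => u wu.
by rewrite klr_eM; case: eqP => // uj; rewrite -uj wu in wj.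
Qed.

Lemma e_ordE : e_ord k beta = \sum_t e t.
Proof.
transitivity (\sum_(u in [set phiS I1 t | t in [set: wseq alpha]]) klr_e u : R).
  apply: eq_bigl => u; apply/idP/imsetP => [/wo_phi[t <-]|[t _ ->]].
    by exists t.
  exact: phiS_well_ordered.
rewrite big_imset /=; last by move=> t t' _ _; apply: phiS_inj.
by apply: eq_bigl => t; rewrite inE.
Qed.

Lemma bcl_e_ord a : bcl (a * e_ord k beta) = bcl a.
Proof.
congr cls; apply: val_inj; rewrite /= -!mulrA; congr (_ * (_ * _)).
exact: e_ord_idem.
Qed.

Lemma bcl_sum_e a : bcl a = \sum_t bcl (a * e t).
Proof. by rewrite -bcl_e_ord e_ordE mulr_sumr bcl_sum. Qed.

Lemma count_phi_is12 l : count is1 (phi I1 l) = count is2 (phi I1 l).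
Proof.
elim: l => //= i l IHl; rewrite !count_cat -/(phi I1 l) IHl; congr (_ + _)%N.
by rewrite /phi1; case: split_vert.
Qed.

(** Exchanging the two strands of a pair leaves one more 2 than 1 in the prefix
    that ends there. *)
Lemma unordered_swap t (c : 'I_n.-1) :
  is1 (tnth (val (phiS I1 t)) (lo c)) -> unordered (swap c (phiS I1 t)).
Proof.
case: (blockP t (lo c)) => // a s sa cE _.
have tE : val t = take s (val t) ++ val a :: drop s.+1 (val t) :> seq _.
  by rewrite -sa (tnth_nth (val a)) -drop_nth ?size_tuple // cat_take_drop.
have uE : val (phiS I1 t) = phi I1 (take s (val t)) ++
    [:: v1 a, v2 a & phi I1 (drop s.+1 (val t))] :> seq _.
  rewrite -[LHS]/(phi I1 (tval (val t))) {1}tE phi_cat phi_cons.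
  by rewrite /phi1 split_vert1.
have szE : size (phi I1 (take s (val t))) = c by apply/esym/(congr1 val cE).
apply/existsP; exists (lo c); rewrite (swap_cat uE szE) /= -szE.
rewrite -cat_rcons take_size_cat ?size_rcons // -cats1 !count_cat.
by rewrite count_phi_is12 /= !addn0 addn1 ltnSn.
Qed.

Lemma klr_tau2E c j : klr_tau c * klr_tau c * klr_e j =
  Qpol (tnth (val j) (lo c)) (tnth (val j) (hi c)) (X (lo c)) (X (hi c)) * klr_e j.
Proof.
by rewrite (cls_square (klr_relE (klr_tau2 k c j))) Qpol_rmorph.
Qed.

(** In the balanced algebra, x_p and x_{p+1} agree on the two strands of a
    pair: their difference is the square of the crossing of the two strands,
    which passes through an unordered sequence. *)
Lemma bcl_x a t p : bcl (a * X p * e t) = bcl (a * X (first_pos I1 t (blk t p)) * e t).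
Proof.
case: (blockP t p) => [b r _ ->|b r _ ->|b r rb pE] //.
have lt_c : ((first_pos I1 t r) < n.-1)%N.
  by rewrite -ltnS prednK ?(leq_ltn_trans _ (ltn_ord p)) // -pE.
pose c := Ordinal lt_c.
have pc : p = hi c by apply: val_inj.
have hc : first_pos I1 t r = lo c by apply: val_inj.
rewrite pc hc; apply/eqP; rewrite -subr_eq0 -bclB -mulrBl -mulrBr.
have [lo1 hi2] : tnth (val (phiS I1 t)) (lo c) = v1 b /\
    tnth (val (phiS I1 t)) (hi c) = v2 b.
  have x0 : dvert I1 := v1 b.
  have bnd q : (pos I1 t r <= q <= (pos I1 t r).+1)%N ->
      (pos I1 t r <= q < pos I1 t r.+1)%N.
    by rewrite posS rb phi1_1 addn2.
  rewrite (@tnth_phiS _ I1 _ t r (lo c) x0) ?bnd ?leqnn ?leqnSn //.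
  rewrite (@tnth_phiS _ I1 _ t r (hi c) x0) ?bnd ?leqnn ?leqnSn //.
  by rewrite rb phi1_1 /= subnn subSnn.
have -> : a * (X (hi c) - X (lo c)) * e t = a * klr_tau c * klr_e (swap c (phiS I1 t)) * klr_tau c.
  rewrite -!mulrA -klr_teC; congr (_ * _).
  rewrite mulrA klr_tau2E lo1 hi2; congr (_ * _); rewrite /Qpol /=.
  rewrite narrows_v1v2 eqxx expr1 narrows_base // (narrows_I1 no_arrow_I1) ?expr0 ?mulr1 //;
    exact: (valP b).
by rewrite bcl_unordered // unordered_swap ?lo1.
Qed.

Lemma bcl_res a h t :
  bcl (a * peval X h * e t) = bcl (a * peval X (lft I1 t (res t h)) * e t).
Proof.
rewrite /lft /res subm_comp.
exact: (peval_subm (@klr_xC _ _ _) bclD (fun b p => bcl_x b t p) h a).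
Qed.
End Lifts.

Section RingLemmas.
Variables (k : fieldType) (A : pzAlgType k).

Lemma mul_signed (a b e1 e2 y z : A) (s s' : bool) :
  e2 * e2 = e2 -> b * e1 = e2 * b -> e1 * e1 = e1 ->
  a * e2 = (-1) ^+ s * y -> b * e1 = (-1) ^+ s' * z ->
  a * b * e1 = (-1) ^+ (s (+) s') * (y * z).
Proof.
move=> e22 be e11 ay bz; rewrite -mulr_signM -ay -bz.
by rewrite -!mulrA; congr (a * _); rewrite be !mulrA e22.
Qed.

Lemma peval_pushD (W : zmodType) m (x : 'I_m -> A) (f : A -> W) (a : A) g h :
  {morph f : b c / b + c} ->
  f (a * peval x (g + h)) = f (a * peval x g) + f (a * peval x h).
Proof. by move=> fD; rewrite pevalD mulrDr fD. Qed.

Lemma mul_peval0 m (x : 'I_m -> A) (b z : A) : b * peval x 0 * z = 0.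
Proof. by rewrite peval0 mulr0 mul0r. Qed.

Lemma push_middle (a z e1 y : A) : z * e1 = e1 * z -> a * e1 = y -> a * z * e1 = y * z.
Proof. by move=> ze <-; rewrite -mulrA ze mulrA. Qed.

Lemma push_left (a z e1 e2 : A) :
  z * e1 = e1 * z -> a * e1 = e2 * a -> a * z * e1 = e2 * (a * z).
Proof. by move=> ze ae; rewrite -mulrA ze mulrA ae mulrA. Qed.

Lemma push_last (a b z e1 e2 : A) : z * e1 = e1 * z -> b * e1 = e2 * b ->
  a * b * z * e1 = a * e2 * (b * z).
Proof. by move=> ze be; rewrite -!mulrA ze (mulrA b) be -mulrA. Qed.
End RingLemmas.

Section Spanning.
Variables (k : fieldType) (G : quiver) (I1 : {set G}) (alpha : {ffun G -> nat}).
Hypothesis no_arrow_I1 : forall a : arrow G,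
  ~~ ((source a \in I1) && (target a \in I1)).
Local Notation beta := (phiW I1 alpha).
Local Notation d := (height alpha).
Local Notation n := (height beta).
Local Notation R := (klr k beta).
Local Notation S := (bal_klr k beta).
Local Notation P := {mpoly k[d]}.
Local Notation e t := (klr_e (phiS I1 t) : R).
Local Notation X := (@klr_x k _ beta).
Local Notation T := (@klr_tau k _ beta).
Local Notation bcl := (@bcl k G I1 alpha).
Implicit Types (t : wseq alpha) (v : seq 'I_d.-1) (g h : P) (M : 'S_d) (L : 'S_n).

(** The element of the doubled algebra that corresponds to tau_v e(t). *)
Fixpoint tauR t v : R :=
  if v is r :: v' then tau_elt k I1 (wact (wperm v') t) r * tauR t v' else e t.

(** Replacing each letter of an ascending word by the crossing of two blocks gives
    an ascending word, since the blocks involved have not met before. *)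
Lemma tauR_expand t v : up v -> exists u, [/\ up u,
  exists b : bool, tau_word T u * e t = (-1) ^+ b * tauR t v & bal t (wperm v) (wperm u)].
Proof.
have ee j : klr_e j * klr_e j = klr_e j :> R by rewrite klr_eM eqxx.
elim: v => [_|r v IHv].
  by exists [::]; split=> //; [exists false; rewrite tau_word0 expr0 | exact: bal1].
rewrite up_cons => /andP[/IHv[u [up_u [b uE] bal_u]] lt_r].
have [w [[c wE] bal_w up_w]] := cross k I1 (wact (wperm v) t) r.
exists (w ++ u); split.
- by apply: up_w => // p q pE qE; apply: (bal_lt bal_u); rewrite pE qE.
- exists (c (+) b); rewrite tau_word_cat.
  apply: (mul_signed (ee _) _ (ee _) wE uE).
  by rewrite -(bal_phi bal_u); apply: (tau_word_e (@klr_teC _ _ _)).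
by rewrite wperm_cat wperm_cons; apply: bal_mul.
Qed.

(** The image of tau_v g(x) e(t), in the spanning set of the balanced algebra. *)
Definition nf t v g : S := bcl (tauR t v * peval X (lft I1 t g)).

Lemma nfD t v g h : nf t v (g + h) = nf t v g + nf t v h.
Proof.
rewrite /nf [lft I1 t _]rmorphD; exact: (peval_pushD _ _ _ _ (@bclD k G I1 alpha)).
Qed.

Lemma nf0 t v : nf t v 0 = 0.
Proof. by apply: (addrI (nf t v 0)); rewrite -nfD !addr0. Qed.

Lemma nfN t v g : nf t v (- g) = - nf t v g.
Proof. by apply/eqP; rewrite -addr_eq0 -nfD addNr nf0. Qed.

Variable sel : 'S_d -> seq 'I_d.-1.
Hypotheses (sel_up : forall M, up (sel M)) (selK : forall M, wperm (sel M) = M).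

Definition nfspan t (s : S) := exists c : 'S_d -> P, s = \sum_M nf t (sel M) (c M).

Lemma nfspan0 t : nfspan t 0.
Proof. by exists (fun=> 0); rewrite big1 // => M _; apply: nf0. Qed.

Lemma nfspanD t s s' : nfspan t s -> nfspan t s' -> nfspan t (s + s').
Proof.
move=> [c ->] [c' ->]; exists (fun M => c M + c' M); rewrite -big_split /=.
by apply: eq_bigr => M _; rewrite nfD.
Qed.

Lemma nfspanN t s : nfspan t s -> nfspan t (- s).
Proof.
move=> [c ->]; exists (fun M => - c M); rewrite -sumrN.
by apply: eq_bigr => M _; rewrite nfN.
Qed.

Lemma nfspan_nf t M g : nfspan t (nf t (sel M) g).
Proof.
exists (fun M' => if M' == M then g else 0); rewrite (bigD1 M) //= eqxx big1 ?addr0 //.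
by move=> M' /negPf ->; apply: nf0.
Qed.

(** If L reverses a pair, the word is chosen so that it starts by crossing this
    pair, which passes through an unordered sequence. If L leads to a sequence
    that is not well-ordered, the idempotent of the corner kills it. Otherwise L
    permutes the blocks, and the word is a product of crossings of blocks. *)
Lemma good_word t L : exists u, [/\ up u, wperm u = L &
  forall f : {mpoly k[n]}, nfspan t (bcl (tau_word T u * peval X f * e t))].
Proof.
have Xe (f : {mpoly k[n]}) : peval X f * e t = e t * peval X f by apply: peval_e; apply: klr_xeC.
have [/existsP[p /existsP[q /and3P[p1 /eqP Lq le_qp]]]|ord] :=
  boolP [exists p, exists q : 'I_n,
    [&& is1 (tnth (val (phiS I1 t)) (L p)), L q == (L p).+1 :> nat & (q <= p)%N]].
  have lt_c : (L p < n.-1)%N by rewrite ltn_predRL -Lq.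
  pose c := Ordinal lt_c; have Lp : L p = lo c by apply: val_inj.
  have ltq : (q < p)%N.
    rewrite ltn_neqAle le_qp andbT; apply/negP => /eqP/val_inj qp.
    by move: Lq; rewrite qp => /n_Sn.
  have [u [up_u uL]] : exists u, up (u ++ [:: c]) /\ wperm (u ++ [:: c]) = L.
    apply: up_ending => p' q'; rewrite -Lp => /perm_inj -> Lq'.
    by rewrite (_ : q' = q) //; apply: (@perm_inj _ L); apply: val_inj; rewrite Lq' /= Lq.
  exists (u ++ [:: c]); split=> // f.
  rewrite tau_word_cat tau_word_cons tau_word0 mulr1 (push_last _ (Xe f) (klr_teC k c (phiS I1 t))).
  rewrite bcl_unordered; first exact: nfspan0.
  by apply: unordered_swap; rewrite -Lp.
have [wL|wL] := boolP (well_ordered (wact L (phiS I1 t))); last first.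
  have [u up_u uL] := up_exists L; exists u; split=> // f.
  rewrite (push_left (Xe f) (tau_word_e (@klr_teC _ _ _) _ _)) uL bcl_not_ordered //.
  exact: nfspan0.
have [t' t'E] := wo_phi wL.
have [M bal_M] : exists M, bal t M L.
  apply: (bal_exists (t' := t')) => // p q p1 Lq; rewrite ltnNge.
  apply: contra ord => le_qp; apply/existsP; exists p; apply/existsP; exists q.
  by rewrite p1 Lq eqxx.
have [u [up_u [b uE] bal_u]] := tauR_expand t (sel_up M).
rewrite selK in bal_u; exists u; split=> // [|f]; first exact: bal_uniq bal_u bal_M.
rewrite bcl_res // (push_middle (Xe _) uE).
have := nfspan_nf t M (res t f); rewrite /nf.
set z := tauR t _; set y := peval X _.
case: b {uE}; rewrite ?expr1 ?mulN1r ?mulNr ?expr0 ?mul1r // => /nfspanN.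
by rewrite -bclN.
Qed.

Lemma bal_span (s : S) : exists c : wseq alpha -> 'S_d -> P,
  s = \sum_t \sum_M nf t (sel M) (c t M).
Proof.
have [a <-] := bcl_onto s.
have span_t t : nfspan t (bcl (a * e t)).
  have [w wP] := choice (good_word t).
  have [c ->] := klr_span (phiS I1 t) a
    (fun L => let: And3 up_w _ _ := wP L in up_w)
    (fun L => let: And3 _ wL _ := wP L in wL).
  rewrite bcl_sum; apply: (big_ind (nfspan t)) => [||L _].
  - exact: nfspan0.
  - exact: nfspanD.
  by have [_ _] := wP L; apply.
have [c cE] := choice span_t.
by exists c; rewrite bcl_sum_e; apply: eq_bigr => t _; apply: cE.
Qed.
End Spanning.

(** * Comparison of the two algebras *)

Section Comparison.
Variables (k : fieldType) (G : quiver) (I1 : {set G}) (alpha : {ffun G -> nat}).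
Hypothesis no_arrow_I1 : forall a : arrow G,
  ~~ ((source a \in I1) && (target a \in I1)).
Local Notation beta := (phiW I1 alpha).
Local Notation d := (height alpha).
Local Notation R := (klr k alpha).
Local Notation S := (bal_klr k beta).
Local Notation P := {mpoly k[d]}.
Local Notation V := {ffun wseq alpha -> P}.
Local Notation e t := (klr_e (phiS I1 t) : klr k beta).
Local Notation nf := (@nf k G I1 alpha).
Implicit Types (t : wseq alpha) (f g : P) (v : V) (a b : R) (s : S).

HB.instance Definition _ s :=
  GRing.isLinear.Build k V V _ (@bal_act k G I1 alpha s) (bal_act_is_linear s).

Lemma bal_act_nf t (u : seq 'I_d.-1) g t' f : bal_act (nf t u g) (single t' f) =
  if t == t' then single (wact (wperm u) t) (word_op u t (g * f)) else 0.
Proof.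
rewrite bal_act_bcl; set z := peval _ _.
elim: u => [|r u IHu] /=.
  rewrite pol_actM lftv_single pol_act_peval pol_act_e (inj_eq (@phiS_inj G I1 alpha)).
  case: eqP => [<-|_]; last exact: linear0.
  by rewrite resv_single rmorphM /= !resK wact1.
have tauE : tau_elt k I1 (wact (wperm u) t) r * e_ord k beta =
    tau_elt k I1 (wact (wperm u) t) r := corner_mulr (tau_elt_corner k I1 _ r).
have assoc : tau_elt k I1 (wact (wperm u) t) r * tauR k I1 t u * z =
    tau_elt k I1 (wact (wperm u) t) r * e_ord k beta * (tauR k I1 t u * z).
  by rewrite tauE; apply: esym (mulrA _ _ _).
rewrite assoc resv_pol_actM IHu.
case: eqP => _; last by rewrite !linear0.
by rewrite res_tau_elt // wact_swap wactM.
Qed.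

Variable sel : 'S_d -> seq 'I_d.-1.
Hypotheses (sel_up : forall M, up (sel M)) (selK : forall M, wperm (sel M) = M).
Implicit Type c : wseq alpha -> 'S_d -> P.

Definition nfR c : R :=
  \sum_t \sum_M tau_word klr_tau (sel M) * peval klr_x (c t M) * klr_e t.
Definition nfS c : S := \sum_t \sum_M nf t (sel M) (c t M).
(** The operator by which the elements with coefficients c act, on both sides. *)
Definition op c t f : V := \sum_M single (wact M t) (word_op (sel M) t (c t M * f)).

Lemma nfR_act c t f : pol_act (nfR c) (single t f) = op c t f.
Proof.
rewrite /nfR pol_act_sum (bigD1 t) //= [X in _ + X]big1 ?addr0 => [|t' tt'].
  rewrite pol_act_sum; apply: eq_bigr => M _.
  by rewrite pol_actM pol_act_e eqxx pol_actM pol_act_peval pol_act_tau_word selK.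
rewrite pol_act_sum big1 // => M _; rewrite pol_actM pol_act_e (negPf tt').
exact: linear0.
Qed.

Lemma nfS_act c t f : bal_act (nfS c) (single t f) = op c t f.
Proof.
have bal_act0 w : bal_act (0 : S) w = 0.
  by apply: (addrI (bal_act (0 : S) w)); rewrite -bal_actD !addr0.
have bal_act_sum (J : finType) (F : J -> S) w : bal_act (\sum_j F j) w = \sum_j bal_act (F j) w.
  by apply: (big_morph (fun s => bal_act s w) (fun s s' => bal_actD s s' w) (bal_act0 w)).
rewrite /nfS bal_act_sum (bigD1 t) //= [X in _ + X]big1 ?addr0 => [|t' tt'].
  rewrite bal_act_sum; apply: eq_bigr => M _.
  by rewrite bal_act_nf // eqxx selK.
by rewrite bal_act_sum big1 // => M _; rewrite bal_act_nf // (negPf tt').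
Qed.

Lemma op_inj c : (forall t f, op c t f = 0) -> forall t M, c t M = 0.
Proof.
move=> c0 t; apply: (word_op_indep sel_up selK) => f.
transitivity (\sum_j op c t f j); last by rewrite c0 big1 // => j _; rewrite ffunE.
under [RHS]eq_bigr do rewrite sum_ffunE.
rewrite exchange_big /=; apply: eq_bigr => M _.
rewrite (bigD1 (wact M t)) //= ffunE eqxx big1 ?addr0 //.
by move=> j /negPf jt; rewrite ffunE jt.
Qed.

Lemma nfR_onto a : exists c, a = nfR c.
Proof.
have [c cE] := choice (fun t => klr_span t a sel_up selK).
exists c; rewrite -[LHS]mulr1 -sum_klr_e mulr_sumr.
by apply: eq_bigr => t _; apply: cE.
Qed.

Lemma nfR0 c : (forall t M, c t M = 0) -> nfR c = 0.
Proof.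
move=> c0; apply: big1 => t _; apply: big1 => M _; rewrite c0.
exact: mul_peval0.
Qed.

Lemma pol_act_inj a : (forall v, pol_act a v = 0) -> a = 0.
Proof.
have [c ->] := nfR_onto a => c0; apply/nfR0/op_inj => t f.
by rewrite -nfR_act.
Qed.

Lemma bal_act_inj s s' : (forall v, bal_act s v = bal_act s' v) -> s = s'.
Proof.
move=> ss'; apply/eqP; rewrite -subr_eq0; apply/eqP.
have [c cE] := bal_span no_arrow_I1 sel_up selK (s - s').
rewrite cE; apply: big1 => t _; apply: big1 => M _.
rewrite (op_inj (c := c)) ?nf0 // => {M}t' f.
rewrite -nfS_act -[nfS c]cE; apply: (addIr (bal_act s' (single t' f))).
by rewrite -bal_actD subrK add0r ss'.
Qed.

Lemma act_single (h h' : {linear V -> V}) :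
  (forall t f, h (single t f) = h' (single t f)) -> forall v, h v = h' v.
Proof.
move=> hh v; rewrite (single_sum v) !linear_sum; apply: eq_bigr => t _; exact: hh.
Qed.

Lemma same_act c v : bal_act (nfS c) v = pol_act (nfR c) v.
Proof.
apply: (act_single (h := bal_act (nfS c)) (h' := pol_act (nfR c))) => t f.
exact: etrans (nfS_act c t f) (esym (nfR_act c t f)).
Qed.

Lemma bal_act_ex a : exists s, forall v, bal_act s v = pol_act a v.
Proof. by have [c ->] := nfR_onto a; exists (nfS c) => v; apply: same_act. Qed.

Lemma pol_act_ex s : exists a, forall v, bal_act s v = pol_act a v.
Proof.
have [c ->] := bal_span no_arrow_I1 sel_up selK s.
by exists (nfR c) => v; apply: same_act.
Qed.
End Comparison.


Section Values.
Variables (k : fieldType) (G : quiver) (I1 : {set G}) (alpha : {ffun G -> nat}).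
Hypothesis no_arrow_I1 : forall a : arrow G,
  ~~ ((source a \in I1) && (target a \in I1)).
Local Notation d := (height alpha).
Implicit Types (t : wseq alpha) (v : {ffun wseq alpha -> {mpoly k[d]}}).
Local Notation R := (klr k alpha).
Local Notation e t := (klr_e (phiS I1 t) : klr k (phiW I1 alpha)).

Lemma pol_act_e_lftv_phi t v : pol_act (e t) (lftv I1 v) = lftv I1 (single t (v t)).
Proof. by rewrite pol_act_klr_e lftv_phiS lftv_single. Qed.

Lemma bal_act_e t v : bal_act (bal_e k I1 t) v = pol_act (klr_e t : R) v.
Proof.
rewrite bal_act_cls /= pol_act_e_lftv_phi lftv_single resv_single resK.
exact/esym/pol_act_klr_e.
Qed.

Lemma bal_act_x t (r : 'I_d) v :
  bal_act (xstar k I1 r * bal_e k I1 t) v = pol_act (klr_x r * klr_e t : R) v.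
Proof.
rewrite xstarE bal_act_cls /= /x_elt pol_actM pol_act_e_lftv_phi lftv_single.
have -> : klr_xn (pos I1 t r) = klr_x (first_pos I1 t r) :> klr k (phiW I1 alpha).
  by rewrite /klr_xn (insubT (fun i => i < _)%N (pos_x_lt I1 t r)).
rewrite pol_act_x resv_single rmorphM /= resK [res t _]submX blk_first_pos.
by rewrite pol_actM pol_act_klr_e pol_act_x.
Qed.

Lemma bal_act_tau t (r : 'I_d.-1) v :
  bal_act (taustar k I1 r * bal_e k I1 t) v = pol_act (klr_tau r * klr_e t : R) v.
Proof.
rewrite taustarE bal_act_cls /=; have := tau_eltM k I1 t r t; rewrite eqxx => <-.
rewrite pol_actM pol_act_e_lftv_phi res_tau_elt //.
by rewrite pol_actM pol_act_klr_e pol_act_tau.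
Qed.
End Values.

Theorem theorem2p12 (k : fieldType) (G : quiver) (I1 : {set G})
    (alpha : {ffun G -> nat})
    (no_loop : forall a : arrow G, source a != target a)
    (no_arrow_I1 : forall a : arrow G,
      ~~ ((source a \in I1) && (target a \in I1))) :
  exists Phi : {rmorphism klr k alpha -> bal_klr k (phiW I1 alpha)},
    [/\ bijective Phi,
        scalable Phi,
        forall i : wseq alpha, Phi (klr_e i) = bal_e k I1 i,
        forall (i : wseq alpha) (r : 'I_(height alpha)),
          Phi (klr_x r * klr_e i) = xstar k I1 r * bal_e k I1 i
      & forall (i : wseq alpha) (r : 'I_(height alpha).-1),
          Phi (klr_tau r * klr_e i) = taustar k I1 r * bal_e k I1 i].
Proof.
have ex_word (M : 'S_(height alpha)) : exists u, up u /\ wperm u = M.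
  by have [u] := up_exists M; exists u.
have [sel selP] := choice ex_word.
have sel_up M := proj1 (selP M); have selK M := proj2 (selP M).
(* F maps a to the only element of the balanced algebra that acts as a *)
have [F FE] := choice (@bal_act_ex k _ _ _ no_arrow_I1 _ sel_up selK).
have eqF := @bal_act_inj k _ _ _ no_arrow_I1 _ sel_up selK.
have [F' FE'] := choice (@pol_act_ex k _ _ _ no_arrow_I1 _ sel_up selK).
have F_zmod : zmod_morphism F.
  move=> a b; apply: eqF => v; rewrite FE pol_actD pol_actN -!FE.
  exact: esym (bal_actB _ _ _).
have F_monoid : monoid_morphism F.
  split=> [|a b]; apply: eqF => v; last by rewrite FE pol_actM bal_actM !FE.
  by rewrite FE pol_act1 -(rmorph1 (@pzscal k _)) bal_act_scal scale1r.
pose Phi : {rmorphism klr k alpha -> bal_klr k (phiW I1 alpha)} :=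
  HB.pack F (GRing.isZmodMorphism.Build _ _ F F_zmod)
    (GRing.isMonoidMorphism.Build _ _ F F_monoid).
exists Phi; split=> [|c a|t|t r|t r]; last 4 first.
- apply: eqF => v; rewrite [LHS]FE.
  apply: etrans (esym (bal_actM _ _ _)).
  by rewrite bal_act_scal FE [LHS]pol_actM pol_act_scal.
- by apply: eqF => v; rewrite [LHS]FE bal_act_e.
- by apply: eqF => v; rewrite [LHS]FE bal_act_x.
- by apply: eqF => v; rewrite [LHS]FE bal_act_tau.
exists F' => [a|s]; last by apply: eqF => v; rewrite [LHS]FE FE'.
apply/eqP; rewrite -subr_eq0; apply/eqP.
apply: (pol_act_inj sel_up selK) => v.
by rewrite pol_actD pol_actN -FE' FE subrr.
Qed.
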